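(* Let $\alpha>1$ be an irrational number. As the integer $n\to\infty$, $$q_{\alpha}(n)\sim \frac{\exp\left(\pi\sqrt{\frac{n}{3\alpha}}\right)}{2^{2-\frac{1}{2\alpha}}(3\alpha)^{1/4}n^{3/4}},$$ and $$p_{\alpha}(n)=\frac{\exp\left(2\pi\sqrt{\frac{n}{6\alpha}}\right)}{n^{1-\frac{1}{4\alpha}+o(1)}}.$$ Furthermore, if the series $J_{\alpha}(1)=\sum_{\ell\ge 1}\frac{\widetilde{B}_1(\alpha\ell)}{\ell}$ is convergent, then, as $n\to\infty$, $$p_{\alpha}(n)\sim \frac{\exp\left(2\pi\sqrt{\frac{n}{6\alpha}}\right)}{\Lambda_{\alpha}\, n^{1-\frac{1}{4\alpha}}},$$ where, with $\gamma$ denoting the Euler–Mascheroni constant, $$\Lambda_{\alpha}=4\sqrt{3}\,(\pi e^{-\gamma})^{\frac{1}{2\alpha}}\left(\frac{\alpha}{6}\right)^{\frac{1}{4\alpha}}\prod_{\ell\ge 1}\left(1-\frac{\{\alpha \ell\}}{\alpha \ell}\right)e^{\frac{1}{2\alpha \ell}}.$$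
   Context: $\lfloor x\rfloor$ is the largest integer $\le x$, $\{x\}=x-\lfloor x\rfloor$ is the fractional part, and $\widetilde{B}_1(x)=\{x\}-\tfrac12$. The Beatty sequence of $\alpha$ is $(\lfloor\alpha m\rfloor)_{m\in\mathbb{N}}$, $\mathbb{N}=\{1,2,3,\ldots\}$. $p_{\alpha}(n)$ is the number of partitions of $n$ (non-increasing sequences of positive integers with sum $n$) all of whose summands belong to the Beatty sequence of $\alpha$ (repetitions allowed); $q_{\alpha}(n)$ is the number of partitions of $n$ into pairwise distinct summands belonging to the Beatty sequence of $\alpha$. Convergence of the series and the infinite product is understood in the sense of limits of the partial sums/products over $1\le \ell\le N$ as $N\to\infty$. *)

(* Defs.v *)
From HB Require Import structures.
From mathcomp Require Export all_boot all_order all_algebra.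
From mathcomp Require Export finmap.
From mathcomp Require Export all_classical all_reals all_analysis.

Set Implicit Arguments.
Unset Strict Implicit.
Unset Printing Implicit Defensive.

Export Order.TTheory GRing.Theory Num.Theory.
Export numFieldNormedType.Exports.

Local Open Scope classical_set_scope.
Local Open Scope ring_scope.

Definition frac_part (R : realType) (x : R) : R := x - (Num.floor x)%:~R.

Definition bernoulli1 (R : realType) (x : R) : R := frac_part x - 2^-1.

(* [ln 0 = 0] in the library; only the limit matters. *)
Definition euler_gamma (R : realType) : R :=
  limn (fun N : nat => \sum_(1 <= k < N.+1) (k%:R : R)^-1 - ln (N%:R : R)).

Definition in_beatty (R : realType) (alpha : R) (k : nat) : Prop :=
  exists2 m : nat, (0 < m)%N & Num.floor (alpha * m%:R) = k%:Z.

Definition partitions (n : nat) : set (seq nat) :=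
  [set s | [/\ sorted geq s, all (leq 1) s & sumn s = n]].

Definition beatty_partitions (R : realType) (alpha : R) (n : nat) :
    set (seq nat) :=
  [set s | partitions n s /\ {in s, forall k : nat, in_beatty alpha k}].

Definition distinct_beatty_partitions (R : realType) (alpha : R) (n : nat) :
    set (seq nat) :=
  [set s | beatty_partitions alpha n s /\ uniq s].

(* [fset_set] is the empty set on infinite sets; the next facts show that this
   default is never used below. *)
Lemma finite_partitions (n : nat) : finite_set (partitions n).
Proof.
apply: (@sub_finite_set _ _
  ((fun t : n.-bseq 'I_n.+1 => map val (bseqval t)) @` [set: _])); last first.
  by apply: finite_image.
move=> s [_ s_gt0 s_sum].
have s_size : (size s <= n)%N.
  rewrite -s_sum; elim: s s_gt0 {s_sum} => //= k s IHs /andP[k_gt0 /IHs].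
  by rewrite -add1n; apply: leq_add.
have s_le k : k \in s -> (k < n.+1)%N.
  rewrite ltnS -s_sum; elim: s {s_gt0 s_sum s_size} => //= a s IHs.
  rewrite inE => /predU1P[->|/IHs k_le]; first exact: leq_addr.
  exact: leq_trans k_le (leq_addl _ _).
have t_size : (size (map (@inord n) s) <= n)%N by rewrite size_map.
exists (Bseq t_size) => //=.
rewrite -map_comp -[RHS]map_id; apply/eq_in_map => k /s_le k_le /=.
by rewrite inordK.
Qed.

Lemma finite_beatty_partitions (R : realType) (alpha : R) (n : nat) :
  finite_set (beatty_partitions alpha n).
Proof. by apply: sub_finite_set (finite_partitions n) => s []. Qed.

Lemma finite_distinct_beatty_partitions (R : realType) (alpha : R) (n : nat) :
  finite_set (distinct_beatty_partitions alpha n).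
Proof. by apply: sub_finite_set (finite_beatty_partitions alpha n) => s []. Qed.

Definition p_beatty (R : realType) (alpha : R) (n : nat) : nat :=
  #|` fset_set (beatty_partitions alpha n)|.

Definition q_beatty (R : realType) (alpha : R) (n : nat) : nat :=
  #|` fset_set (distinct_beatty_partitions alpha n)|.

Definition J1_partial (R : realType) (alpha : R) (N : nat) : R :=
  \sum_(1 <= l < N.+1) bernoulli1 (alpha * l%:R) / l%:R.

Definition Lambda_prod_partial (R : realType) (alpha : R) (N : nat) : R :=
  \prod_(1 <= l < N.+1)
    ((1 - frac_part (alpha * l%:R) / (alpha * l%:R))
     * expR (1 / (2 * alpha * l%:R))).

Definition Lambda (R : realType) (alpha : R) : R :=
  4 * Num.sqrt 3 * (pi * expR (- euler_gamma R)) `^ (1 / (2 * alpha))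
  * (alpha / 6) `^ (1 / (4 * alpha))
  * limn (Lambda_prod_partial alpha).

(* Main.v *)
From mathcomp Require Import ring lra zify measurable_realfun.
Require Import Defs.

(** Let [a m] be the integer part of [alpha * m]. For a positive [x] give every partition into
parts [a m] with [m <= n] the weight [expR (- x * sum)]. The multiplicities of the parts are then
independent, geometric for repeated parts and Bernoulli for distinct parts, and the number of
partitions of [n] is the probability that the sum of the parts equals [n], times [expR (x * n)], times
the generating function at [expR (- x)]. The number [x] is chosen so that the expected sum is about
[n]; this gives [x = sqrt (growth / n)] with [growth = pi ^+ 2 / (6 * alpha)] for repeated parts, and
[growth] is half as large for distinct parts. Two quantities remain to be estimated.

The probability. It is a Fourier coefficient of the characteristic function of the sum
([fourier_prob], proved by recursion in the number of parts). Near the angle 0 the characteristic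
function is a Gaussian, by second order expansions of its factors ([ln_amp_approx], [pha_approx]) and
Riemann sums for mean and variance ([sum_socc], [sum_vocc]). At larger angles it is negligible
([amp_dominated]): because [alpha] is irrational, both possible differences of consecutive parts occur
in every window of bounded length, and two differences that differ by 1 keep the angles of the
parts away from a common period ([window_bound]). Dominated convergence gives the local limit theorem
([local_limit]): the probability is asymptotically the peak of a Gaussian density.

The generating function. Its logarithm is a sum of values [lgeo (x * a m)], where
[lgeo t = - ln (1 - expR (- t))]. With the integers in place of the [a m] it is evaluated by the trapezoid
rule and Stirling's formula ([sum_lgeo_grid]); passing to [a m] costs the logarithm of the product
in [Lambda] and a sum of the values of [bernoulli1] with smooth weights ([sum_lgeo_asymp]). The
fractional parts of the multiples of [alpha] have mean 1/2 ([bernoulli1_discrepancy]), so summation by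
parts bounds the fractional contribution by [o (ln n)], and makes it converge as soon as the series
[J1_partial] does. This gives the two statements about [p_beatty]. For distinct parts the generating
function is a quotient of two such products, at [x] and [2 * x], in which the fractional
contributions cancel ([beatty_error_double]); so the asymptotics of [q_beatty] hold for every irrational
[alpha].

No complex numbers are used: the characteristic function is handled through its modulus and its
argument. *)

Set Implicit Arguments.
Unset Strict Implicit.
Unset Printing Implicit Defensive.

Local Open Scope classical_set_scope.
Local Open Scope ring_scope.

(** * Recursions for partitions into increasing parts *)

Section Counting.
Variable a : nat -> nat.
Hypothesis a_mono : {homo a : i j / (i < j)%N}.

(** The parts are indexed from 1: [M] bounds the indices, not the parts. *)
Definition parts_among (M : nat) (s : seq nat) : Prop :=
  {in s, forall k, exists2 m, (0 < m <= M)%N & a m = k}.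

Definition parts_set (M n : nat) : set (seq nat) :=
  [set s | [/\ sorted geq s, sumn s = n & parts_among M s]].

Definition dparts_set (M n : nat) : set (seq nat) :=
  [set s | parts_set M n s /\ uniq s].

Lemma index_le_part m : (m <= a m)%N.
Proof.
elim: m => // m IH.
by apply: (leq_ltn_trans IH); apply: a_mono.
Qed.

Lemma parts_among_cons M k s : parts_among M (k :: s) <->
  (exists2 m, (0 < m <= M)%N & a m = k) /\ parts_among M s.
Proof.
split=> [H|[H1 H2]].
  split; first by apply: H; rewrite mem_head.
  by move=> j js; apply: H; rewrite inE js orbT.
by move=> j; rewrite inE => /predU1P[->//|]; apply: H2.
Qed.

Lemma finite_parts_set M n : finite_set (parts_set M n).
Proof.
apply: sub_finite_set (finite_partitions n) => s [s1 s2 s3]; split => //.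
apply/allP => k /s3[m /andP[m0 _] <-].
exact: leq_trans m0 (index_le_part m).
Qed.

Lemma finite_dparts_set M n : finite_set (dparts_set M n).
Proof. by apply: sub_finite_set (finite_parts_set M n) => s []. Qed.

Definition nparts M n : nat := #|` fset_set (parts_set M n)|.
Definition ndparts M n : nat := #|` fset_set (dparts_set M n)|.

Lemma card_fset_set_cons (A B : set (seq nat)) k :
  finite_set A -> finite_set B -> (forall s, A (k :: s) -> False) ->
  #|` fset_set (A `|` (cons k @` B))| =
  (#|` fset_set A| + #|` fset_set B|)%N.
Proof.
move=> fA fB AB.
have fI : finite_set (cons k @` B) by apply: finite_image.
rewrite fset_setU// cardfsU (_ : fset_set A `&` fset_set (cons k @` B) = fset0)%fset.
  by rewrite cardfs0 subn0 fset_set_image// card_imfset// => s t [].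
apply/fsetP => s; rewrite !inE; apply/negP => /andP[].
rewrite !in_fset_set// !inE => As [t Bt ts].
by apply: (AB t); rewrite ts.
Qed.

Lemma parts_among_sub M M' s :
  (M <= M')%N -> parts_among M s -> parts_among M' s.
Proof.
move=> MM H k /H[m /andP[m0 mM] <-]; exists m => //.
by rewrite m0 (leq_trans mM).
Qed.

Lemma sorted_geq_consE k s :
  sorted geq (k :: s) = all (fun j => j <= k)%N s && sorted geq s.
Proof.
rewrite /= path_sortedE; last by move=> x y z /= yx zy; apply: leq_trans zy yx.
by congr (_ && _); apply: eq_all.
Qed.

Lemma parts_among_below M s k :
  parts_among M.+1 (k :: s) -> sorted geq (k :: s) -> k <> a M.+1 ->
  parts_among M (k :: s).
Proof.
move=> H sk ka j js.
have [i /andP[i0 iM] ij] := H _ js.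
exists i => //; rewrite i0 /=.
have jk : (j <= k)%N.
  move: js; rewrite inE => /predU1P[->//|js].
  by move: sk; rewrite sorted_geq_consE => /andP[/allP/(_ _ js)].
have [i' /andP[_ i'M] i'k] := H k (mem_head _ _).
have kM : (k < a M.+1)%N.
  rewrite ltn_neqAle; apply/andP; split; first exact/eqP.
  by rewrite -i'k; move: i'M; rewrite leq_eqVlt => /predU1P[->//|/a_mono/ltnW].
rewrite -ltnS ltn_neqAle iM andbT; apply/eqP => iE.
by move: (leq_ltn_trans jk kM); rewrite -ij iE ltnn.
Qed.

(** This keeps the two cases of [parts_setS] and [dparts_setS] disjoint. *)
Lemma part_notin M s : parts_among M s -> a M.+1 \notin s.
Proof.
move=> H; apply/negP => /H[m /andP[_ mM] E].
by have := a_mono (mM : (m < M.+1)%N); rewrite E ltnn.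
Qed.

(** A partition into the first [M.+1] parts either avoids the largest part, or starts
with it; this is the recursion in [M] that the Fourier integrals will satisfy too. *)
Lemma parts_setS M n : parts_set M.+1 n =
  parts_set M n `|` (cons (a M.+1) @`
    (if (a M.+1 <= n)%N then parts_set M.+1 (n - a M.+1) else set0)).
Proof.
apply/seteqP; split=> [s|s [[s1 s2 s3]|]].
- case: s => [|k s] [s1 s2 s3].
    by left; split => // k; rewrite in_nil.
  have [kE|/eqP kE] := eqVneq k (a M.+1); last first.
    by left; split => //; apply: parts_among_below.
  right; exists s; last by rewrite kE.
  have an : (a M.+1 <= n)%N by rewrite -s2 /= kE leq_addr.
  rewrite an; split.
  - by move: s1; rewrite sorted_geq_consE => /andP[].
  - by rewrite -s2 /= kE addKn.
  - by move/parts_among_cons: s3 => [].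
- by split => //; apply: parts_among_sub s3.
- move=> [t + <-]; case: ifPn => // an [t1 t2 t3]; split.
  + rewrite sorted_geq_consE t1 andbT; apply/allP => j /t3[m /andP[_ mM] <-].
    by move: mM; rewrite leq_eqVlt => /predU1P[->//|/a_mono/ltnW].
  + by rewrite /= t2 subnKC.
  + by apply/parts_among_cons; split=> //; exists M.+1; rewrite ?leqnn.
Qed.

Lemma dparts_setS M n : dparts_set M.+1 n =
  dparts_set M n `|` (cons (a M.+1) @`
    (if (a M.+1 <= n)%N then dparts_set M (n - a M.+1) else set0)).
Proof.
apply/seteqP; split=> [s [+ us]|s [[+ us]|]].
- rewrite parts_setS => -[ps|[t + E]]; first by left.
  rewrite -{s}E in us *.
  case: ifPn => // an [t1 t2 t3]; right; exists t => //.
  move: us => /= /andP[at_ ut].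
  split=> //; split => //.
  case: t t1 t3 at_ {t2 ut} => [|k t] t1 t3 at_.
    by move=> k; rewrite in_nil.
  apply: parts_among_below => //.
  by move=> kE; move: at_; rewrite inE kE eqxx.
- by move=> ps; split => //; rewrite parts_setS; left.
- move=> [t + <-]; case: ifPn => // an [[t1 t2 t3] ut]; split; last first.
    by rewrite /= ut andbT; apply: part_notin.
  rewrite parts_setS; right; exists t => //; rewrite an; split => //.
  exact: parts_among_sub t3.
Qed.

Lemma npartsS M n : nparts M.+1 n =
  (nparts M n + (if a M.+1 <= n then nparts M.+1 (n - a M.+1) else 0))%N.
Proof.
rewrite /nparts parts_setS card_fset_set_cons.
- by case: ifPn => // _; rewrite fset_set0 cardfs0.
- exact: finite_parts_set.
- by case: ifPn => _; [exact: finite_parts_set|exact: finite_set0].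
- by move=> s [_ _ /part_notin]; rewrite mem_head.
Qed.

Lemma ndpartsS M n : ndparts M.+1 n =
  (ndparts M n + (if a M.+1 <= n then ndparts M (n - a M.+1) else 0))%N.
Proof.
rewrite /ndparts dparts_setS card_fset_set_cons.
- by case: ifPn => // _; rewrite fset_set0 cardfs0.
- exact: finite_dparts_set.
- by case: ifPn => _; [exact: finite_dparts_set|exact: finite_set0].
- by move=> s [[_ _ /part_notin]]; rewrite mem_head.
Qed.

Lemma parts_set0 n : parts_set 0 n = if n == 0%N then [set [::]] else set0.
Proof.
apply/seteqP; split=> [[|k s] [s1 s2 s3]|s].
- by rewrite -s2.
- by have [m] := s3 k (mem_head _ _); case: m.
- by case: eqP => // -> ->; split => // k; rewrite in_nil.
Qed.

Lemma nparts0 n : nparts 0 n = (n == 0%N).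
Proof.
rewrite /nparts parts_set0; case: eqP => _; last by rewrite fset_set0 cardfs0.
by rewrite fset_set1 cardfs1.
Qed.

Lemma ndparts0 n : ndparts 0 n = (n == 0%N).
Proof.
rewrite /ndparts -nparts0 /nparts; congr (#|` fset_set _|).
apply/seteqP; split=> [s []//|s sp]; split => //.
by move: sp; rewrite parts_set0; case: eqP => // _ ->.
Qed.

End Counting.

(** * Beatty sequences *)

Section BeattyParts.
Variables (R : realType) (alpha : R).
Hypothesis alpha1 : 1 < alpha.

Definition bty (m : nat) : nat := `|Num.floor (alpha * m%:R)|%N.

Lemma bty_floor m : Num.floor (alpha * m%:R) = (bty m)%:Z.
Proof.
rewrite /bty gez0_abs // floor_ge0 mulr_ge0//.
by rewrite ltW// (lt_trans _ alpha1).
Qed.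

Lemma btyE m : (bty m)%:R = alpha * m%:R - frac_part (alpha * m%:R).
Proof. by rewrite /frac_part bty_floor -pmulrn opprB addrC subrK. Qed.

Lemma bty_mono : {homo bty : i j / (i < j)%N}.
Proof.
apply: homo_ltn => [|i]; first exact: ltn_trans.
rewrite -ltz_nat -!bty_floor -(ltr_int R).
apply: (@le_lt_trans _ _ (alpha * i.+1%:R - 1)); last first.
  by rewrite ltrBlDr -intrD1 floorD1_gt.
have : (Num.floor (alpha * i%:R))%:~R <= alpha * i%:R by apply: floor_le_tmp.
move=> /le_trans; apply.
by rewrite -natr1 mulrDr mulr1 -addrA lerDl subr_ge0 ltW.
Qed.

(** Since [m <= bty m], a partition of [n] only uses parts of index at most [n]; this
makes the problem finite. *)
Lemma beatty_partitionsE n M : (n <= M)%N ->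
  beatty_partitions alpha n = parts_set bty M n.
Proof.
move=> nM; apply/seteqP; split=> s.
- move=> [[s1 s2 s3] s4]; split=> // k ks.
  have [m m0 mE] := s4 k ks.
  have mk : bty m = k by apply/eqP; rewrite -eqz_nat -bty_floor mE.
  exists m => //; rewrite m0 /=; apply: leq_trans nM.
  rewrite -s3; apply: (@leq_trans (bty m)).
    by apply: index_le_part => //; exact: bty_mono.
  rewrite mk; elim: s ks {s1 s2 s3 s4} => //= j s IH.
  rewrite inE => /predU1P[->|/IH]; first exact: leq_addr.
  by move=> /leq_trans; apply; apply: leq_addl.
- move=> [s1 s2 s3]; split; last first.
    by move=> k /s3[m /andP[m0 _] <-]; exists m => //; exact: bty_floor.
  split => //; apply/allP => k /s3[m /andP[m0 _] <-].
  by apply: leq_trans m0 _; apply: index_le_part => //; exact: bty_mono.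
Qed.

Lemma p_beattyE n M : (n <= M)%N -> p_beatty alpha n = nparts bty M n.
Proof. by move=> nM; rewrite /p_beatty (beatty_partitionsE nM). Qed.

Lemma q_beattyE n M : (n <= M)%N -> q_beatty alpha n = ndparts bty M n.
Proof.
move=> nM.
by rewrite /q_beatty /distinct_beatty_partitions (beatty_partitionsE nM).
Qed.

End BeattyParts.

(** * Rules of differentiation *)

Section Calculus.
Variable R : realType.
Implicit Types (f g df : R -> R) (a b x c d t u v : R).

(** [is_derive] is a type class, whose automatic resolution gets in the way of
    explicit derivations; this alias is not one. *)
Definition der x f d : Prop := is_derive x 1 f d.

Lemma der_eq f x a b : der x f a -> a = b -> der x f b.
Proof. by move=> ? <-. Qed.

Lemma dcst c x : der x (fun=> c : R) 0.
Proof. exact: is_derive_cst. Qed.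

Lemma did x : der x (fun t : R => t) 1.
Proof. exact: is_derive_id. Qed.

Lemma dadd f g x a b : der x f a -> der x g b ->
  der x (fun t => f t + g t) (a + b).
Proof. by move=> ? ?; apply: is_deriveD. Qed.

Lemma dsub f g x a b : der x f a -> der x g b ->
  der x (fun t => f t - g t) (a - b).
Proof. by move=> ? ?; apply: is_deriveB. Qed.

Lemma dopp f x a : der x f a -> der x (fun t => - f t) (- a).
Proof. by move=> ?; apply: is_deriveN. Qed.

Lemma dmul f g x a b : der x f a -> der x g b ->
  der x (fun t => f t * g t) (a * g x + f x * b).
Proof.
move=> ? ?; have -> : a * g x + f x * b = f x *: b + g x *: a.
  by rewrite /GRing.scale /= addrC [g x * a]mulrC.
exact: is_deriveM.
Qed.

Lemma dscale c f x a : der x f a ->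
  der x (fun t => c * f t) (c * a).
Proof. by move=> ?; apply: is_deriveZ. Qed.

Lemma dcomp f g x a b : der x g b -> der (g x) f a ->
  der x (fun t => f (g t)) (a * b).
Proof. by move=> ? ?; apply: is_derive1_comp. Qed.

Lemma dinvr f x a : f x != 0 -> der x f a ->
  der x (fun t => (f t)^-1) (- a / f x ^+ 2).
Proof.
move=> f0 [fd fa]; apply: DeriveDef; first exact: derivableV.
by rewrite deriveV// fa /GRing.scale /= mulNr mulrC -mulNr.
Qed.

Lemma dexp f x a : der x f a ->
  der x (fun t => expR (f t)) (expR (f x) * a).
Proof. by move=> h; apply: (dcomp h); exact: is_derive_expR. Qed.

Lemma dln f x a : 0 < f x -> der x f a ->
  der x (fun t => ln (f t)) (a / f x).
Proof.
move=> f0 fa; rewrite mulrC; apply: (dcomp fa).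
exact: is_derive1_ln.
Qed.

Lemma der_continuous f x a : der x f a -> {for x, continuous f}.
Proof. by move=> [fd _]; apply/differentiable_continuous/derivable1_diffP. Qed.

Lemma mvt f df a b : a < b ->
  (forall x, a <= x <= b -> der x f (df x)) ->
  exists2 c, a < c < b & f b - f a = df c * (b - a).
Proof.
move=> ab fd.
case: (@MVT _ f df a b ab).
- by move=> x; rewrite in_itv /= => /andP[/ltW ax /ltW xb]; apply: fd; rewrite ax.
- apply: derivable_within_continuous => x; rewrite in_itv /= => xab.
  by have [] := fd x xab.
- by move=> c; rewrite in_itv /= => cab ->; exists c.
Qed.

Lemma der_ge0_le f df a b : a <= b ->
  (forall x, a <= x <= b -> der x f (df x)) ->
  (forall x, a < x < b -> 0 <= df x) -> f a <= f b.
Proof.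
rewrite le_eqVlt => /predU1P[-> //|ab] fd f0.
rewrite -subr_ge0; have [c cab ->] := mvt ab fd.
by rewrite mulr_ge0 ?f0// subr_ge0 ltW.
Qed.

Lemma der_le0_ge f df a b : a <= b ->
  (forall x, a <= x <= b -> der x f (df x)) ->
  (forall x, a < x < b -> df x <= 0) -> f b <= f a.
Proof.
move=> ab fd f0; rewrite -lerN2.
apply: (@der_ge0_le (fun t => - f t) (fun t => - df t)) => // [x xab|x xab].
  by apply: dopp; exact: fd.
by rewrite oppr_ge0; exact: f0.
Qed.

Lemma dsin f x a : der x f a ->
  der x (fun t => sin (f t)) (cos (f x) * a).
Proof. by move=> h; apply: (dcomp h); exact: is_derive_sin. Qed.

Lemma dcos f x a : der x f a ->
  der x (fun t => cos (f t)) (- sin (f x) * a).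
Proof. by move=> h; apply: (dcomp h); exact: is_derive_cos. Qed.

Lemma datan f x a : der x f a ->
  der x (fun t => atan (f t)) ((1 + f x ^+ 2)^-1 * a).
Proof. by move=> h; apply: (dcomp h); exact: is_derive1_atan. Qed.

Lemma dsqr x : der x (fun t : R => t ^+ 2) (2 * x).
Proof.
apply: der_eq (dmul (did x) (did x)) _; ring.
Qed.

Lemma dcube x : der x (fun t : R => t ^+ 3) (3 * x ^+ 2).
Proof.
apply: der_eq; first exact: (dmul (did x) (dsqr x)).
rewrite /=; ring.
Qed.

(** * Elementary inequalities *)

Lemma sin_le_id x : 0 <= x -> sin x <= x.
Proof.
move=> x0; rewrite -subr_ge0.
rewrite -[leLHS](_ : 0 - sin 0 = 0); last by rewrite sin0 subr0.
apply: (@der_ge0_le (fun t => t - sin t) (fun t => 1 - cos t * 1)) => //.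
by move=> y _; apply: dsub; [exact: did|apply: dsin; exact: did].
Qed.

Lemma one_sub_cos_le x : 1 - cos x <= x ^+ 2 / 2.
Proof.
wlog x0 : x / 0 <= x => [H|].
  have [/H//|/ltW x0] := leP 0 x.
  by rewrite -cosN -sqrrN; apply: H; rewrite oppr_ge0.
rewrite -subr_ge0.
rewrite -[leLHS](_ : 2^-1 * 0 ^+ 2 - (1 - cos 0) = 0); last first.
  by rewrite cos0; ring.
rewrite [x ^+ 2 / 2]mulrC.
apply: (@der_ge0_le (fun t => 2^-1 * t ^+ 2 - (1 - cos t))
  (fun t => 2^-1 * (2 * t) - (0 - (- sin t * 1)))) => //.
  move=> y _; apply: dsub; first by apply: dscale; exact: dsqr.
  by apply: dsub; [exact: dcst|apply: dcos; exact: did].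
move=> y /andP[y0 _]; rewrite mulKf ?pnatr_eq0// mulr1 sub0r opprK subr_ge0.
exact/sin_le_id/ltW.
Qed.

Lemma id_sub_sin_le x : 0 <= x -> x - sin x <= x ^+ 3 / 6.
Proof.
move=> x0; rewrite -subr_ge0 mulrC.
rewrite -[leLHS](_ : 6^-1 * 0 ^+ 3 - (0 - sin 0) = 0); last first.
  by rewrite sin0; ring.
apply: (@der_ge0_le (fun t => 6^-1 * t ^+ 3 - (t - sin t))
  (fun t => 6^-1 * (3 * t ^+ 2) - (1 - (cos t * 1)))) => //.
  move=> y _; apply: dsub; first by apply: dscale; exact: dcube.
  by apply: dsub; [exact: did|apply: dsin; exact: did].
move=> y /andP[y0 _]; rewrite mulr1 subr_ge0.
by have := one_sub_cos_le y; lra.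
Qed.

Lemma abs_sin_le x : `|sin x| <= `|x|.
Proof.
wlog x0 : x / 0 <= x => [H|].
  have [/H//|/ltW x0] := leP 0 x.
  by rewrite -normrN -sinN -[leRHS]normrN; apply: H; rewrite oppr_ge0.
rewrite [leRHS]ger0_norm// ler_norml sin_le_id// andbT.
rewrite lerNl -sinN.
have [xp|xp] := leP x pi.
  by apply: (le_trans _ x0); rewrite sinN oppr_le0 sin_ge0_pi// x0.
apply: le_trans (sin_le1 _) _.
by apply: le_trans (ltW xp); apply: le_trans (pi_ge2 R); lra.
Qed.

Lemma abs_sin_sub_id_le x : `|sin x - x| <= `|x| ^+ 3.
Proof.
wlog x0 : x / 0 <= x => [H|].
  have [/H//|/ltW x0] := leP 0 x.
  have -> : `|sin x - x| = `|sin (- x) - - x| by rewrite sinN -normrN; congr (`|_|); ring.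
  rewrite -(normrN x).
  by apply: H; rewrite oppr_ge0.
rewrite distrC ger0_norm ?subr_ge0 ?sin_le_id// ger0_norm//.
apply: le_trans (id_sub_sin_le x0) _.
have : 0 <= x ^+ 3 by exact: exprn_ge0.
lra.
Qed.

Lemma half_le_sin x : 0 <= x <= 1 -> x / 2 <= sin x.
Proof.
move=> /andP[x0 x1]; have := id_sub_sin_le x0.
have : x ^+ 3 <= x by rewrite exprS ler_piMr// expr_le1.
lra.
Qed.

Lemma sin_sqr_approx x : `|4 * sin (x / 2) ^+ 2 - x ^+ 2| <= x ^+ 4.
Proof.
pose v := x / 2; rewrite -/v (_ : x = 2 * v); last first.
  by rewrite /v mulrC divfK// pnatr_eq0.
have -> : 4 * sin v ^+ 2 - (2 * v) ^+ 2 = 4 * ((sin v - v) * (sin v + v)) by ring.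
rewrite normrM normrM ger0_norm//.
have h1 := abs_sin_sub_id_le v.
have h2 : `|sin v + v| <= 2 * `|v|.
  by apply: le_trans (ler_normD _ _) _; have := abs_sin_le v; lra.
have -> : (2 * v) ^+ 4 = 16 * (`|v| ^+ 3 * `|v|).
  by rewrite -exprSr (_ : `|v| ^+ 4 = v ^+ 4) -?[4%N]/(2 * 2)%N ?exprM ?real_normK ?num_real//; ring.
have := ler_pM (normr_ge0 _) (normr_ge0 _) h1 h2.
have : 0 <= `|v| ^+ 3 * `|v| by rewrite mulr_ge0// exprn_ge0.
lra.
Qed.

Lemma abs_atan_le x : `|atan x| <= `|x|.
Proof.
wlog x0 : x / 0 <= x => [H|].
  have [/H//|/ltW x0] := leP 0 x.
  by rewrite -normrN -atanN -[leRHS]normrN; apply: H; rewrite oppr_ge0.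
rewrite ger0_norm; last by rewrite -[leLHS]atan0 le_atan.
rewrite ger0_norm// -subr_ge0.
rewrite -[leLHS](_ : 0 - atan 0 = 0); last by rewrite atan0 subr0.
apply: (@der_ge0_le (fun t => t - atan t) (fun t => 1 - (1 + t ^+ 2)^-1 * 1)) => //.
  by move=> y _; apply: dsub; [exact: did|apply: datan; exact: did].
by move=> y _; rewrite mulr1 subr_ge0 invf_le1 ?lerDl ?sqr_ge0// ltr_pwDl// sqr_ge0.
Qed.

Lemma abs_atan_sub_id_le x : `|atan x - x| <= `|x| ^+ 3.
Proof.
wlog x0 : x / 0 <= x => [H|].
  have [/H//|/ltW x0] := leP 0 x.
  have -> : `|atan x - x| = `|atan (- x) - - x| by rewrite atanN -normrN; congr (`|_|); ring.
  rewrite -(normrN x).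
  by apply: H; rewrite oppr_ge0.
have h : atan x <= x.
  by apply: le_trans (ler_norm _) _; apply: le_trans (abs_atan_le x) _; rewrite ger0_norm.
rewrite distrC ger0_norm ?subr_ge0// ger0_norm// -subr_ge0.
rewrite -[leLHS](_ : 0 ^+ 3 - (0 - atan 0) = 0); last first.
  by rewrite atan0; ring.
apply: (@der_ge0_le (fun t => t ^+ 3 - (t - atan t))
   (fun t => 3 * t ^+ 2 - (1 - (1 + t ^+ 2)^-1 * 1))) => //.
  move=> y _; apply: dsub; first exact: dcube.
  by apply: dsub; [exact: did|apply: datan; exact: did].
move=> y _; rewrite mulr1.
have y2 := sqr_ge0 y.
have y1 : 1 + y ^+ 2 != 0 by rewrite gt_eqF// ltr_pwDl.
have -> : 1 - (1 + y ^+ 2)^-1 = y ^+ 2 / (1 + y ^+ 2) by field.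
rewrite subr_ge0 ler_pdivrMr ?ltr_pwDl//; nra.
Qed.

Lemma ln1D_bound (w : R) : `|w| <= 2^-1 -> `|ln (1 + w) - w| <= 2 * w ^+ 2.
Proof.
rewrite ler_norml => /andP[w1 w2].
have w0 : 0 < 1 + w by lra.
have h1 : ln (1 + w) <= w by apply: le_ln1Dx; lra.
have h2 : - ln (1 + w) <= - w + 2 * w ^+ 2.
  rewrite -lnV ?posrE//.
  have -> : (1 + w)^-1 = 1 + ((1 + w)^-1 - 1) by ring.
  apply: (@le_trans _ _ ((1 + w)^-1 - 1)).
    by apply: le_ln1Dx; rewrite ltrBrDl subrr invr_gt0.
  have w3 : 0 <= w ^+ 2 * (1 + 2 * w) by rewrite mulr_ge0 ?sqr_ge0//; lra.
  rewrite lerBlDr -[leLHS]mul1r ler_pdivrMr//; nra.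
by rewrite ler_norml; apply/andP; split; nra.
Qed.

Lemma ln_le_sub1 x : 0 < x -> ln x <= x - 1.
Proof.
by move=> x0; rewrite {1}(_ : x = 1 + (x - 1)); [apply: le_ln1Dx; lra|ring].
Qed.

Lemma expN_le_inv u : 0 <= u -> expR (- u) <= (1 + u)^-1.
Proof.
move=> u0; rewrite expRN lef_pV2 ?posrE ?expR_gt0 ?ltr_pwDl//.
exact: expR_ge1Dx.
Qed.

End Calculus.

(** * The Bose function and the logarithm of a geometric series *)

Section BoseFunction.
Variable R : realType.
Implicit Types t s u : R.

(** The mean of a geometric variable of ratio [expR (- t)], that is the expected
multiplicity of a part [a] with [t = x * a] when a partition of [n] has weight
[expR (- x * n)]. *)
Definition bose t : R := (expR t - 1)^-1.

Lemma expR_sub1_gt0 t : 0 < t -> 0 < expR t - 1.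
Proof. by move=> t0; rewrite subr_gt0 expR_gt1. Qed.

Lemma bose_gt0 t : 0 < t -> 0 < bose t.
Proof. by move=> t0; rewrite invr_gt0 expR_sub1_gt0. Qed.

(** One term of the exponential series; all decay of [bose] at infinity comes from here. *)
Lemma bose_pow_le t k : 0 < t -> bose t * t ^+ k.+1 <= k.+1`!%:R.
Proof.
move=> t0; rewrite mulrC ler_pdivrMr ?expR_sub1_gt0//.
rewrite -ler_pdivrMl ?ltr0n ?fact_gt0// mulrC lerBrDl.
exact/expR_ge1Dxn/ltW.
Qed.

Lemma bose1D t : 0 < t -> 1 + bose t = (1 - expR (- t))^-1.
Proof.
move=> t0; rewrite expRN /bose.
have e0 := expR_gt0 t; have e1 := expR_sub1_gt0 t0.
have e2 : 1 - (expR t)^-1 != 0.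
  rewrite (_ : 1 - _ = (expR t - 1) / expR t); first by rewrite mulf_neq0 ?gt_eqF ?invr_gt0.
  by field; rewrite gt_eqF.
field; rewrite !gt_eqF//.
Qed.

Lemma dbose t : 0 < t -> der t bose (- (bose t * (1 + bose t))).
Proof.
move=> t0; have e1 := expR_sub1_gt0 t0.
apply: der_eq.
  apply: dinvr; first by rewrite gt_eqF.
  by apply: dsub; [apply: dexp; exact: did|exact: dcst].
rewrite /bose mulr1 subr0; field; rewrite gt_eqF//.
Qed.

Definition bosephi t : R := t * bose t.
(** [bose t * (1 + bose t)] is the variance of that geometric variable. *)
Definition boseV t : R := t ^+ 2 * (bose t * (1 + bose t)).

Lemma dbosephi t : 0 < t ->
  der t bosephi (bose t * (1 - t * (1 + bose t))).
Proof.
move=> t0; apply: der_eq.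
  by apply: dmul; [exact: did|exact: dbose].
by rewrite /=; ring.
Qed.

Lemma bose1D_ge t : 0 < t -> 1 <= t * (1 + bose t).
Proof.
move=> t0; have e1 := expR_sub1_gt0 t0.
have -> : t * (1 + bose t) = t * expR t / (expR t - 1).
  by rewrite /bose; field; rewrite gt_eqF.
rewrite ler_pdivlMr// mul1r.
have := expR_ge1Dx (- t).
rewrite -(ler_pM2r (expR_gt0 t)) -expRD addNr expR0; nra.
Qed.

Lemma bosephi_ge0 t : 0 < t -> 0 <= bosephi t.
Proof. by move=> t0; rewrite mulr_ge0 ?ltW ?bose_gt0. Qed.

Lemma bosephi_le1 t : 0 < t -> bosephi t <= 1.
Proof.
by move=> t0; have := bose_pow_le 0 t0; rewrite expr1 mulrC.
Qed.

Lemma bosephi_decr s t : 0 < s -> s <= t -> bosephi t <= bosephi s.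
Proof.
move=> s0 st; apply: (der_le0_ge st) => x /andP[sx _].
  by apply: dbosephi; apply: lt_le_trans sx.
have x0 : 0 < x by exact: lt_trans sx.
by rewrite mulr_ge0_le0 ?subr_le0 ?bose1D_ge// ltW// bose_gt0.
Qed.

Lemma dboseV t : 0 < t -> der t boseV
  (t * (bose t * (1 + bose t)) * (2 - t * (1 + 2 * bose t))).
Proof.
move=> t0; apply: der_eq.
  apply: dmul; first exact: dsqr.
  apply: dmul; first exact: dbose.
  by apply: dadd; [exact: dcst|exact: dbose].
by rewrite /=; ring.
Qed.

(** Equivalent to [tanh (t / 2) <= t / 2]; it makes [boseV] decreasing. *)
Lemma bose2_ge t : 0 < t -> 2 <= t * (1 + 2 * bose t).
Proof.
move=> t0; have e1 := expR_sub1_gt0 t0.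
have -> : t * (1 + 2 * bose t) = t * (expR t + 1) / (expR t - 1).
  by rewrite /bose; field; rewrite gt_eqF.
rewrite ler_pdivlMr// -subr_ge0.
rewrite -[leLHS](_ : 0 * (expR 0 + 1) - 2 * (expR 0 - 1) = 0); last first.
  by rewrite expR0; ring.
apply: (@der_ge0_le _ (fun t => t * (expR t + 1) - 2 * (expR t - 1))
  (fun t => (1 * (expR t + 1) + t * (expR t * 1 + 0)) - 2 * (expR t * 1 - 0))).
- exact: ltW.
- move=> x _; apply: dsub.
    apply: dmul; first exact: did.
    by apply: dadd; [apply: dexp; exact: did|exact: dcst].
  apply: dscale.
  by apply: dsub; [apply: dexp; exact: did|exact: dcst].
- move=> x _; have := expR_ge1Dx (- x).
  rewrite -(ler_pM2r (expR_gt0 x)) -expRD addNr expR0; nra.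
Qed.

Lemma boseV_ge0 t : 0 < t -> 0 <= boseV t.
Proof.
move=> t0; have b0 := ltW (bose_gt0 t0).
by rewrite /boseV mulr_ge0 ?sqr_ge0// mulr_ge0// addr_ge0.
Qed.

Lemma boseV_decr s t : 0 < s -> s <= t -> boseV t <= boseV s.
Proof.
move=> s0 st; apply: (der_le0_ge st) => x /andP[sx _].
  by apply: dboseV; apply: lt_le_trans sx.
have x0 : 0 < x by exact: lt_trans sx.
have b0 := ltW (bose_gt0 x0).
rewrite mulr_ge0_le0 ?subr_le0 ?bose2_ge//.
by rewrite !mulr_ge0 ?(ltW x0)// addr_ge0.
Qed.

(** [boseV t] is the square of [(t / 2) / sinh (t / 2)]. *)
Lemma boseV_le1 t : 0 < t -> boseV t <= 1.
Proof.
move=> t0; have e1 := expR_sub1_gt0 t0.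
have -> : boseV t = (t * expR (t / 2) / (expR t - 1)) ^+ 2.
  have tE : expR t = expR (t / 2) ^+ 2 by rewrite expr2 -expRD; congr expR; field.
  by rewrite /boseV /bose tE in e1 *; field; rewrite gt_eqF.
rewrite expr_le1 ?mulr_ge0 ?expR_ge0 ?invr_ge0 ?(ltW t0) ?(ltW e1)//.
rewrite ler_pdivrMr// mul1r -subr_ge0.
rewrite -[leLHS](_ : (expR 0 - 1) - 0 * expR (0 / 2) = 0); last first.
  by rewrite expR0; ring.
apply: (@der_ge0_le _ (fun t => (expR t - 1) - t * expR (t / 2))
  (fun t => (expR t * 1 - 0) -
     (1 * expR (t / 2) + t * (expR (t / 2) * (1 * 2^-1 + t * 0))))).
- exact: ltW.
- move=> x _; apply: dsub.
    by apply: dsub; [apply: dexp; exact: did|exact: dcst].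
  apply: dmul; first exact: did.
  by apply: dexp; apply: dmul; [exact: did|exact: dcst].
- move=> x _; have := expR_ge1Dx (x / 2).
  have := expR_gt0 (x / 2).
  have -> : expR x = expR (x / 2) ^+ 2 by rewrite expr2 -expRD; congr expR; field.
  nra.
Qed.

(** Equal to [- ln (1 - expR (- t))], in a form without subtraction. *)
Definition lgeo t : R := ln (1 + bose t).

Lemma bose1D_gt0 t : 0 < t -> 0 < 1 + bose t.
Proof. by move=> t0; rewrite addr_gt0// bose_gt0. Qed.

Lemma lgeoE t : 0 < t -> expR (lgeo t) = (1 - expR (- t))^-1.
Proof. by move=> t0; rewrite /lgeo lnK ?posrE ?bose1D_gt0// bose1D. Qed.

Lemma dlgeo t : 0 < t -> der t lgeo (- bose t).
Proof.
move=> t0; apply: der_eq.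
  apply: dln; first exact: bose1D_gt0.
  by apply: dadd; [exact: dcst|exact: dbose].
by rewrite add0r; field; rewrite gt_eqF// bose1D_gt0.
Qed.

Lemma lgeo_ge0 t : 0 < t -> 0 <= lgeo t.
Proof. by move=> t0; rewrite ln_ge0// lerDl ltW// bose_gt0. Qed.

Lemma lgeo_le t : 0 < t -> lgeo t <= bose t.
Proof. by move=> t0; apply: le_ln1Dx; apply: lt_trans (bose_gt0 t0); lra. Qed.

(** The singularity [- ln t] of [lgeo] at the origin is removed. *)
Definition lreg t : R := ln t + lgeo t.
Definition dlreg_fun t : R := t^-1 - bose t.

Lemma dlreg t : 0 < t -> der t lreg (dlreg_fun t).
Proof.
move=> t0; apply: dadd; last exact: dlgeo.
exact: is_derive1_ln.
Qed.

Lemma dlreg_fun_ge0 t : 0 < t -> 0 <= dlreg_fun t.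
Proof.
move=> t0; rewrite subr_ge0 -[leRHS]mul1r ler_pdivlMr// mulrC.
exact: bosephi_le1.
Qed.

Lemma dlreg_fun_le1 t : 0 < t -> dlreg_fun t <= 1.
Proof.
move=> t0; rewrite lerBlDr -[leLHS]mul1r ler_pdivrMr// mulrC.
exact: bose1D_ge.
Qed.

Lemma dlreg_decr s t : 0 < s -> s <= t -> dlreg_fun t <= dlreg_fun s.
Proof.
move=> s0 st; apply: (@der_le0_ge _ _
   (fun x => - 1 / x ^+ 2 - (- (bose x * (1 + bose x)))) _ _ st) => x /andP[sx _].
  have x0 : 0 < x by apply: lt_le_trans sx.
  by apply: dsub; [apply: dinvr; [rewrite gt_eqF|exact: did]|exact: dbose].
have x0 : 0 < x by exact: lt_trans sx.
have x2 : 0 < x ^+ 2 by exact: exprn_gt0.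
rewrite opprK mulNr mul1r addrC subr_le0 -[leRHS]mul1r ler_pdivlMr// mulrC.
exact: boseV_le1.
Qed.

Lemma lreg_ge0 t : 0 < t -> 0 <= lreg t.
Proof.
move=> t0; rewrite /lreg /lgeo -lnM ?posrE ?bose1D_gt0//.
by rewrite ln_ge0// bose1D_ge.
Qed.

Lemma lreg_le t : 0 < t -> lreg t <= t.
Proof.
move=> t0; rewrite /lreg /lgeo -lnM ?posrE ?bose1D_gt0//.
rewrite bose1D// -[leRHS]expRK ler_ln ?posrE ?expR_gt0//; last first.
  by rewrite mulr_gt0// invr_gt0 subr_gt0 expR_lt1 oppr_lt0.
have e0 : 0 < 1 - expR (- t) by rewrite subr_gt0 expR_lt1 oppr_lt0.
rewrite ler_pdivrMr// mulrBr mulr1 -expRD subrr expR0 lerBrDl.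
exact: expR_ge1Dx.
Qed.

End BoseFunction.

(** Limits are mostly obtained from explicit error bounds, hence this form. *)
Lemma cvg_of_dist (R : realType) (T : Type) (F : set_system T) (FF : Filter F)
    (v u : T -> R) (l : R) :
  (\forall n \near F, `|u n - l| <= v n) -> v @ F --> (0 : R) -> u @ F --> l.
Proof.
move=> uv v0; apply/cvgrPdist_le => e e0.
have /cvgrPdist_le/(_ e e0) := v0; apply: filterS2 uv => n uv.
rewrite sub0r normrN distrC => ve.
exact: le_trans uv (le_trans (ler_norm _) ve).
Qed.

(** * Integrals over a segment *)

Section SegmentIntegral.
Variable R : realType.
Implicit Types (f g F : R -> R) (a b c : R).
Local Notation mu := (@lebesgue_measure R).

Definition seg_int a b f : R := \int[mu]_(x in `[a, b]) f x.

Lemma seg_integrable a b f : continuous f ->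
  mu.-integrable `[a, b] (EFin \o f).
Proof.
move=> cf; apply: continuous_compact_integrable; first exact: segment_compact.
exact: continuous_subspaceT.
Qed.

Lemma seg_intD a b f g : continuous f -> continuous g ->
  seg_int a b (fun x => f x + g x) = seg_int a b f + seg_int a b g.
Proof. by move=> cf cg; apply: RintegralD => //; exact: seg_integrable. Qed.

Lemma seg_intZ a b c f : continuous f ->
  seg_int a b (fun x => c * f x) = c * seg_int a b f.
Proof. by move=> cf; apply: RintegralZl => //; exact: seg_integrable. Qed.

Lemma seg_int_le a b f g : continuous f -> continuous g ->
  (forall x, a <= x <= b -> f x <= g x) -> seg_int a b f <= seg_int a b g.
Proof.
move=> cf cg fg; apply: le_Rintegral => //; exact: seg_integrable.
Qed.

Lemma eq_seg_int a b f g : (forall x, a <= x <= b -> f x = g x) ->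
  seg_int a b f = seg_int a b g.
Proof.
by move=> fg; apply: eq_Rintegral => x; rewrite inE /= in_itv /=; exact: fg.
Qed.

Lemma seg_int_cst a b c : a <= b -> seg_int a b (fun=> c) = c * (b - a).
Proof.
move=> ab; rewrite /seg_int Rintegral_cst//= lebesgue_measure_itv/= lte_fin.
move: ab; rewrite le_eqVlt => /predU1P[->|ab]; first by rewrite ltxx subrr.
by rewrite ab.
Qed.

Lemma seg_int_ftc a b F f : a < b -> continuous f ->
  (forall x, der x F (f x)) -> seg_int a b f = F b - F a.
Proof.
move=> ab cf dF.
rewrite /seg_int /Rintegral (@continuous_FTC2 _ f F)//.
- exact: continuous_subspaceT.
- have cF x : {for x, continuous F} by apply: der_continuous (dF x).
  split=> [x _||]; first by have [] := dF x.
  + exact/cvg_at_right_filter/cF.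
  + exact/cvg_at_left_filter/cF.
- by move=> x _; rewrite derive1E; have [_] := dF x.
Qed.

Lemma continuousX_fun f n : continuous f -> continuous (fun x => f x ^+ n).
Proof. by move=> cf x; apply: (@continuous_comp _ _ _ f (fun y => y ^+ n)); [exact: cf|exact: exprn_continuous]. Qed.

Lemma continuousM_fun f g : continuous f -> continuous g ->
  continuous (fun x => f x * g x).
Proof. by move=> cf cg x; apply: continuousM; [exact: cf|exact: cg]. Qed.

Lemma continuousD_fun f g : continuous f -> continuous g ->
  continuous (fun x => f x + g x).
Proof. by move=> cf cg x; apply: continuousD; [exact: cf|exact: cg]. Qed.

Lemma continuousB_fun f g : continuous f -> continuous g ->
  continuous (fun x => f x - g x).
Proof. by move=> cf cg x; apply: continuousB; [exact: cf|exact: cg]. Qed.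

Lemma continuous_cst_fun c : continuous (fun _ : R => c : R).
Proof. by move=> x; exact: cvg_cst. Qed.

Lemma continuous_id_fun : continuous (fun x : R => x).
Proof. by move=> x. Qed.

End SegmentIntegral.

(** * Wallis integrals and the Basel sum *)

Section Wallis.
Variable R : realType.
Implicit Types x : R.

(** For identities that hold modulo one multiple of a hypothesis. *)
Lemma eq_lincomb (k a b u v : R) : a = b -> u - v = k * (a - b) -> u = v.
Proof. by move=> -> /eqP; rewrite subrr mulr0 subr_eq0 => /eqP. Qed.

Lemma dpow (x : R) n : der x (fun t : R => t ^+ n.+1) (n.+1%:R * x ^+ n).
Proof.
elim: n => [|n IH]; first by rewrite mul1r; exact: did.
have -> : (fun t : R => t ^+ n.+2) = (fun t => t * t ^+ n.+1).
  by apply/funext => t; rewrite exprS.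
apply: der_eq (dmul (did x) IH) _.
by rewrite /= -[n.+2%:R]natr1 exprS; ring.
Qed.

Lemma dcosX x n : der x (fun t => cos t ^+ n.+1) (n.+1%:R * cos x ^+ n * - sin x).
Proof.
apply: der_eq; first apply: (dcomp (is_derive_cos x) (dpow (cos x) n)).
by [].
Qed.

Definition wallis m : R := seg_int 0 (pi / 2) (fun x => cos x ^+ m).

Lemma pihalf_gt0 : 0 < pi / 2 :> R.
Proof. by rewrite divr_gt0// pi_gt0. Qed.

Lemma ccosX m : continuous (fun x : R => cos x ^+ m).
Proof. exact/continuousX_fun/continuous_cos. Qed.

Lemma wallis0 : wallis 0 = pi / 2.
Proof.
rewrite /wallis (@eq_seg_int _ _ _ _ (fun=> 1)).
  by rewrite seg_int_cst ?subr0 ?mul1r// ltW// pihalf_gt0.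
by move=> x _; rewrite expr0.
Qed.

Lemma wallis1 : wallis 1 = 1.
Proof.
rewrite /wallis (seg_int_ftc (F := sin)) ?pihalf_gt0//.
- by rewrite sin0 sin_pihalf subr0.
- exact: ccosX.
- by move=> x; rewrite expr1; exact: is_derive_sin.
Qed.

Lemma cos_range x : 0 <= x <= pi / 2 -> 0 <= cos x <= 1.
Proof.
move=> /andP[x0 x1]; rewrite cos_le1 andbT cos_ge0_pihalf// x1 andbT.
by apply: le_trans x0; rewrite oppr_le0 ltW// pihalf_gt0.
Qed.

Lemma wallis_decr m : wallis m.+1 <= wallis m.
Proof.
apply: seg_int_le; [exact: ccosX|exact: ccosX|] => x /cos_range/andP[c0 c1].
by rewrite exprS ler_piMl// exprn_ge0.
Qed.

Lemma wallis_rec m : m.+2%:R * wallis m.+2 = m.+1%:R * wallis m.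
Proof.
apply/eqP; rewrite -subr_eq0 -mulNr; apply/eqP.
rewrite /wallis -!seg_intZ -?seg_intD; try exact: ccosX; last 2 first.
- apply: continuousM_fun; [exact: continuous_cst_fun|exact: ccosX].
- apply: continuousM_fun; [exact: continuous_cst_fun|exact: ccosX].
rewrite (seg_int_ftc (F := fun x => cos x ^+ m.+1 * sin x)) ?pihalf_gt0//.
- by rewrite cos_pihalf sin0 expr0n /= mul0r mulr0 subr0.
- apply: continuousD_fun; apply: continuousM_fun;
    try exact: continuous_cst_fun; exact: ccosX.
- move=> x; apply: der_eq.
    apply: dmul; [exact: dcosX|exact: is_derive_sin].
  have := sin2cos2 x; rewrite -[m.+2%:R]natr1 !exprS expr0 !mulr1 => h.
  by apply: (eq_lincomb (k := - (m.+1%:R * cos x ^+ m)) h); ring.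
Qed.

Lemma wallis_gt0 m : 0 < wallis m.
Proof.
suff: 0 < wallis m /\ 0 < wallis m.+1 by case.
elim: m => [|m [IH1 IH2]].
  by rewrite wallis0 wallis1 pihalf_gt0.
split => //.
by rewrite -(pmulr_rgt0 _ (ltr0Sn R m.+1)) wallis_rec mulr_gt0// ltr0n.
Qed.

Lemma wallis_prod m : m.+1%:R * wallis m * wallis m.+1 = pi / 2.
Proof.
elim: m => [|m IH]; first by rewrite wallis0 wallis1 mul1r mulr1.
by rewrite mulrAC wallis_rec -IH; ring.
Qed.

(** [wallis] decreases, so [wallis_prod] bounds its square from both sides. *)
Lemma wallis_sqr_bounds m :
  pi / 2 / m.+1%:R <= wallis m ^+ 2 /\
  m.+1%:R * wallis m.+1 ^+ 2 <= pi / 2.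
Proof.
split.
  rewrite ler_pdivrMr ?ltr0n// -(wallis_prod m) expr2.
  rewrite mulrC [leRHS]mulrC [leLHS]mulrC mulrA.
  by rewrite ler_wpM2l ?mulr_ge0 ?ler0n ?(ltW (wallis_gt0 _))// wallis_decr.
rewrite -(wallis_prod m) expr2 mulrA ler_wpM2r ?(ltW (wallis_gt0 _))//.
by rewrite ler_wpM2l ?ler0n// wallis_decr.
Qed.

(** These integrals give the Basel sum: [wallis2_rec] divided by the recursion of
[wallis] makes the inverse squares telescope, and [wallis2] is negligible against
[wallis] because [x <= 4 * sin x] on the interval. *)
Definition wallis2 n : R := seg_int 0 (pi / 2) (fun x => x ^+ 2 * cos x ^+ n).

Lemma cx2cosX m : continuous (fun x : R => x ^+ 2 * cos x ^+ m).
Proof.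
apply: continuousM_fun; last exact: ccosX.
by apply: continuousX_fun; exact: continuous_id_fun.
Qed.

Lemma wallis2_rec n : wallis n.+2 =
  (n.+2%:R * n.+1%:R * wallis2 n - n.+2%:R ^+ 2 * wallis2 n.+2) / 2.
Proof.
apply/eqP; rewrite eq_sym -subr_eq0; apply/eqP.
pose k : R := n.+2%:R.
pose p : R := - (k * n.+1%:R / 2). pose q : R := k ^+ 2 / 2.
suff : wallis n.+2 + (p * wallis2 n + q * wallis2 n.+2) = 0.
  by rewrite /p /q -/k => h; rewrite -oppr0 -h; field.
rewrite /wallis /wallis2 -2?seg_intZ; try exact: cx2cosX.
have c1 : continuous (fun x : R => p * (x ^+ 2 * cos x ^+ n)).
  by apply: continuousM_fun; [exact: continuous_cst_fun|exact: cx2cosX].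
have c2 : continuous (fun x : R => q * (x ^+ 2 * cos x ^+ n.+2)).
  by apply: continuousM_fun; [exact: continuous_cst_fun|exact: cx2cosX].
have c3 := continuousD_fun c1 c2.
rewrite -seg_intD// -seg_intD//; last exact: ccosX.
(* two integrations by parts packed into one primitive *)
rewrite (seg_int_ftc (F := fun x => x * cos x ^+ n.+2 +
   k / 2 * (x ^+ 2 * (cos x ^+ n.+1 * sin x)))) ?pihalf_gt0//.
- by rewrite cos_pihalf !expr0n /=; ring.
- by apply: continuousD_fun => //; exact: ccosX.
- move=> x; apply: der_eq.
    apply: dadd; first by apply: dmul; [exact: did|exact: dcosX].
    apply: dscale; apply: dmul; first exact: dsqr.
    by apply: dmul; [exact: dcosX|exact: is_derive_sin].
  have h := sin2cos2 x.
  rewrite /= /p /q /k !exprS expr0 !mulr1.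
  rewrite !exprS expr0 !mulr1 in h.
  have -> : n.+2%:R = n.+1%:R + 1 :> R by rewrite -natr1.
  apply: (eq_lincomb (k := - ((n.+1%:R + 1) / 2 * (x * x * (n.+1%:R * cos x ^+ n)))) h).
  by field.
Qed.

Lemma id_le_4sin x : 0 <= x <= pi / 2 -> x <= 4 * sin x.
Proof.
move=> /andP[x0 x1].
have [x2|x2] := leP x 1.
  by have := @half_le_sin R x; rewrite x0 x2 => /(_ isT); lra.
have x3 : x <= 2 by apply: le_trans x1 (ltW (pihalf_lt2 R)).
have h1 : 1 / 2 <= sin 1 :> R by apply: half_le_sin; lra.
have h2 : sin 1 < sin x.
  rewrite ltr_sin// in_itv/=; apply/andP; split => //.
  - by apply: (@le_trans _ _ 0) => //; rewrite oppr_le0 ltW// pihalf_gt0.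
  - exact: ltW (lt_le_trans x2 x1).
  - by apply: le_trans x0; rewrite oppr_le0 ltW// pihalf_gt0.
lra.
Qed.

Lemma wallis2_bound n : 0 <= wallis2 n <= 16 * wallis n / n.+2%:R.
Proof.
apply/andP; split.
  rewrite -[leLHS](_ : seg_int 0 (pi / 2) (fun=> 0) = 0); last first.
    by rewrite seg_int_cst ?mul0r// ltW// pihalf_gt0.
  apply: seg_int_le; [exact: continuous_cst_fun|exact: cx2cosX|].
  move=> x /cos_range/andP[c0 _].
  by rewrite mulr_ge0 ?sqr_ge0// exprn_ge0.
have -> : 16 * wallis n / n.+2%:R = 16 * (wallis n - wallis n.+2).
  have -> : wallis n.+2 = n.+1%:R * wallis n / n.+2%:R.
    by rewrite -wallis_rec mulrC mulKf// pnatr_eq0.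
  have n2 : n.+2%:R != 0 :> R by rewrite pnatr_eq0.
  have -> : n.+1%:R = n.+2%:R - 1 :> R by rewrite -[n.+2%:R]natr1 addrK.
  move: (n.+2%:R : R) n2 => k k0; field.
  by [].
have -> : 16 * (wallis n - wallis n.+2) = 16 * wallis n + (- 16) * wallis n.+2 by ring.
rewrite /wallis -2?seg_intZ; try exact: ccosX.
have c1 : continuous (fun x : R => 16 * cos x ^+ n).
  by apply: continuousM_fun; [exact: continuous_cst_fun|exact: ccosX].
have c2 : continuous (fun x : R => (- 16) * cos x ^+ n.+2).
  by apply: continuousM_fun; [exact: continuous_cst_fun|exact: ccosX].
rewrite -seg_intD//.
apply: seg_int_le; [exact: cx2cosX|exact: continuousD_fun|].
move=> x x01; have /andP[c0 _] := cos_range x01.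
have h1 := id_le_4sin x01; have h2 := sin2cos2 x.
have /andP[x0 _] := x01.
have -> : 16 * cos x ^+ n + - 16 * cos x ^+ n.+2 = 16 * (1 - cos x ^+ 2) * cos x ^+ n.
  by rewrite !exprS; ring.
rewrite ler_wpM2r ?exprn_ge0// -h2; nra.
Qed.

Lemma wallis2_0 : wallis2 0 = (pi / 2) ^+ 3 / 3.
Proof.
rewrite /wallis2 (seg_int_ftc (F := fun x => 3^-1 * x ^+ 3)) ?pihalf_gt0//.
- by field.
- exact: cx2cosX.
- by move=> x; apply: der_eq; [apply: dscale; exact: dcube|rewrite expr0; field].
Qed.

Lemma basel_partial n : \sum_(1 <= k < n.+1) (k%:R ^+ 2)^-1 =
  pi ^+ 2 / 6 - 2 * wallis2 n.*2 / wallis n.*2 :> R.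
Proof.
elim: n => [|n IH].
  rewrite big_geq// wallis2_0 wallis0.
  by have := pi_gt0 R; move: (pi : R) => p p0; field; rewrite gt_eqF.
rewrite big_nat_recr//= IH doubleS.
have := wallis2_rec n.*2; have := wallis_rec n.*2.
have w0 : wallis n.*2 != 0 by rewrite gt_eqF// wallis_gt0.
have -> : n.*2.+2%:R = 2 * n.+1%:R :> R by rewrite -natrM -doubleS mul2n.
have -> : n.*2.+1%:R = 2 * n.+1%:R - 1 :> R.
  by rewrite -natrM mul2n doubleS -[n.*2.+2%:R]natr1 addrK.
have k0 : (n.+1%:R : R) != 0 by rewrite pnatr_eq0.
have k1 : 2 * (n.+1%:R : R) - 1 != 0.
  rewrite subr_eq0 -natrM -[1]/(1%:R) eqr_nat; apply/eqP; lia.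
move: (n.+1%:R : R) k0 k1 => k k0 k1 h1 h2.
have e1 : wallis n.*2.+2 = (2 * k - 1) * wallis n.*2 / (2 * k).
  by rewrite -h1; field.
have e2 : wallis2 n.*2.+2 =
    (2 * k * (2 * k - 1) * wallis2 n.*2 - 2 * wallis n.*2.+2) / (2 * k) ^+ 2.
  by rewrite h2; field.
rewrite e2 e1; field.
by rewrite ?w0 ?k0 ?k1.
Qed.

Lemma basel : (fun n => \sum_(1 <= k < n.+1) ((k%:R : R) ^+ 2)^-1) @ \oo -->
  (pi ^+ 2 / 6 : R).
Proof.
have h n : pi ^+ 2 / 6 - 32 / n.+1%:R <=
    (\sum_(1 <= k < n.+1) (k%:R ^+ 2)^-1 : R) <= pi ^+ 2 / 6.
  rewrite basel_partial; have w0 := wallis_gt0 n.*2.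
  have /andP[h1 h2] := wallis2_bound n.*2.
  apply/andP; split; last first.
    by rewrite gerBl divr_ge0 ?mulr_ge0// ltW.
  rewrite lerD2l lerN2 ler_pdivrMr//.
  have : 16 * wallis n.*2 / n.*2.+2%:R <= 16 * wallis n.*2 / n.+1%:R.
    rewrite ler_wpM2l ?mulr_ge0 ?(ltW w0)// lef_pV2 ?posrE ?ltr0n//.
    by rewrite ler_nat ltnS -addnn; apply: leq_trans (leq_addr _ _) _.
  move=> /(le_trans h2) h3.
  rewrite (_ : 32 / n.+1%:R * wallis n.*2 = 2 * (16 * wallis n.*2 / n.+1%:R)).
    by rewrite ler_wpM2l.
  by ring.
apply: (@cvg_of_dist _ _ _ _ (fun n => 32 * n.+1%:R^-1)).
  apply: nearW => n; have /andP[h1 h2] := h n.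
  have h3 : 0 <= 32 / n.+1%:R :> R by rewrite divr_ge0.
  move: (\sum_(1 <= k < n.+1) _) (pi ^+ 2 / 6) (32 / _) h1 h2 h3 => S P K h1 h2 h3.
  by rewrite ler_norml; apply/andP; split; lra.
rewrite -[X in _ --> X](mulr0 (32 : R)).
by apply: cvgM; [exact: cvg_cst|exact: cvg_harmonic].
Qed.

End Wallis.

(** * The trapezoid rule *)

Section Trapezoid.
Variable R : realType.
Implicit Types (f F df : R -> R) (a b : R).

(** For a convex function the error has a sign and is controlled by the variation of
the derivative, a bound that adds up to a telescoping sum. *)
Lemma trapezoid_error F f df a b : a <= b ->
  (forall x, a <= x <= b -> der x F (f x)) ->
  (forall x, a <= x <= b -> der x f (df x)) ->
  (forall x y, a <= x -> x <= y -> y <= b -> df x <= df y) ->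
  0 <= (b - a) * (f a + f b) / 2 - (F b - F a) <= (b - a) ^+ 2 * (df b - df a).
Proof.
move=> ab dF df' mdf.
pose D t := (t - a) * (f a + f t) / 2 - (F t - F a).
pose D' t := (1 * (f a + f t) + (t - a) * df t) / 2 - f t.
have Da : D a = 0 by rewrite /D !subrr !mul0r subr0.
have dD x : a <= x <= b -> der x D (D' x).
  move=> xab; apply: dsub; last first.
    by apply: der_eq; [apply: dsub; [exact: dF|exact: dcst]|rewrite subr0].
  apply: der_eq.
    apply: dmul; last exact: dcst.
    apply: dmul; first by apply: dsub; [exact: did|exact: dcst].
    by apply: dadd; [exact: dcst|exact: df'].
  by rewrite /=; ring.
have bD x : a < x < b -> 0 <= D' x <= (b - a) * (df b - df a).
  move=> /andP[ax xb].
  have [|c /andP[ac cx] E] := @mvt _ f df a x ax.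
    by move=> z /andP[az zx]; apply: df'; rewrite az (le_trans zx)// ltW.
  have -> : D' x = (x - a) * (df x - df c) / 2.
    by rewrite /D'; move: E => /eqP; rewrite subr_eq => /eqP ->; field.
  have h1 : df c <= df x by apply: mdf; rewrite ?ltW.
  have h2 : df a <= df c by apply: mdf; rewrite ?(ltW ac) ?lexx// ltW// (lt_trans cx).
  have h3 : df x <= df b by apply: mdf; rewrite ?lexx ?(ltW ax) ?(ltW xb).
  have h4 : 0 <= (x - a) * (df x - df c) by rewrite mulr_ge0// subr_ge0// ltW.
  have h5 : (x - a) * (df x - df c) <= (b - a) * (df b - df a).
    by rewrite ler_pM// ?subr_ge0 ?(ltW ax)// ?lerD2r ?(ltW xb)//; lra.
  by apply/andP; split; lra.
rewrite -/(D b); apply/andP; split.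
  by rewrite -Da; apply: (der_ge0_le ab dD) => x /bD/andP[].
rewrite -subr_ge0.
rewrite -[leLHS](_ : (b - a) * (df b - df a) * a - D a - (b - a) * (df b - df a) * a = 0); last by rewrite Da; ring.
have -> : (b - a) ^+ 2 * (df b - df a) - D b =
  ((b - a) * (df b - df a) * b - D b) - (b - a) * (df b - df a) * a by ring.
rewrite lerD2r.
apply: (@der_ge0_le _ (fun t => (b - a) * (df b - df a) * t - D t)
   (fun t => (b - a) * (df b - df a) * 1 - D' t) a b ab).
  by move=> x xab; apply: dsub; [apply: dscale; exact: did|exact: dD].
by move=> x /bD/andP[_ h]; rewrite mulr1 subr_ge0.
Qed.

Lemma trapezoid_sum F f df y M : 0 < y ->
  (forall x, 0 < x -> der x F (f x)) ->
  (forall x, 0 < x -> der x f (df x)) ->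
  (forall s t, 0 < s -> s <= t -> df s <= df t) ->
  0 <= y * \sum_(1 <= m < M.+2) f (y * m%:R) - y * (f y + f (y * M.+1%:R)) / 2
       - (F (y * M.+1%:R) - F y) <= y ^+ 2 * (df (y * M.+1%:R) - df y).
Proof.
move=> y0 dF df' mdf; elim: M => [|M IH].
  by rewrite big_nat1 mulr1 !subrr mulr0; apply/andP; split; lra.
have yM : 0 < y * M.+1%:R by rewrite mulr_gt0.
have E : y * M.+2%:R - y * M.+1%:R = y by rewrite -[M.+2%:R]natr1; ring.
have := @trapezoid_error F f df (y * M.+1%:R) (y * M.+2%:R).
rewrite -subr_ge0 E (ltW y0) => /(_ isT) H.
have {H}/andP[h1 h2] := H (fun x hx => dF x (lt_le_trans yM (proj1 (andP hx))))
  (fun x hx => df' x (lt_le_trans yM (proj1 (andP hx))))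
  (fun s t hs st _ => mdf s t (lt_le_trans yM hs) st).
rewrite big_nat_recr//=.
move/andP: IH => [h3 h4].
by apply/andP; split; lra.
Qed.

End Trapezoid.

(** * Stirling's formula *)

Section Stirling.
Variable R : realType.

Definition stirling_dev n : R :=
  ln n`!%:R - (n%:R + 2^-1) * ln n%:R + n%:R.

Lemma ln_fact n : ln n`!%:R = \sum_(1 <= m < n.+1) ln m%:R :> R.
Proof.
elim: n => [|n IH]; first by rewrite big_geq// fact0 ln1.
by rewrite factS natrM lnM ?posrE ?ltr0n ?fact_gt0// big_nat_recr//= IH addrC.
Qed.

(** The trapezoid rule for [- ln] between two consecutive integers. *)
Lemma stirling_dev_step n :
  (0 : R) <= stirling_dev n.+1 - stirling_dev n.+2 <= n.+1%:R^-1 - n.+2%:R^-1.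
Proof.
have n1 : 0 < n.+1%:R :> R by [].
have n12 : n.+1%:R <= n.+2%:R :> R by rewrite ler_nat.
have := @trapezoid_error R (fun t => t - t * ln t) (fun t => - ln t)
  (fun t => - t^-1) n.+1%:R n.+2%:R n12.
have E : n.+2%:R - n.+1%:R = 1 :> R by rewrite -[n.+2%:R]natr1 addrC addKr.
have d1 (x : R) : n.+1%:R <= x <= n.+2%:R -> der x (fun t => t - t * ln t) (- ln x).
  move=> /andP[hx _]; have x0 : 0 < x by apply: lt_le_trans hx.
  apply: der_eq.
    apply: dsub; first exact: did.
    by apply: dmul; [exact: did|exact: is_derive1_ln].
  by rewrite /= mulfV ?gt_eqF//; ring.
have d2 (x : R) : n.+1%:R <= x <= n.+2%:R -> der x (fun t => - ln t) (- x^-1).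
  move=> /andP[hx _]; have x0 : 0 < x by apply: lt_le_trans hx.
  by apply: dopp; exact: is_derive1_ln.
have d3 (x z : R) : n.+1%:R <= x -> x <= z -> z <= n.+2%:R -> - x^-1 <= - z^-1.
  move=> hx xz _; have x0 : 0 < x by apply: lt_le_trans hx.
  by rewrite lerN2 lef_pV2 ?posrE// (lt_le_trans x0).
move=> /(_ d1 d2 d3); rewrite E.
rewrite /stirling_dev (factS n.+1) natrM lnM ?posrE ?ltr0n ?fact_gt0//.
have -> : n.+2%:R = n.+1%:R + 1 :> R by rewrite natr1.
move: (ln n.+1`!%:R) (ln (n.+1%:R + 1)) (ln n.+1%:R) => a b c.
set x := (X in 0 <= X <= _); set y := (X in _ -> 0 <= X <= _).
have -> : x = y by rewrite /x /y; field.
by rewrite expr1n mul1r opprK addrC.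
Qed.

Lemma stirling_dev_cvg : cvgn stirling_dev.
Proof.
suff : cvgn (fun n => stirling_dev n.+1).
  by move=> /cvg_ex[l hl]; apply/cvg_ex; exists l; rewrite -cvg_shiftS.
apply: nonincreasing_is_cvgn.
  by apply/nonincreasing_seqP => n; have /andP[h _] := stirling_dev_step n; rewrite -subr_ge0.
exists (stirling_dev 1 - 1) => _ [n _ <-].
have h : stirling_dev 1 - stirling_dev n.+1 <= 1 - n.+1%:R^-1.
  elim: n => [|n IH]; first by rewrite invr1 !subrr.
  have /andP[_] := stirling_dev_step n; move: IH.
  by move: (stirling_dev _) (stirling_dev _) (stirling_dev _) (_^-1) (_^-1) => x y z u v; lra.
have : 0 <= n.+1%:R^-1 :> R by [].
by move: h; move: (stirling_dev _) (stirling_dev _) (_^-1) => x y u; lra.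
Qed.

Lemma wallis_fact n :
  wallis R n.*2 * (4 ^+ n * n`!%:R ^+ 2) = pi / 2 * (n.*2)`!%:R.
Proof.
elim: n => [|n IH]; first by rewrite wallis0 fact0 expr0 expr1n !mulr1.
have := wallis_rec R n.*2.
rewrite doubleS !factS !natrM.
have -> : n.*2.+2%:R = 2 * n.+1%:R :> R by rewrite -natrM -doubleS mul2n.
move: (n.*2.+1%:R : R) => k h.
have n0 : n.+1%:R != 0 :> R by rewrite pnatr_eq0.
have -> : wallis R n.*2.+2 = k * wallis R n.*2 / (2 * n.+1%:R).
  by rewrite -h; field.
have -> : pi / 2 * (2 * n.+1%:R * (k * (n.*2)`!%:R)) =
    2 * n.+1%:R * k * (pi / 2 * (n.*2)`!%:R) :> R by ring.
rewrite -IH exprS; field.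
by [].
Qed.

Lemma wallis_cvg : (fun n => n.+1%:R * wallis R n.+1.*2 ^+ 2) @ \oo --> (pi / 4 : R).
Proof.
have p0 := pi_gt0 R.
apply: (@cvg_of_dist _ _ _ _ (fun n => pi / 4 * n.+1%:R^-1)); last first.
  rewrite -[X in _ --> X](mulr0 (pi / 4)).
  by apply: cvgM; [exact: cvg_cst|exact: cvg_harmonic].
apply: nearW => n.
have [h1 _] := wallis_sqr_bounds R n.+1.*2.
have [_ h2] := wallis_sqr_bounds R n.+1.*2.-1.
rewrite prednK ?double_gt0// in h2.
have k2 : n.+1.*2%:R = 2 * n.+1%:R :> R by rewrite -natrM mul2n.
rewrite -[n.+1.*2.+1%:R]natr1 in h1.
have k0 : 0 < n.+1%:R :> R by [].
rewrite !k2 in h1 h2.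
rewrite ler_pdivrMr in h1; last by lra.
move: (wallis _ _ ^+ 2) (pi : R) (n.+1%:R : R) p0 k0 h1 h2 => w p k p0 k0 h1 h2.
rewrite ler_norml; apply/andP; split; last first.
  have : 0 <= p / 4 * k^-1 by rewrite mulr_ge0 ?divr_ge0 ?invr_ge0//; lra.
  lra.
have e : p / 4 * k^-1 * k = p / 4 by field; rewrite gt_eqF.
rewrite -subr_ge0 opprK; set x := p / 4 * k^-1 in e *.
suff : 0 <= (k * w - p / 4 + x) * k by rewrite pmulr_lge0.
rewrite mulrDl e; nra.
Qed.

(** The deviations converge, and the limit [l] is found from [2 * l - l] along
[2 * (dev n) - dev (2 * n)], which [wallis_fact] turns into Wallis' product. *)
Theorem stirling : stirling_dev @ \oo --> (ln (2 * pi) / 2 : R).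
Proof.
have p0 := pi_gt0 R.
have /cvg_ex[C hC] := stirling_dev_cvg.
have h1 : (fun n => stirling_dev n.+1) @ \oo --> C by rewrite (cvg_shiftS stirling_dev).
have h2 : (fun n => stirling_dev n.+1.*2) @ \oo --> C.
  apply: (cvg_comp (fun n => n.+1.*2) stirling_dev _ hC).
  move=> P [N _ NP]; exists N => // n /= Nn; apply: NP => /=.
  by rewrite -addnn; apply: (leq_trans Nn); apply: leq_trans (leq_addr _ _).
have h3 : (fun n => stirling_dev n.+1 + stirling_dev n.+1 - stirling_dev n.+1.*2) @ \oo --> C + C - C.
  by apply: cvgB => //; apply: cvgD.
rewrite addrK in h3.
suff h4 : (fun n => stirling_dev n.+1 + stirling_dev n.+1 - stirling_dev n.+1.*2) @ \oo -->
    (ln (2 * pi) / 2 : R).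
  by rewrite -(cvg_unique _ h3 h4).
have -> : (fun n => stirling_dev n.+1 + stirling_dev n.+1 - stirling_dev n.+1.*2) =
    (fun n => (ln (pi / 2) + ln 2 / 2) - ln (n.+1%:R * wallis R n.+1.*2 ^+ 2) / 2).
  apply/funext => n.
  have w0 := wallis_gt0 R n.+1.*2.
  have f0 (k : nat) : 0 < k`!%:R :> R by rewrite ltr0n fact_gt0.
  have := congr1 (@ln R) (wallis_fact n.+1).
  rewrite !lnM ?posrE ?mulr_gt0 ?exprn_gt0 ?invr_gt0//.
  rewrite !lnXn// (_ : 4 = 2 ^+ 2) ?lnXn//; last by rewrite expr2 -natrM.
  rewrite /stirling_dev.
  have -> : n.+1.*2%:R = 2 * n.+1%:R :> R by rewrite -natrM mul2n.
  rewrite lnM ?posrE//.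
  move: (ln (wallis _ _)) (ln n.+1`!%:R) (ln (n.+1.*2)`!%:R) (ln 2) (ln n.+1%:R) (ln pi) (ln 2^-1) => a b c d e f g.
  rewrite -[d *+ 2]mulr_natl -[_ *+ n.+1]mulr_natl => h.
  have -> : c = a + (n.+1%:R * (2 * d) + (b + b)) - (f + g) by rewrite h; ring.
  by field.
have -> : ln (2 * pi) / 2 = (ln (pi / 2) + ln 2 / 2) - ln (pi / 4) / 2 :> R.
  rewrite !lnM ?posrE ?invr_gt0// !lnV ?posrE// (_ : 4 = 2 ^+ 2) ?lnXn//; last by rewrite expr2 -natrM.
  by move: (ln 2) (ln pi) => u v; rewrite -[u *+ 2]mulr_natl; field.
apply: cvgB; first exact: cvg_cst.
apply: cvgM; last exact: cvg_cst.
apply: cvg_comp; first exact: wallis_cvg.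
by apply: continuous_ln; rewrite divr_gt0.
Qed.

End Stirling.

(** * Fractional parts of the multiples of an irrational number *)

Section FracPart.
Variable R : realType.
Implicit Types x y t : R.

Lemma frac_part_ge0 x : 0 <= frac_part x.
Proof. by rewrite subr_ge0 floor_le_tmp. Qed.

Lemma frac_part_lt1 x : frac_part x < 1.
Proof. by rewrite ltrBlDr addrC -intrD1 floorD1_gt. Qed.

Lemma frac_partDz x (z : int) : frac_part (x + z%:~R) = frac_part x.
Proof. rewrite /frac_part floorDrz ?intr_int// intrKfloor intrD; ring. Qed.

Lemma bernoulli1_bound x : `|bernoulli1 x| <= 2^-1.
Proof.
have := frac_part_ge0 x; have := frac_part_lt1 x.
by rewrite /bernoulli1 ler_norml; lra.
Qed.

Lemma bernoulli1Dz x (z : int) : bernoulli1 (x + z%:~R) = bernoulli1 x.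
Proof. by rewrite /bernoulli1 frac_partDz. Qed.

(** half of the second periodic Bernoulli function, a primitive of
    [bernoulli1]; being continuous it makes sums of [bernoulli1] along a small
    step telescope up to a small error at each wrap-around. *)
Definition bern2 x : R := (frac_part x ^+ 2 - frac_part x) / 2.

Lemma bern2_bound x : `|bern2 x| <= 1.
Proof.
have := frac_part_ge0 x; have := frac_part_lt1 x; rewrite /bern2 ler_norml.
move: (frac_part x) => u u1 u0; apply/andP; split; nra.
Qed.

(** The last term counts the integers passed between [t] and [t + h]. *)
Lemma bern2_step t h : 0 <= h <= 1 ->
  `|bern2 (t + h) - bern2 t - h * bernoulli1 t| <=
    h ^+ 2 + h * ((Num.floor (t + h))%:~R - (Num.floor t)%:~R).
Proof.
move=> /andP[h0 h1].
have hu := frac_part_ge0 t; have hu1 := frac_part_lt1 t.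
have hv := frac_part_ge0 (t + h); have hv1 := frac_part_lt1 (t + h).
pose w : int := Num.floor (t + h) - Num.floor t.
have vE : frac_part (t + h) = frac_part t + h - w%:~R.
  by rewrite /frac_part /w intrD intrN; ring.
rewrite -intrN -intrD -/w.
have w0 : 0 <= w by rewrite subr_ge0 le_floor// lerDl.
have w2 : w < 2.
  by rewrite -(ltr_int R); move: vE hv hv1; move: (frac_part _) (frac_part _) hu hu1 => u v; lra.
rewrite /bern2 /bernoulli1 vE.
rewrite vE in hv hv1.
have [wE|wE] : w = 0 \/ w = 1 by lia.
  rewrite wE in hv hv1 *; move: (frac_part t) hu hu1 => u hu hu1.
  rewrite ler_norml; apply/andP; split; nra.
rewrite wE in hv hv1 *; move: (frac_part t) hu hu1 hv hv1 => u hu hu1 hv hv1.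
rewrite (_ : _ - _ - _ = h ^+ 2 / 2 - (u + h - 1)); last by field.
rewrite mulr1z in hv hv1 *.
rewrite ler_norml; apply/andP; split; nra.
Qed.

Lemma bernoulli1_sum_step t h K : 0 < h <= 1 ->
  `|\sum_(0 <= k < K) bernoulli1 (t + k%:R * h)| <= 3 / h + 2 * K%:R * h.
Proof.
move=> /andP[h0 h1].
have step : `|bern2 (t + K%:R * h) - bern2 t -
    h * \sum_(0 <= k < K) bernoulli1 (t + k%:R * h)| <=
    K%:R * h ^+ 2 + h * ((Num.floor (t + K%:R * h))%:~R - (Num.floor t)%:~R).
  elim: K => [|K IH].
    by rewrite big_geq// !mul0r addr0 mulr0 !subrr normr0 mulr0 addr0.
  rewrite big_nat_recr//= mulrDr.
  have := @bern2_step (t + K%:R * h) h; rewrite (ltW h0) h1 => /(_ isT).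
  have -> : t + K.+1%:R * h = t + K%:R * h + h by rewrite -natr1; ring.
  rewrite -[K.+1%:R]natr1 => h2.
  move: IH h2.
  set X := bern2 (t + K%:R * h) - _ - _; set Y := bern2 (t + K%:R * h + h) - _ - _.
  rewrite (_ : _ - (_ + _) = X + Y); last by rewrite /X /Y; ring.
  move=> hX hY; apply: le_trans (ler_normD _ _) _; lra.
have f1 : (Num.floor (t + K%:R * h))%:~R <= t + K%:R * h :> R by exact: floor_le_tmp.
have f2 : t < (Num.floor t)%:~R + 1 :> R by rewrite -intrD1 floorD1_gt.
have b1 := bern2_bound t; have b2 := bern2_bound (t + K%:R * h).
have hE : h * (3 / h + 2 * K%:R * h) = 3 + 2 * K%:R * h ^+ 2 by field; rewrite gt_eqF.
rewrite -(ler_pM2l h0) hE -{1}(gtr0_norm h0) -normrM.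
move: b1 b2 step f1 f2; rewrite !ler_norml.
move: (bern2 t) (bern2 _) (Num.floor _)%:~R (Num.floor _)%:~R (\sum_(_ <= _ < _) _) => x y z z' S.
move=> /andP[x1 x2] /andP[y1 y2] /andP[s1 s2] f1 f2.
have f3 : h * (z' - z) <= h * (K%:R * h + 1) by rewrite ler_wpM2l ?ltW//; lra.
by apply/andP; split; nra.
Qed.

Lemma bernoulli1_sum_stepN t h K : 0 < h <= 1 ->
  `|\sum_(0 <= k < K) bernoulli1 (t - k%:R * h)| <= 3 / h + 2 * K%:R * h.
Proof.
move=> h01; have := bernoulli1_sum_step (t - (K%:R - 1) * h) K h01.
rewrite big_nat_rev /= add0n; congr (`|_| <= _).
rewrite big_nat_cond [RHS]big_nat_cond; apply: eq_bigr => k /andP[/andP[_ kK] _].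
by rewrite natrB// -natr1; congr bernoulli1; ring.
Qed.

(** Grouping by residue classes modulo [d]. *)
Lemma sum_blocks (f : nat -> R) K d :
  \sum_(0 <= j < (K * d)) f j = \sum_(0 <= r < d) \sum_(0 <= k < K) f (k * d + r)%N.
Proof.
rewrite exchange_big /=; elim: K => [|K IH]; first by rewrite mul0n !big_geq.
rewrite big_nat_recr//= -IH mulSn addnC.
rewrite (@big_cat_nat _ _ _ (K * d)%N) ?leq_addr//=; congr (_ + _).
rewrite -{1}[(K * d)%N]add0n big_addn addKn.
by apply: eq_bigr => r _; rewrite addnC.
Qed.

(** Dirichlet's pigeonhole argument; irrationality excludes a zero distance. *)
Lemma small_multiple (alpha e : R) : irrational alpha -> 0 < e ->
  exists2 d : nat, (0 < d)%N & exists p : int, 0 < `|alpha * d%:R - p%:~R| <= e.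
Proof.
move=> irr e0.
pose N := (Num.truncn e^-1).+1.
have Ne : e^-1 < N%:R by apply: truncnS_gt.
have N0 : 0 < N%:R :> R by rewrite ltr0n.
have bnd (k : nat) : (Num.truncn (N%:R * frac_part (alpha * k%:R)) < N)%N.
  rewrite -(ltr_nat R); apply: le_lt_trans (_ : N%:R * frac_part (alpha * k%:R) < _).
    by rewrite truncn_le// mulr_ge0 ?frac_part_ge0// ltW.
  by rewrite gtr_pMr// frac_part_lt1.
pose F (k : 'I_N.+1) : 'I_N := Ordinal (bnd k).
have nF : ~~ injectiveb F.
  apply/negP => /injectiveP iF; have := leq_card F iF.
  by rewrite !card_ord ltnn.
have [i [j ij Fij]] : exists i : 'I_N.+1, exists2 j : 'I_N.+1, (i < j)%N & F i = F j.
  move/injectivePn: nF => [i [j nij Fij]].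
  have [ij|ij|ij] := ltngtP i j; first by exists i, j.
    by exists j, i.
  by move: nij; rewrite (val_inj ij) eqxx.
exists (j - i)%N; first by rewrite subn_gt0.
exists (Num.floor (alpha * j%:R) - Num.floor (alpha * i%:R)).
rewrite natrB 1?ltnW//.
set p : int := _ - _.
have dE : alpha * (j%:R - i%:R) - p%:~R = frac_part (alpha * j%:R) - frac_part (alpha * i%:R).
  by rewrite /p /frac_part intrD intrN; ring.
apply/andP; split; last first.
  rewrite dE; have := congr1 val Fij => /= E.
  have hi : 0 <= N%:R * frac_part (alpha * i%:R) by rewrite mulr_ge0 ?frac_part_ge0// ltW.
  have hj : 0 <= N%:R * frac_part (alpha * j%:R) by rewrite mulr_ge0 ?frac_part_ge0// ltW.
  have := truncn_itv hi; have := truncn_itv hj; rewrite E.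
  move: (Num.truncn _)%:R (Num.truncn _).+1%:R (@natr1 R (Num.truncn (N%:R * frac_part (alpha * j%:R)))) => a b <-.
  move: (frac_part _) (frac_part _) => u v /andP[h1 h2] /andP[h3 h4].
  have : N%:R * `|v - u| <= 1.
    by rewrite -{1}(gtr0_norm N0) -normrM ler_norml; apply/andP; split; nra.
  rewrite -ler_pdivlMl// mulr1 => /le_trans; apply.
  by rewrite -[leRHS]invrK lef_pV2 ?posrE ?invr_gt0// ltW.
rewrite normr_gt0; apply/eqP => E.
apply: irr; apply/rationalP; exists p, (j - i)%N.
have ji : (j - i)%:R != 0 :> R by rewrite pnatr_eq0 -lt0n subn_gt0.
move/eqP: E; rewrite -natrB 1?ltnW// subr_eq0 => /eqP <-.
by rewrite mulfK.
Qed.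

(** The fractional parts of an irrational rotation average to 1/2: a multiple
    [d alpha] close to an integer turns each residue class mod [d] into a walk
    with a small step. *)
Theorem bernoulli1_discrepancy (alpha e : R) : irrational alpha -> 0 < e ->
  exists C : R, forall M, `|\sum_(1 <= j < M.+1) bernoulli1 (alpha * j%:R)| <= e * M%:R + C.
Proof.
move=> irr e0.
have [|d d0 [p /andP[h0 he]]] := @small_multiple alpha (Num.min 1 (e / 2)) irr.
  by rewrite lt_min ltr01 divr_gt0.
set h := `|_| in h0 he; move: he; rewrite le_min => /andP[h1 he].
(* [3 * d / h] for the [d] residue classes, [d] for the incomplete last block, 1 for
   the index 0 *)
exists (e + 3 * d%:R / h + d%:R + 1) => M.
have d0' : 0 < d%:R :> R by rewrite ltr0n.
pose K := (M.+1 %/ d)%N.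
have KM : (K * d <= M.+1)%N by exact: leq_divM.
have S0 : \sum_(1 <= j < M.+1) bernoulli1 (alpha * j%:R) =
    \sum_(0 <= j < K * d) bernoulli1 (alpha * j%:R) +
    \sum_(K * d <= j < M.+1) bernoulli1 (alpha * j%:R) - bernoulli1 (alpha * 0).
  by rewrite -big_cat_nat//= [X in _ = X - _]big_ltn// [RHS]addrC addKr.
have S1 : `|\sum_(K * d <= j < M.+1) bernoulli1 (alpha * j%:R)| <= d%:R.
  apply: le_trans (ler_norm_sum _ _ _) _.
  apply: (@le_trans _ _ (\sum_(K * d <= j < M.+1) 1)).
    by apply: ler_sum => j _; apply: le_trans (bernoulli1_bound _) _; lra.
  rewrite sumr_const_nat ler_nat leq_subLR {1}(divn_eq M.+1 d) -/K.
  by rewrite leq_add2l ltnW// ltn_mod.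
have S2 : `|\sum_(0 <= j < K * d) bernoulli1 (alpha * j%:R)| <= d%:R * (3 / h + 2 * K%:R * h).
  rewrite sum_blocks; apply: le_trans (ler_norm_sum _ _ _) _.
  apply: (@le_trans _ _ (\sum_(0 <= r < d) (3 / h + 2 * K%:R * h))); last first.
    by rewrite big_const_nat subn0 iter_addr_0 -[leLHS]mulr_natl.
  apply: ler_sum => r _.
  have hh : 0 < h <= 1 by rewrite h0.
  have [p0|p0] := leP 0 (alpha * d%:R - p%:~R).
    have hE : h = alpha * d%:R - p%:~R by rewrite /h ger0_norm.
    apply: le_trans (bernoulli1_sum_step (alpha * r%:R) K hh).
    rewrite le_eqVlt; apply/orP; left; apply/eqP; congr `|_|.
    apply: eq_bigr => k _.
    rewrite -[RHS](bernoulli1Dz _ (k%:Z * p)); congr bernoulli1.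
    by rewrite hE intrM -pmulrn natrD natrM; ring.
  have hE : h = - (alpha * d%:R - p%:~R) by rewrite /h ltr0_norm.
  apply: le_trans (bernoulli1_sum_stepN (alpha * r%:R) K hh).
  rewrite le_eqVlt; apply/orP; left; apply/eqP; congr `|_|.
  apply: eq_bigr => k _.
  rewrite -[RHS](bernoulli1Dz _ (k%:Z * p)); congr bernoulli1.
  by rewrite hE intrM -pmulrn natrD natrM; ring.
have S3 := bernoulli1_bound (alpha * 0).
have S4 : 2 * (K * d)%:R * h <= e * M%:R + e.
  have : (K * d)%:R <= M.+1%:R :> R by rewrite ler_nat.
  rewrite -[M.+1%:R]natr1 => h4.
  have : 2 * (K * d)%:R * h <= 2 * (M%:R + 1) * (e / 2).
    by rewrite ler_pM ?(ltW h0)// ler_wpM2l.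
  lra.
rewrite S0; apply: le_trans (ler_normB _ _) _.
apply: le_trans (lerD (ler_normD _ _) (lexx _)) _.
have E : d%:R * (3 / h + 2 * K%:R * h) = 3 * d%:R / h + 2 * (K * d)%:R * h.
  by rewrite natrM; ring.
rewrite E in S2; move: (3 * d%:R / h) S2 => Q S2; lra.
Qed.

End FracPart.

(** * The dilogarithm of [exp (- t)] *)

Section Dilogarithm.
Variable R : realType.
Implicit Types (z t x : R) (c : R ^nat).

Lemma cvg_pseries_bounded c z : (forall n, `|c n| <= 1) -> `|z| < 1 ->
  cvgn (pseries c z).
Proof.
move=> c1 z1; apply: normed_cvg.
apply: (@series_le_cvg _ _ (geometric 1 `|z|)) => [n|n|n|].
- exact: normr_ge0.
- by rewrite /= mul1r exprn_ge0.
- by rewrite /= normrM normrX mul1r ler_piMl// exprn_ge0.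
- by apply: is_cvg_geometric_series; rewrite normr_id.
Qed.

Lemma der_pseries c z : (forall n, `|c n| <= 1) ->
  (forall n, `|pseries_diffs c n| <= 1) ->
  (forall n, `|pseries_diffs (pseries_diffs c) n| <= 1) -> `|z| < 1 ->
  der z (fun x => limn (pseries c x)) (limn (pseries (pseries_diffs c) z)).
Proof.
move=> c0 c1 c2 z1.
pose K : R := (1 + `|z|) / 2.
have K0 : `|K| = K by rewrite ger0_norm// divr_ge0// addr_ge0.
have zK : `|z| < `|K| by rewrite K0 /K; lra.
have K1 : `|K| < 1 by rewrite K0 /K; lra.
by apply: (@pseries_snd_diffs _ c K) => //; apply: cvg_pseries_bounded.
Qed.

Definition log_coeff n : R := n%:R^-1.
Definition dilog_coeff n : R := (n%:R ^+ 2)^-1.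

Lemma invn_le1 n : `|n%:R^-1 : R| <= 1.
Proof.
case: n => [|n]; first by rewrite invr0 normr0.
by rewrite ger0_norm// invf_le1// ler1n.
Qed.

Lemma dilog_coeff_diffs n : pseries_diffs dilog_coeff n = log_coeff n.+1.
Proof.
by rewrite /pseries_diffs /log_coeff /dilog_coeff expr2 invfM mulrA mulfV ?mul1r// pnatr_eq0.
Qed.

(** The remainder of the logarithmic series has derivative [x ^+ n / (1 - x)]. *)
Lemma log_partial z n : 0 <= z < 1 ->
  0 <= - ln (1 - z) - \sum_(1 <= k < n.+1) z ^+ k / k%:R <= z ^+ n / (1 - z).
Proof.
move=> /andP[z0 z1].
pose D (x : R) := - ln (1 - x) - \sum_(1 <= k < n.+1) x ^+ k / k%:R.
have D0 : D 0 = 0.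
  rewrite /D subr0 ln1 oppr0 sub0r big_nat_cond big1 ?oppr0// => k /andP[/andP[k0 _] _].
  by rewrite expr0n eqn0Ngt k0 mul0r.
have dD x : 0 <= x <= z -> der x D (x ^+ n / (1 - x)).
  move=> /andP[x0 xz]; have x1 : 0 < 1 - x by rewrite subr_gt0 (le_lt_trans xz).
  have dS : der x (fun x => \sum_(1 <= k < n.+1) x ^+ k / k%:R) (\sum_(0 <= k < n) x ^+ k).
    elim: n {D D0} => [|m IH].
      rewrite big_geq//; under eq_fun do rewrite big_geq//.
      exact: dcst.
    rewrite big_nat_recr//=; under eq_fun do rewrite big_nat_recr//=.
    apply: dadd => //; apply: der_eq.
      by apply: dmul; [exact: dpow|exact: dcst].
    by rewrite mulr0 addr0 mulrAC mulfV ?mul1r// pnatr_eq0.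
  apply: der_eq.
    apply: dsub; last exact: dS.
    by apply: dopp; apply: dln; [exact: x1|apply: dsub; [exact: dcst|exact: did]].
  have := subrX1 x n; rewrite -(big_mkord xpredT (fun i => x ^+ i)) => h.
  rewrite sub0r mulNr opprK mul1r.
  have -> : \sum_(0 <= k < n) x ^+ k = (1 - x ^+ n) / (1 - x).
    by rewrite -[1 - x ^+ n]opprB h; field; rewrite gt_eqF.
  by field; rewrite gt_eqF.
rewrite -/(D z); apply/andP; split.
  rewrite -D0; apply: (der_ge0_le z0 dD) => x /andP[/ltW x0 xz].
  by rewrite divr_ge0 ?exprn_ge0// subr_ge0 ltW// (lt_trans xz).
have [->|zN0] := eqVneq z 0; first by rewrite D0 subr0 divr1 exprn_ge0.
have zp : 0 < z by rewrite lt_def zN0.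
rewrite -[D z]subr0 -D0.
have [x /andP[/ltW x0 /ltW xz] ->] := mvt zp dD.
have x1 : 0 < 1 - x by rewrite subr_gt0 (le_lt_trans xz).
have z1' : 0 < 1 - z by rewrite subr_gt0.
rewrite subr0 -[leRHS]mulr1 ler_pM ?(ltW z1) ?(ltW zp)//.
  by rewrite divr_ge0 ?exprn_ge0// ltW.
rewrite ler_pM ?exprn_ge0 ?invr_ge0 ?(ltW x1)//; first by rewrite lerXn2r// ?nnegrE ?(le_trans x0).
by rewrite lef_pV2 ?posrE//; lra.
Qed.

Lemma pseries_log z : 0 < z < 1 ->
  limn (pseries (fun n => log_coeff n.+1) z) = - ln (1 - z) / z.
Proof.
move=> /andP[z0 z1]; apply/cvg_lim => //.
apply: (@cvg_of_dist _ _ _ _ (fun n => geometric (1 / (1 - z) / z) z n)); last first.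
  by apply: cvg_geometric; rewrite gtr0_norm.
apply: nearW => n.
have := @log_partial z n; rewrite (ltW z0) z1 => /(_ isT)/andP[h1 h2].
have -> : pseries (fun n => log_coeff n.+1) z n = (\sum_(1 <= k < n.+1) z ^+ k / k%:R) / z.
  rewrite /pseries /series /= big_add1 /= mulr_suml; apply: eq_bigr => k _.
  rewrite /log_coeff; have k0 : k.+1%:R != 0 :> R by rewrite pnatr_eq0.
  move: (k.+1%:R : R) k0 => q q0.
  by rewrite exprS; field; rewrite q0 gt_eqF.
rewrite -mulrBl normrM ler0_norm; last by move: h1; lra.
rewrite gtr0_norm ?invr_gt0// /= mul1r mulrAC ler_wpM2r ?invr_ge0 ?(ltW z0)//.
by rewrite mulrC; move: h2; lra.
Qed.

(** Up to sign a primitive of [lgeo], with value [pi ^+ 2 / 6] at the origin; this is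
how [pi ^+ 2 / 6] enters the growth rate. *)
Definition dilog_exp t : R := limn (pseries dilog_coeff (expR (- t))).

Lemma dilog_coeff_ge0 n : 0 <= dilog_coeff n.
Proof. by rewrite invr_ge0 sqr_ge0. Qed.

Lemma dilog_coeff_le1 n : `|dilog_coeff n| <= 1.
Proof. by rewrite /dilog_coeff -exprVn normrX expr_le1// invn_le1. Qed.

Lemma expN_lt1 t : 0 < t -> (0 : R) < expR (- t) < 1.
Proof. by move=> t0; rewrite expR_gt0 expR_lt1 oppr_lt0. Qed.

Lemma ddilog_exp t : 0 < t -> der t dilog_exp (- lgeo t).
Proof.
move=> t0; have /andP[e0 e1] := expN_lt1 t0.
apply: der_eq.
  apply: (@dcomp _ (fun z => limn (pseries dilog_coeff z)) (fun t => expR (- t))).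
    by apply: dexp; apply: dopp; exact: did.
  apply: der_pseries => [n|n|n|].
  - exact: dilog_coeff_le1.
  - by rewrite dilog_coeff_diffs; exact: invn_le1.
  - rewrite {1}/pseries_diffs dilog_coeff_diffs /log_coeff ger0_norm ?divr_ge0//.
    by rewrite ler_pdivrMr// mul1r ler_nat.
  - by rewrite gtr0_norm.
rewrite (_ : pseries_diffs dilog_coeff = fun n => log_coeff n.+1); last first.
  by apply/funext => n; exact: dilog_coeff_diffs.
rewrite /= pseries_log ?e0//.
rewrite /lgeo bose1D// lnV ?posrE ?subr_gt0//; field.
by rewrite gt_eqF.
Qed.

Lemma dilog_exp_partial t n : 0 < t ->
  \sum_(1 <= k < n.+1) expR (- t) ^+ k / k%:R ^+ 2 <= dilog_exp t.
Proof.
move=> t0; have /andP[e0 e1] := expN_lt1 t0.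
have -> : \sum_(1 <= k < n.+1) expR (- t) ^+ k / k%:R ^+ 2 =
    pseries dilog_coeff (expR (- t)) n.+1.
  rewrite /pseries /series /= [RHS]big_ltn// /dilog_coeff expr0n /= invr0 mul0r add0r.
  by apply: eq_bigr => k _; rewrite mulrC.
apply: nondecreasing_cvgn_le.
  apply/nondecreasing_seqP => m.
  by rewrite /pseries /series /= big_nat_recr//= lerDl mulr_ge0 ?dilog_coeff_ge0// exprn_ge0// ltW.
by apply: cvg_pseries_bounded; [exact: dilog_coeff_le1|rewrite gtr0_norm].
Qed.

Lemma dilog_exp_ge0 t : 0 < t -> 0 <= dilog_exp t.
Proof. by move=> t0; have := dilog_exp_partial 0 t0; rewrite big_geq. Qed.

Lemma dilog_exp_ub t (B : R) : 0 < t ->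
  (forall n, \sum_(1 <= k < n.+1) expR (- t) ^+ k / k%:R ^+ 2 <= B) -> dilog_exp t <= B.
Proof.
move=> t0 hB; have /andP[e0 e1] := expN_lt1 t0.
apply: limr_le.
  by apply: cvg_pseries_bounded; [exact: dilog_coeff_le1|rewrite gtr0_norm].
exists 1%N => // -[//|n] _.
apply: le_trans (hB n); rewrite /pseries /series /=.
rewrite big_ltn// /dilog_coeff expr0n /= invr0 mul0r add0r.
by rewrite le_eqVlt; apply/orP; left; apply/eqP; apply: eq_bigr => k _; rewrite mulrC.
Qed.

Lemma basel_ub n : \sum_(1 <= k < n.+1) ((k%:R : R) ^+ 2)^-1 <= pi ^+ 2 / 6.
Proof.
have w0 := wallis_gt0 R n.*2; have /andP[h1 _] := wallis2_bound R n.*2.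
by rewrite basel_partial gerBl divr_ge0 ?mulr_ge0// ltW.
Qed.

Lemma dilog_exp_le t : 0 < t -> dilog_exp t <= pi ^+ 2 / 6.
Proof.
move=> t0; have /andP[e0 e1] := expN_lt1 t0.
apply: dilog_exp_ub => // n; apply: le_trans (basel_ub n).
apply: ler_sum_nat => k _; rewrite ler_piMl ?invr_ge0 ?sqr_ge0//.
by rewrite exprn_ile1 ?ltW.
Qed.

Lemma dilog_exp_decay t : 0 < t -> dilog_exp t <= expR (- t) * (pi ^+ 2 / 6).
Proof.
move=> t0; have /andP[e0 e1] := expN_lt1 t0.
apply: dilog_exp_ub => // n.
apply: (@le_trans _ _ (expR (- t) * \sum_(1 <= k < n.+1) ((k%:R : R) ^+ 2)^-1)); last first.
  by rewrite ler_wpM2l ?(ltW e0)// basel_ub.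
rewrite mulr_sumr; apply: ler_sum_nat => -[//|k] _.
rewrite ler_wpM2r ?invr_ge0 ?sqr_ge0// exprS ler_piMr ?(ltW e0)//.
by rewrite exprn_ile1 ?ltW.
Qed.

Lemma dilog_exp_cvg0 : dilog_exp t @[t --> 0^'+] --> (pi ^+ 2 / 6 : R).
Proof.
apply/cvgrPdist_le => e e0.
have /cvgrPdist_le/(_ _ (divr_gt0 e0 (ltr0n R 2))) [N _ hN] := @basel R.
have {hN} := hN N (leqnn N); rewrite /= => hN.
have : (fun t : R => \sum_(1 <= k < N.+1) expR (- t) ^+ k / k%:R ^+ 2) @ 0^'+ -->
    \sum_(1 <= k < N.+1) ((k%:R : R) ^+ 2)^-1.
  have -> : \sum_(1 <= k < N.+1) ((k%:R : R) ^+ 2)^-1 =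
      \sum_(1 <= k < N.+1) expR (- 0) ^+ k / k%:R ^+ 2.
    by apply: eq_bigr => k _; rewrite oppr0 expR0 expr1n mul1r.
  apply: cvg_at_right_filter.
  suff [d hd] : exists d, der 0 (fun t : R => \sum_(1 <= k < N.+1) expR (- t) ^+ k / k%:R ^+ 2) d.
    exact: der_continuous hd.
  elim: N {hN} => [|N [d IH]].
    by exists 0; under eq_fun do rewrite big_geq//; exact: dcst.
  eexists; under eq_fun do rewrite big_nat_recr//=.
  apply: dadd; first exact: IH.
  apply: dmul; last exact: dcst.
  apply: (@dcomp _ (fun x => x ^+ N.+1) (fun t => expR (- t))); last exact: dpow.
  by apply: dexp; apply: dopp; exact: did.
move=> /cvgrPdist_le/(_ _ (divr_gt0 e0 (ltr0n R 2))).
apply: filterS2 (nbhs_right_gt 0) => t t0.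
have := dilog_exp_partial N t0; have := dilog_exp_le t0; move: hN.
move: (\sum_(_ <= _ < _) _) (\sum_(_ <= _ < _) _) (dilog_exp t) (pi ^+ 2 / 6) => a b c d.
by rewrite !ler_norml => /andP[h1 h2] h3 h4 /andP[h5 h6]; apply/andP; split; lra.
Qed.

End Dilogarithm.

(** * Riemann sums of decreasing functions *)

Section RiemannSums.
Variable R : realType.
Implicit Types (f F : R -> R) (B l y t s x alpha : R) (p : nat -> R).

Definition decr_pos f := forall s t, 0 < s -> s <= t -> f t <= f s.

(** The mean value inequality up to the origin, where [F] only has a limit. *)
Lemma primitive_bounds f F A B l t : 0 < t ->
  (forall s, 0 < s < t -> A <= f s <= B) -> (forall s, 0 < s -> der s F (f s)) ->
  F s @[s --> 0^'+] --> l -> t * A <= F t - l <= t * B.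
Proof.
move=> t0 fB dF FF0.
have h s : 0 < s -> s < t -> (t - s) * A <= F t - F s <= (t - s) * B.
  move=> s0 st; have [|c /andP[sc ct] ->] := @mvt _ F f s t st.
    by move=> z /andP[sz _]; apply: dF; apply: lt_le_trans sz.
  have /andP[h1 h2] : A <= f c <= B by apply: fB; rewrite (lt_trans s0 sc).
  by rewrite [f c * _]mulrC !ler_wpM2l ?subr_ge0 ?(ltW st).
have cF : (F t - F s) @[s --> 0^'+] --> F t - l by apply: cvgB => //; exact: cvg_cst.
have cl c : ((t - s) * c) @[s --> 0^'+] --> t * c.
  apply: cvgM; last exact: cvg_cst.
  rewrite -[X in _ --> X]subr0; apply: cvgB; first exact: cvg_cst.
  by apply: cvg_at_right_filter; exact: cvg_id.
apply/andP; split.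
  apply: (ler_cvg_to (cl _) cF).
  near=> s; have /h : 0 < s by near: s; exact: nbhs_right_gt.
  by move=> /(_ _)/andP[]//; near: s; exact: nbhs_right_lt.
apply: (ler_cvg_to cF (cl _)).
near=> s; have /h : 0 < s by near: s; exact: nbhs_right_gt.
by move=> /(_ _)/andP[]//; near: s; exact: nbhs_right_lt.
Unshelve. all: by end_near. Qed.

(** A Riemann sum of a bounded decreasing function, with one sample point in
    each cell [y(m-1), ym]: the errors of the cells telescope. *)
Lemma riemann_sum f F B l y p M : 0 < y -> decr_pos f ->
  (forall s, 0 < s -> 0 <= f s <= B) -> (forall s, 0 < s -> der s F (f s)) ->
  F s @[s --> 0^'+] --> l ->
  (forall m, 0 < p m.+1 /\ y * m%:R <= p m.+1 <= y * m.+1%:R) ->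
  `|y * \sum_(1 <= m < M.+2) f (p m) - (F (y * M.+1%:R) - l)| <= y * B.
Proof.
move=> y0 fd fB dF FF0 hp.
suff : `|y * \sum_(1 <= m < M.+2) f (p m) - (F (y * M.+1%:R) - l)| <=
    y * (B - f (y * M.+1%:R)).
  move=> /le_trans; apply; rewrite ler_wpM2l ?(ltW y0)// gerBl.
  by have /fB/andP[] : 0 < y * M.+1%:R by rewrite mulr_gt0.
elim: M => [|M IH].
  rewrite big_nat1 mulr1.
  have [p0 /andP[_ p1]] := hp 0%N; rewrite mulr1 in p1.
  have h1 := fd _ _ p0 p1; have /andP[_ h2] := fB _ p0.
  have fB' s : 0 < s < y -> f y <= f s <= B.
    by move=> /andP[s0 sy]; have /andP[_ ->] := fB _ s0; rewrite fd// ltW.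
  have := primitive_bounds y0 fB' dF FF0.
  move=> /andP[h3 h4].
  have : y * f y <= y * f (p 1%N) by rewrite ler_wpM2l// ltW.
  have : y * f (p 1%N) <= y * B by rewrite ler_wpM2l// ltW.
  by rewrite ler_norml mulrBr => h5 h6; apply/andP; split; lra.
rewrite big_nat_recr//=.
have [p0 /andP[p1 p2]] := hp M.+1.
have t0 : 0 < y * M.+1%:R by rewrite mulr_gt0.
have st : y * M.+1%:R < y * M.+2%:R by rewrite ltr_pM2l// ltr_nat.
have [|c /andP[sc ct] E] := @mvt _ F f _ _ st.
  by move=> z /andP[sz _]; apply: dF; apply: lt_le_trans sz.
have c0 := lt_trans t0 sc.
have yE : y * M.+2%:R - y * M.+1%:R = y by rewrite -[M.+2%:R]natr1; ring.
have f1 : y * f (p M.+2) <= y * f (y * M.+1%:R) by rewrite ler_wpM2l ?(ltW y0)// fd.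
have f2 : y * f (y * M.+2%:R) <= y * f (p M.+2) by rewrite ler_wpM2l ?(ltW y0)// fd.
have f3 : y * f c <= y * f (y * M.+1%:R) by rewrite ler_wpM2l ?(ltW y0)// fd// ltW.
have f4 : y * f (y * M.+2%:R) <= y * f c by rewrite ler_wpM2l ?(ltW y0)// fd// ltW.
rewrite yE [f c * y]mulrC in E.
move: IH; rewrite !ler_norml [y * (_ + _)]mulrDr ![y * (B - _)]mulrBr => /andP[h1 h2].
by apply/andP; split; lra.
Qed.

(** The part [bty alpha m] lies in the cell between [alpha * (m - 1)] and [alpha * m]. *)
Lemma riemann_beatty f F B l alpha x M : 1 < alpha -> 0 < x -> decr_pos f ->
  (forall s, 0 < s -> 0 <= f s <= B) -> (forall s, 0 < s -> der s F (f s)) ->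
  F s @[s --> 0^'+] --> l ->
  `|alpha * x * \sum_(1 <= m < M.+2) f (x * (bty alpha m)%:R)
     - (F (alpha * x * M.+1%:R) - l)| <= alpha * x * B.
Proof.
move=> a1 x0 fd fB dF FF0; have a0 : 0 < alpha by exact: lt_trans a1.
apply: (@riemann_sum f F B l _ (fun m => x * (bty alpha m)%:R)) => // [|m].
  by rewrite mulr_gt0.
have hm : (m.+1 <= bty alpha m.+1)%N by apply: index_le_part; exact: bty_mono.
split; first by rewrite mulr_gt0// ltr0n (leq_trans _ hm).
have h1 := frac_part_ge0 (alpha * m.+1%:R); have h2 := frac_part_lt1 (alpha * m.+1%:R).
rewrite [alpha * x]mulrC -!mulrA !ler_pM2l// (btyE a1).
rewrite -natr1 in h1 h2 *; apply/andP; split; nra.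
Qed.

Lemma riemann_grid f F B l y M : 0 < y -> decr_pos f ->
  (forall s, 0 < s -> 0 <= f s <= B) -> (forall s, 0 < s -> der s F (f s)) ->
  F s @[s --> 0^'+] --> l ->
  `|y * \sum_(1 <= m < M.+2) f (y * m%:R) - (F (y * M.+1%:R) - l)| <= y * B.
Proof.
move=> y0 fd fB dF FF0.
apply: (@riemann_sum f F B l _ (fun m => y * m%:R)) => // m.
by rewrite mulr_gt0// lexx andbT ler_pM2l// ler_nat.
Qed.

End RiemannSums.

(** * First and second moments over the Beatty parts *)

Section BosePrimitives.
Variable R : realType.
Implicit Types t s x : R.
Local Notation zeta2 := (pi ^+ 2 / 6 : R).

Lemma lgeo_decr : decr_pos (@lgeo R).
Proof.
move=> s t s0 st; apply: (der_le0_ge st (df := fun x => - bose x)) => x /andP[sx _].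
  by apply: dlgeo; apply: lt_le_trans sx.
by rewrite oppr_le0 ltW// bose_gt0// (lt_trans s0).
Qed.

(** [lgeo] decreases, so [t * lgeo t] is at most its integral over the interval from 0
to [t]. *)
Lemma mul_lgeo_le t : 0 < t -> t * lgeo t <= zeta2 - dilog_exp t.
Proof.
move=> t0.
have cF : (dilog_exp s - dilog_exp t) @[s --> 0^'+] --> zeta2 - dilog_exp t.
  by apply: cvgB; [exact: dilog_exp_cvg0|exact: cvg_cst].
have cl : ((t - s) * lgeo t) @[s --> 0^'+] --> t * lgeo t.
  apply: cvgM; last exact: cvg_cst.
  rewrite -[X in _ --> X]subr0; apply: cvgB; first exact: cvg_cst.
  by apply: cvg_at_right_filter; exact: cvg_id.
apply: (ler_cvg_to cl cF); near=> s.
have s0 : 0 < s by near: s; exact: nbhs_right_gt.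
have st : s < t by near: s; exact: nbhs_right_lt.
have [|c /andP[sc ct] E] := @mvt _ (@dilog_exp R) (fun t => - lgeo t) s t st.
  by move=> z /andP[sz _]; apply: ddilog_exp; apply: lt_le_trans sz.
rewrite -[dilog_exp s - _]opprB E mulNr opprK mulrC.
by rewrite ler_wpM2r ?subr_ge0 ?(ltW st)// lgeo_decr ?(ltW ct)// (lt_trans s0).
Unshelve. all: by end_near. Qed.

Lemma mul_lgeo_cvg0 : (t * lgeo t) @[t --> 0^'+] --> (0 : R).
Proof.
apply: (@cvg_of_dist _ _ _ _ (fun t => zeta2 - dilog_exp t)).
  near=> t; have t0 : 0 < t by near: t; exact: nbhs_right_gt.
  by rewrite subr0 ger0_norm ?mul_lgeo_le// mulr_ge0 ?(ltW t0) ?lgeo_ge0.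
rewrite -[X in _ --> X](subrr zeta2).
by apply: cvgB; [exact: cvg_cst|exact: dilog_exp_cvg0].
Unshelve. all: by end_near. Qed.

Definition phi_prim t : R := - dilog_exp t - t * lgeo t.

Lemma dphi_prim t : 0 < t -> der t phi_prim (bosephi t).
Proof.
move=> t0; apply: der_eq.
  apply: dsub; first by apply: dopp; exact: ddilog_exp.
  by apply: dmul; [exact: did|exact: dlgeo].
by rewrite /bosephi /=; ring.
Qed.

Lemma phi_prim_cvg0 : phi_prim t @[t --> 0^'+] --> - zeta2.
Proof.
rewrite -[X in _ --> X]subr0; apply: cvgB; last exact: mul_lgeo_cvg0.
by apply: cvgN; exact: dilog_exp_cvg0.
Qed.

(** Integration by parts: [boseV t] is [- t ^+ 2] times the derivative of [bose]. *)
Definition V_prim t : R := 2 * phi_prim t - t * bosephi t.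

Lemma dV_prim t : 0 < t -> der t V_prim (boseV t).
Proof.
move=> t0; apply: der_eq.
  apply: dsub; first by apply: dscale; exact: dphi_prim.
  by apply: dmul; [exact: did|exact: dbosephi].
by rewrite /bosephi /boseV /=; ring.
Qed.

Lemma V_prim_cvg0 : V_prim t @[t --> 0^'+] --> - (2 * zeta2).
Proof.
rewrite -[X in _ --> X]subr0 -mulrN; apply: cvgB.
  by apply: cvgM; [exact: cvg_cst|exact: phi_prim_cvg0].
apply: (@cvg_of_dist _ _ _ _ (fun t => t)); last by apply: cvg_at_right_filter; exact: cvg_id.
near=> t; have t0 : 0 < t by near: t; exact: nbhs_right_gt.
rewrite subr0 (ger0_norm (mulr_ge0 (ltW t0) (bosephi_ge0 t0))).
by rewrite ler_piMr ?(ltW t0)// bosephi_le1.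
Unshelve. all: by end_near. Qed.

Lemma expN_le_invr t : 0 < t -> expR (- t) <= t^-1.
Proof.
move=> t0; apply: le_trans (expN_le_inv (ltW t0)) _.
by rewrite lef_pV2 ?posrE//; lra.
Qed.

Lemma phi_prim_bound t : 0 < t -> `|phi_prim t| <= (zeta2 + 2) / t.
Proof.
move=> t0; rewrite /phi_prim -opprD normrN.
have h1 := dilog_exp_ge0 t0; have h2 := lgeo_ge0 t0.
have z0 : 0 <= zeta2 by rewrite divr_ge0 ?sqr_ge0.
rewrite ger0_norm ?addr_ge0// ?mulr_ge0 ?(ltW t0)// mulrDl; apply: lerD.
  apply: le_trans (dilog_exp_decay t0) _.
  by rewrite mulrC ler_wpM2l// expN_le_invr.
rewrite ler_pdivlMr//.
have := bose_pow_le 1 t0; have := lgeo_le t0.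
rewrite (_ : (2)`!%:R = 2 :> R)// => h3 h4.
apply: le_trans h4.
rewrite mulrAC [_ * lgeo t]mulrC -expr2 ler_wpM2r ?sqr_ge0//.
Qed.

Lemma V_prim_bound t : 0 < t -> `|V_prim t| <= (2 * zeta2 + 10) / t.
Proof.
move=> t0; rewrite /V_prim.
have -> : (2 * zeta2 + 10) / t = 2 * ((zeta2 + 2) / t) + 6 / t by move: zeta2 => z; ring.
apply: le_trans (ler_normB _ _) _; apply: lerD.
  by rewrite normrM ger0_norm// ler_wpM2l// phi_prim_bound.
rewrite (ger0_norm (mulr_ge0 (ltW t0) (bosephi_ge0 t0))).
rewrite ler_pdivlMr//; have := bose_pow_le 2 t0.
rewrite (_ : (3)`!%:R = 6 :> R)// /bosephi => h.
by apply: le_trans h; rewrite (_ : t * _ * t = bose t * t ^+ 3)//; ring.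
Qed.

Variables (alpha : R) (a1 : 1 < alpha).
Local Notation a m := (bty alpha m)%:R.

Lemma sum_bosephi x M : 0 < x ->
  `|alpha * x * \sum_(1 <= m < M.+2) bosephi (x * a m) - zeta2| <=
  alpha * x + (zeta2 + 2) / (alpha * x * M.+1%:R).
Proof.
move=> x0; have a0 : 0 < alpha by exact: lt_trans a1.
have T0 : 0 < alpha * x * M.+1%:R by rewrite !mulr_gt0.
have := @riemann_beatty _ _ phi_prim 1 (- zeta2) alpha x M a1 x0 (@bosephi_decr R).
move=> /(_ _ dphi_prim phi_prim_cvg0); rewrite mulr1.
have hb s : 0 < s -> 0 <= bosephi s <= 1 by move=> s0; rewrite bosephi_ge0// bosephi_le1.
move=> /(_ hb) h1; have h2 := phi_prim_bound T0.
rewrite (_ : _ - zeta2 = (alpha * x * \sum_(1 <= m < M.+2) bosephi (x * a m) -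
   (phi_prim (alpha * x * M.+1%:R) - - zeta2)) + phi_prim (alpha * x * M.+1%:R)); last by ring.
exact: le_trans (ler_normD _ _) (lerD h1 h2).
Qed.

Lemma sum_boseV x M : 0 < x ->
  `|alpha * x * \sum_(1 <= m < M.+2) boseV (x * a m) - 2 * zeta2| <=
  alpha * x + (2 * zeta2 + 10) / (alpha * x * M.+1%:R).
Proof.
move=> x0; have a0 : 0 < alpha by exact: lt_trans a1.
have T0 : 0 < alpha * x * M.+1%:R by rewrite !mulr_gt0.
have := @riemann_beatty _ _ V_prim 1 (- (2 * zeta2)) alpha x M a1 x0 (@boseV_decr R).
move=> /(_ _ dV_prim V_prim_cvg0); rewrite mulr1.
have hb s : 0 < s -> 0 <= boseV s <= 1 by move=> s0; rewrite boseV_ge0// boseV_le1.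
move=> /(_ hb) h1; have h2 := V_prim_bound T0.
rewrite (_ : _ - 2 * zeta2 = (alpha * x * \sum_(1 <= m < M.+2) boseV (x * a m) -
   (V_prim (alpha * x * M.+1%:R) - - (2 * zeta2))) + V_prim (alpha * x * M.+1%:R)); last by ring.
exact: le_trans (ler_normD _ _) (lerD h1 h2).
Qed.

(** Bounds all higher moments at once: [bose] decays faster than any power, so each of
them is dominated by [(1 + t ^+ 2)^-1]. *)
Lemma sum_inv_sqr x M : 0 < x ->
  x * \sum_(1 <= m < M.+1) (1 + (x * a m) ^+ 2)^-1 <= 2.
Proof.
move=> x0.
have h m : (1 + (x * m.+1%:R) ^+ 2)^-1 * x <= 2 * ((1 + x * m%:R)^-1 - (1 + x * m.+1%:R)^-1).
  rewrite -[m.+1%:R]natr1.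
  have u0 : 0 <= x * m%:R by rewrite mulr_ge0 ?(ltW x0).
  rewrite mulrDr mulr1; move: (x * m%:R) u0 => u u0.
  have -> : 2 * ((1 + u)^-1 - (1 + (u + x))^-1) = (2 * x) / ((1 + u) * (1 + (u + x))).
    by field; rewrite !gt_eqF//; lra.
  rewrite mulrC ler_pdivrMr; last nra.
  rewrite mulrAC ler_pdivlMr; last nra.
  rewrite [2 * x]mulrC -mulrA ler_wpM2l ?(ltW x0)//.
  have : 0 <= (u + x - 1) ^+ 2 by exact: sqr_ge0.
  nra.
have : x * \sum_(1 <= m < M.+1) (1 + (x * a m) ^+ 2)^-1 <=
    2 * (1 - (1 + x * M%:R)^-1).
  elim: M => [|M IH]; first by rewrite big_geq// !mulr0 addr0 invr1 subrr mulr0.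
  rewrite big_nat_recr//= mulrDr.
  have hm : (M.+1 <= bty alpha M.+1)%N by apply: index_le_part; exact: bty_mono.
  have : x * (1 + (x * a M.+1) ^+ 2)^-1 <= (1 + (x * M.+1%:R) ^+ 2)^-1 * x.
    rewrite mulrC ler_wpM2r ?(ltW x0)// lef_pV2 ?posrE ?ltr_pwDl ?sqr_ge0//.
    by rewrite lerD2l lerXn2r ?nnegrE ?mulr_ge0 ?(ltW x0)// ler_pM2l// ler_nat.
  by have := h M; move: IH; lra.
have : 0 <= (1 + x * M%:R)^-1 by rewrite invr_ge0 addr_ge0// mulr_ge0// ltW.
lra.
Qed.

End BosePrimitives.

(** * Summation by parts *)

Section Abel.
Variable R : realType.
Implicit Types (u w j b : nat -> R) (e C c K : R).

Lemma abel_decreasing b w e C M :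
  (forall m, `|\sum_(1 <= k < m.+1) b k| <= e * m%:R + C) ->
  (forall m, 0 <= w m.+1) -> (forall m, w m.+2 <= w m.+1) ->
  `|\sum_(1 <= m < M.+2) b m * w m| <= e * (\sum_(1 <= m < M.+2) w m) + C * w 1%N.
Proof.
move=> hS w0 wd.
suff h : `|\sum_(1 <= m < M.+2) b m * w m - (\sum_(1 <= k < M.+2) b k) * w M.+1| <=
    e * (\sum_(1 <= m < M.+2) w m - M.+1%:R * w M.+1) + C * (w 1%N - w M.+1).
  have h2 : `|(\sum_(1 <= k < M.+2) b k) * w M.+1| <= (e * M.+1%:R + C) * w M.+1.
    by rewrite normrM [ `|w _|]ger0_norm// ler_wpM2r.
  rewrite -[X in `|X|](subrK ((\sum_(1 <= k < M.+2) b k) * w M.+1)).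
  apply: le_trans (ler_normD _ _) _; apply: le_trans (lerD h h2) _.
  by rewrite le_eqVlt; apply/orP; left; apply/eqP; ring.
elim: M => [|M IH].
  by rewrite !big_nat1 mul1r !subrr !mulr0 addr0 normr0.
rewrite ![\sum_(1 <= m < M.+3) _]big_nat_recr//=.
set S := \sum_(1 <= k < M.+2) b k in IH *.
rewrite (_ : _ - _ = (\sum_(1 <= m < M.+2) b m * w m - S * w M.+1) + S * (w M.+1 - w M.+2)); last by ring.
apply: le_trans (ler_normD _ _) _.
have h2 : `|S * (w M.+1 - w M.+2)| <= (e * M.+1%:R + C) * (w M.+1 - w M.+2).
  rewrite normrM [ `|w _ - _|]ger0_norm ?subr_ge0// ler_wpM2r ?subr_ge0//.
  exact: hS.
apply: le_trans (lerD IH h2) _.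
rewrite le_eqVlt; apply/orP; left; apply/eqP.
have -> : M.+2%:R = M.+1%:R + 1 :> R by rewrite natr1.
by ring.
Qed.

(** Convergent partial sums against increasing weights. The boundary terms are kept in
the statement so that the bound is exactly additive in [k]. *)
Lemma abel_increasing j u c e N k :
  (forall m, (N <= m <= N + k)%N -> `|\sum_(1 <= i < m.+1) j i - c| <= e) ->
  (forall m, (N <= m)%N -> u m <= u m.+1) ->
  `|\sum_(N.+1 <= m < (N + k).+1) j m * u m
    - (\sum_(1 <= i < (N + k).+1) j i - c) * u (N + k)%N
    + (\sum_(1 <= i < N.+1) j i - c) * u N| <= e * (u (N + k)%N - u N).
Proof.
move=> hJ ud; elim: k hJ => [|k IH] hJ.
  by rewrite addn0 big_geq// sub0r addNr normr0 subrr mulr0.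
have hJ' m : (N <= m <= N + k)%N -> `|\sum_(1 <= i < m.+1) j i - c| <= e.
  by move=> /andP[m1 m2]; apply: hJ; rewrite m1 addnS ltnW.
have {}IH := IH hJ'.
rewrite addnS big_nat_recr/= ?ltnS ?leq_addr//.
rewrite [\sum_(1 <= i < (N + k).+2) j i]big_nat_recr//=.
have hk := hJ (N + k)%N; rewrite leq_addr leq_add2l leqnSn in hk.
have {}hk := hk isT; have uk := ud (N + k)%N (leq_addr _ _).
set S := \sum_(1 <= i < (N + k).+1) j i in IH hk *.
set T := \sum_(N.+1 <= m < (N + k).+1) j m * u m in IH *.
set Q := _ * u N in IH *.
rewrite (_ : _ - _ + _ = (T - (S - c) * u (N + k)%N + Q) - (S - c) * (u (N + k).+1 - u (N + k)%N)); last by ring.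
apply: le_trans (ler_normB _ _) _.
have h2 : `|(S - c) * (u (N + k).+1 - u (N + k)%N)| <= e * (u (N + k).+1 - u (N + k)%N).
  by rewrite normrM [ `|u _ - _|]ger0_norm ?subr_ge0// ler_wpM2r ?subr_ge0.
apply: le_trans (lerD IH h2) _.
by rewrite le_eqVlt; apply/orP; left; apply/eqP; ring.
Qed.

End Abel.

(** * The generating function on the positive axis *)

Section RealAxis.
Variable R : realType.
Implicit Types t s x y : R.
Local Notation zeta2 := (pi ^+ 2 / 6 : R).

Definition lreg_prim t : R := t * lreg t - t + phi_prim t.

Lemma dlreg_prim t : 0 < t -> der t lreg_prim (lreg t).
Proof.
move=> t0; apply: der_eq.
  apply: dadd; last exact: dphi_prim.
  by apply: dsub; [apply: dmul; [exact: did|exact: dlreg]|exact: did].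
by rewrite /bosephi /dlreg_fun /=; field; rewrite gt_eqF.
Qed.

Lemma lreg_cvg0 : lreg t @[t --> 0^'+] --> (0 : R).
Proof.
apply: (@cvg_of_dist _ _ _ _ (fun t => t)); last by apply: cvg_at_right_filter; exact: cvg_id.
near=> t; have t0 : 0 < t by near: t; exact: nbhs_right_gt.
by rewrite subr0 ger0_norm ?lreg_ge0// lreg_le.
Unshelve. all: by end_near. Qed.

Lemma lreg_prim_cvg0 : lreg_prim t @[t --> 0^'+] --> - zeta2.
Proof.
rewrite -[X in _ --> X]add0r; apply: cvgD; last exact: phi_prim_cvg0.
have id0 : t @[t --> (0:R)^'+] --> (0 : R) by apply: cvg_at_right_filter; exact: cvg_id.
rewrite -[X in _ --> X]subr0; apply: cvgB => //.
by rewrite -[X in _ --> X](mulr0 0); apply: cvgM => //; exact: lreg_cvg0.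
Qed.

Lemma lreg_primE t : 0 < t -> lreg_prim t = t * ln t - t - dilog_exp t.
Proof. by move=> t0; rewrite /lreg_prim /phi_prim /lreg; ring. Qed.

(** The case of the parts [1, ..., M.+1]: the regular part [lreg] is summed by the
trapezoid rule, the singular part [- ln (y * m)] adds up to a factorial. *)
Lemma sum_lgeo_grid y M : 0 < y ->
  `|\sum_(1 <= m < M.+2) lgeo (y * m%:R)
     - (zeta2 / y + ln y / 2 - stirling_dev R M.+1)| <=
  3 * y + lgeo (y * M.+1%:R) + dilog_exp (y * M.+1%:R) / y.
Proof.
move=> y0; set T := y * M.+1%:R; have T0 : 0 < T by rewrite mulr_gt0.
have hsum : \sum_(1 <= m < M.+2) lgeo (y * m%:R) =
    \sum_(1 <= m < M.+2) lreg (y * m%:R) - (M.+1%:R * ln y + ln M.+1`!%:R).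
  rewrite ln_fact.
  have -> : M.+1%:R * ln y = \sum_(1 <= m < M.+2) ln y.
    by rewrite big_const_nat subn1 iter_addr_0 mulr_natl.
  rewrite -big_split -sumrB /=; rewrite big_nat_cond [RHS]big_nat_cond.
  apply: eq_bigr => m /andP[/andP[m0 _] _].
  have m0' : 0 < m%:R :> R by rewrite ltr0n.
  by rewrite /lreg lnM ?posrE//; ring.
have tr := @trapezoid_sum R (fun t => - lreg_prim t) (fun t => - lreg t)
  (fun t => - dlreg_fun t) y M y0.
have tr1 (s : R) : 0 < s -> der s (fun t => - lreg_prim t) (- lreg s).
  by move=> s0; apply: dopp; exact: dlreg_prim.
have tr2 (s : R) : 0 < s -> der s (fun t => - lreg t) (- dlreg_fun s).
  by move=> s0; apply: dopp; exact: dlreg.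
have tr3 s t : 0 < s -> s <= t -> - dlreg_fun s <= - dlreg_fun t.
  by move=> s0 st; rewrite lerN2; exact: dlreg_decr.
have {tr tr1 tr2 tr3}/andP[t1 t2] := tr tr1 tr2 tr3.
have p1 : y * 0 <= lreg_prim y - - zeta2 <= y * y.
  apply: (primitive_bounds y0 (f := @lreg R) _ dlreg_prim lreg_prim_cvg0) => s /andP[s0 sy].
  by rewrite lreg_ge0//= (le_trans (lreg_le s0))// ltW.
have l1 := lreg_ge0 y0; have l2 := lreg_le y0.
have g1 := dlreg_fun_ge0 T0; have g2 := dlreg_fun_le1 y0.
have h1 := lgeo_ge0 T0; have d1 := dilog_exp_ge0 T0.
have lT : lreg T = ln y + ln M.+1%:R + lgeo T by rewrite /lreg /T lnM ?posrE.
have PT : lreg_prim T = T * (ln y + ln M.+1%:R) - T - dilog_exp T.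
  by rewrite lreg_primE// {2}/T lnM ?posrE.
rewrite -/T sumrN in t1 t2; rewrite hsum.
move: p1 => /andP[p1 p2].
set S := \sum_(_ <= _ < _) _ in t1 t2 *.
have fE : ln M.+1`!%:R = stirling_dev R M.+1 + (M.+1%:R + 2^-1) * ln M.+1%:R - M.+1%:R :> R.
  by rewrite /stirling_dev; ring.
rewrite fE.
move: (stirling_dev _ _) => sd.
(* everything multiplied by [y] *)
rewrite -(ler_pM2l y0) -{1}(gtr0_norm y0) -normrM.
rewrite (_ : y * (3 * y + lgeo T + dilog_exp T / y) = 3 * y ^+ 2 + y * lgeo T + dilog_exp T); last first.
  by field; rewrite gt_eqF.
rewrite [y * (S - _ - _)](_ : _ = y * S - T * ln y - T * ln M.+1%:R + T - y * (ln y + ln M.+1%:R) / 2 - zeta2); last first.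
  by move: zeta2 => z; rewrite /T; field; rewrite gt_eqF.
have b1 : 0 <= y * lreg y <= y ^+ 2 by rewrite expr2 mulr_ge0 ?(ltW y0)// ler_wpM2l// ltW.
have b2 : y ^+ 2 * (dlreg_fun y - dlreg_fun T) <= y ^+ 2.
  by rewrite ler_piMr ?sqr_ge0//; lra.
have b3 : 0 <= y * lgeo T by rewrite mulr_ge0// ltW.
move/andP: b1 => [b0 b1].
rewrite PT lT in t1 t2; rewrite mulrDr in t1 t2.
rewrite [y * y](_ : _ = y ^+ 2)// in p2.
have y2 : 0 <= y ^+ 2 by exact: sqr_ge0.
move: (pi ^+ 2 / 6) (lreg_prim y) (dlreg_fun y) (dlreg_fun T) (dilog_exp T) (lgeo T) (lreg y) p1 p2 t1 t2 b0 b1 b2 b3 d1 => z a b c d e f p1 p2 t1 t2 b0 b1 b2 b3 d1.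
by rewrite ler_norml; apply/andP; split; lra.
Qed.

Variables (alpha : R) (a1 : 1 < alpha).
Local Notation a m := (bty alpha m)%:R.

Let a0 : 0 < alpha. Proof. exact: lt_trans a1. Qed.

(** The relative loss when [alpha * m] is rounded down. *)
Definition beatty_defect m : R := frac_part (alpha * m%:R) / (alpha * m%:R).

Lemma bty_gt0 m : 0 < a m.+1 :> R.
Proof.
have hm : (m.+1 <= bty alpha m.+1)%N by apply: index_le_part; exact: bty_mono.
by rewrite ltr0n (leq_trans _ hm).
Qed.

Lemma beatty_defectE m : a m.+1 = alpha * m.+1%:R * (1 - beatty_defect m.+1) :> R.
Proof.
rewrite /beatty_defect btyE//; move: (frac_part _) => f; field.
by rewrite nat1r pnatr_eq0 (gt_eqF a0).
Qed.

Lemma beatty_defect_lt1 m : 0 < 1 - beatty_defect m.+1.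
Proof.
by have := bty_gt0 m; rewrite beatty_defectE pmulr_rgt0// mulr_gt0.
Qed.

(** Rounding [alpha * m] down changes the singular part of [lgeo] by the exact amount
[ln (1 - beatty_defect m)], and the regular part, to first order, by the fractional
part times the slope; the second order errors telescope as [dlreg_fun] decreases. *)
Lemma sum_lgeo_beatty x M : 0 < x ->
  `|\sum_(1 <= m < M.+2) lgeo (x * a m) -
    (\sum_(1 <= m < M.+2) lgeo (alpha * x * m%:R)
     - \sum_(1 <= m < M.+2) ln (1 - beatty_defect m)
     - x * \sum_(1 <= m < M.+2) frac_part (alpha * m%:R) * dlreg_fun (alpha * x * m%:R))|
  <= x.
Proof.
move=> x0; have y0 : 0 < alpha * x by rewrite mulr_gt0.
(* the slope at the left end of cell [m]; at the origin its supremum 1 is used *)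
pose G m : R := if m is 0%N then 1 else dlreg_fun (alpha * x * m%:R).
have GE m c : 0 < c -> alpha * x * m%:R <= c -> dlreg_fun c <= G m.
  case: m => [|m] c0 hc /=; first exact: dlreg_fun_le1.
  by apply: dlreg_decr => //; rewrite mulr_gt0.
have key m : `|lgeo (x * a m.+1) - lgeo (alpha * x * m.+1%:R) + ln (1 - beatty_defect m.+1)
    + x * (frac_part (alpha * m.+1%:R) * dlreg_fun (alpha * x * m.+1%:R))| <= x * (G m - G m.+1).
  set fr := frac_part _.
  have f0 : 0 <= fr by exact: frac_part_ge0.
  have f1 : fr < 1 by exact: frac_part_lt1.
  have am0 := bty_gt0 m; have d0 := beatty_defect_lt1 m.
  set T := alpha * x * m.+1%:R; have T0 : 0 < T by rewrite mulr_gt0.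
  have s0 : 0 < x * a m.+1 by rewrite mulr_gt0.
  have sE : x * a m.+1 = T - x * fr by rewrite btyE// /T -/fr; ring.
  have lnE : ln (x * a m.+1) = ln T + ln (1 - beatty_defect m.+1).
    by rewrite beatty_defectE -lnM ?posrE//; congr ln; rewrite /T; ring.
  rewrite (_ : _ + _ = lreg (x * a m.+1) - lreg T + x * fr * dlreg_fun T); last first.
    by rewrite /lreg lnE; ring.
  have Gc c : x * a m.+1 <= c -> dlreg_fun c <= G m.
    move=> hc; apply: GE; first exact: lt_le_trans hc.
    apply: le_trans hc; rewrite sE /T -[m.+1%:R]natr1.
    have : x * fr <= x * alpha by rewrite ler_pM2l// ltW// (lt_trans f1).
    lra.
  have [fr0|fr0] := eqVneq fr 0.
    rewrite sE fr0 mulr0 subr0 subrr mul0r addr0 normr0.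
    rewrite mulr_ge0 ?(ltW x0)// subr_ge0; apply: Gc.
    by rewrite sE fr0 mulr0 subr0.
  have frp : 0 < fr by rewrite lt_def fr0.
  have sT : x * a m.+1 < T by rewrite sE gtrBl mulr_gt0.
  have [|c /andP[sc cT] E] := @mvt _ (@lreg R) (@dlreg_fun R) _ _ sT.
    by move=> z /andP[sz _]; apply: dlreg; apply: lt_le_trans sz.
  have c0 := lt_trans s0 sc.
  rewrite (_ : _ - _ + _ = - (x * fr * (dlreg_fun c - dlreg_fun T))); last first.
    rewrite -[lreg (x * _) - _]opprB E sE; ring.
  have gT : dlreg_fun T <= dlreg_fun c by apply: dlreg_decr => //; exact: ltW.
  rewrite normrN ger0_norm; last by rewrite !mulr_ge0 ?(ltW x0)// subr_ge0.
  rewrite -mulrA ler_wpM2l ?(ltW x0)//.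
  apply: (@le_trans _ _ (dlreg_fun c - dlreg_fun T)).
    by rewrite ler_piMl ?subr_ge0// ltW.
  by rewrite lerD2r Gc// ltW.
have tel : \sum_(1 <= m < M.+2) x * (G m.-1 - G m) <= x.
  have -> : \sum_(1 <= m < M.+2) x * (G m.-1 - G m) = x * (1 - G M.+1).
    have {GE key} : G 0%N = 1 by [].
    move: G => G G0; elim: M => [|M IH]; first by rewrite big_nat1 G0.
    by rewrite big_nat_recr//= IH; ring.
  rewrite ler_piMr ?(ltW x0)// gerBl /=; apply: dlreg_fun_ge0.
  by rewrite mulr_gt0.
apply: le_trans tel.
rewrite mulr_sumr -!sumrB [X in `|X|](_ : _ = \sum_(1 <= m < M.+2) (lgeo (x * a m) - lgeo (alpha * x * m%:R) + ln (1 - beatty_defect m)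
    + x * (frac_part (alpha * m%:R) * dlreg_fun (alpha * x * m%:R)))); last first.
  by apply: eq_bigr => m _; ring.
apply: le_trans (ler_norm_sum _ _ _) _.
by apply: ler_sum_nat => -[//|m] _; exact: key.
Qed.

(** The oscillating part of the logarithm. For fixed [M] and [y] tending to 0 it
vanishes; in general it is a smoothly truncated tail of the series [J1_partial]. *)
Definition beatty_error y M : R :=
  \sum_(1 <= m < M.+1) bernoulli1 (alpha * m%:R) / m%:R * (1 - bosephi (y * m%:R)).

Lemma dlreg_bosephi t : 0 < t -> t * dlreg_fun t = 1 - bosephi t.
Proof. by move=> t0; rewrite /dlreg_fun /bosephi; field; rewrite gt_eqF. Qed.

(** In the weighted sum of fractional parts given by [sum_lgeo_beatty], the mean 1/2 of
the fractional parts produces [ln T / (2 * alpha)] by a Riemann sum of [dlreg_fun], and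
the deviation from the mean is [beatty_error]. *)
Theorem sum_lgeo_asymp x y T M : 0 < x -> y = alpha * x -> T = y * M.+1%:R ->
  `|\sum_(1 <= m < M.+2) lgeo (x * a m) -
    (zeta2 / y + ln y / 2 - stirling_dev R M.+1
     - \sum_(1 <= m < M.+2) ln (1 - beatty_defect m)
     - ln T / (2 * alpha) - beatty_error y M.+1 / alpha)|
  <= 5 * y + 2 * lgeo T + dilog_exp T / y.
Proof.
move=> x0 yE TE; have y0 : 0 < y by rewrite yE mulr_gt0.
have T0 : 0 < T by rewrite TE mulr_gt0.
have h1 := sum_lgeo_beatty M x0; have h2 := sum_lgeo_grid M y0.
have h3 : `|y * \sum_(1 <= m < M.+2) dlreg_fun (y * m%:R) - (lreg T - 0)| <= y * 1.
  rewrite TE; apply: riemann_grid => //; [exact: dlreg_decr| |exact: dlreg|exact: lreg_cvg0].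
  by move=> s s0; rewrite dlreg_fun_ge0// dlreg_fun_le1.
have E : x * \sum_(1 <= m < M.+2) frac_part (alpha * m%:R) * dlreg_fun (y * m%:R) =
    (y * \sum_(1 <= m < M.+2) dlreg_fun (y * m%:R)) / (2 * alpha) + beatty_error y M.+1 / alpha.
  rewrite /beatty_error mulr_sumr mulr_sumr !mulr_suml -big_split /=.
  rewrite big_nat_cond [RHS]big_nat_cond; apply: eq_bigr => m /andP[/andP[m0 _] _].
  have m0' : 0 < m%:R :> R by rewrite ltr0n.
  rewrite -dlreg_bosephi ?mulr_gt0// /bernoulli1.
  rewrite yE; field; by rewrite (gt_eqF a0) gt_eqF.
rewrite -yE E in h1.
rewrite -TE in h2; rewrite subr0 mulr1 in h3.
have lT : lreg T = ln T + lgeo T by [].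
rewrite lT in h3.
have g0 := lgeo_ge0 T0; have d0 := dilog_exp_ge0 T0.
have d1 : 0 <= dilog_exp T / y by rewrite divr_ge0// ltW.
have xy : x <= y by rewrite yE ler_peMl// ltW.
have h4 : `|(y * \sum_(1 <= m < M.+2) dlreg_fun (y * m%:R)) / (2 * alpha) - ln T / (2 * alpha)| <= y + lgeo T.
  rewrite -mulrBl normrM [ `|(2 * alpha)^-1|]gtr0_norm; last by rewrite invr_gt0 mulr_gt0.
  rewrite ler_pdivrMr; last by rewrite mulr_gt0.
  set U := y * _ in h3 *.
  rewrite (_ : U - ln T = (U - (ln T + lgeo T)) + lgeo T); last by ring.
  apply: le_trans (ler_normD _ _) _.
  rewrite [ `|lgeo T|]ger0_norm//; apply: le_trans (lerD h3 (lexx _)) _.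
  have : 0 <= (y + lgeo T) * (2 * alpha - 1).
    by apply: mulr_ge0; [rewrite addr_ge0// ltW|have := a1; lra].
  lra.
move: (beatty_error _ _ / alpha) (ln T / (2 * alpha)) (_ / (2 * alpha)) (stirling_dev _ _) (\sum_(_ <= _ < _) ln _) (zeta2 / y) (dilog_exp T / y) (lgeo T) (ln y / 2) (\sum_(1 <= m < M.+2) lgeo (y * m%:R)) (\sum_(_ <= _ < _) _) h1 h2 h4 g0 d1.
move=> v1 v2 v3 v4 v5 v6 v7 v8 v9 v10 v11.
rewrite !ler_norml => /andP[h1 h1'] /andP[h2 h2'] /andP[h4 h4'] g0 d1.
by apply/andP; split; lra.
Qed.

End RealAxis.

(** * Polar form of the factors *)

Section ContinuousOpp.
Variable R : realType.
Implicit Types f : R -> R.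

Lemma continuousV_fun f : (forall x, f x != 0) -> continuous f ->
  continuous (fun x => (f x)^-1).
Proof. by move=> f0 cf x; apply: cvgV; [exact: f0|exact: cf]. Qed.

Lemma continuousN_fun f : continuous f -> continuous (fun x => - f x).
Proof. by move=> cf x; apply: cvgN; exact: cf. Qed.

End ContinuousOpp.

Section PolarFactor.
Variable R : realType.
Implicit Types (b t X : R).

(** Polar form of [1 + b * (exp (i t) - 1)], the characteristic function of a Bernoulli
variable of mean [b]: real and imaginary parts, squared modulus and argument. The
argument is an arctangent because the real part stays positive. Working with these four
real functions replaces complex numbers throughout. *)
Definition fac_re b t : R := 1 - b + b * cos t.
Definition fac_im b t : R := b * sin t.
Definition fac_sqr b t : R := 1 - 4 * (b * (1 - b)) * sin (t / 2) ^+ 2.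
Definition fac_arg b t : R := atan (fac_im b t / fac_re b t).

Lemma cos_half t : cos t = 1 - 2 * sin (t / 2) ^+ 2.
Proof.
rewrite {1}(_ : t = t / 2 + t / 2); last by field.
by rewrite cosD -!expr2 cos2sin2; ring.
Qed.

Lemma fac_sqrE b t : fac_sqr b t = fac_re b t ^+ 2 + fac_im b t ^+ 2.
Proof.
rewrite /fac_sqr /fac_re /fac_im.
have h := cos2Dsin2 t; have h2 := cos_half t.
have -> : sin (t / 2) ^+ 2 = (1 - cos t) / 2 by rewrite h2; field.
by apply: (eq_lincomb (k := - b ^+ 2) h); field.
Qed.

Lemma fac_sqr_gt0 b t : 0 < fac_re b t -> 0 < fac_sqr b t.
Proof. by move=> h; rewrite fac_sqrE ltr_pwDl ?exprn_gt0// sqr_ge0. Qed.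

Lemma fac_polar b t : 0 < fac_re b t ->
  Num.sqrt (fac_sqr b t) * cos (fac_arg b t) = fac_re b t /\
  Num.sqrt (fac_sqr b t) * sin (fac_arg b t) = fac_im b t.
Proof.
move=> h; have h2 := fac_sqr_gt0 h.
have hc : Num.sqrt (fac_sqr b t) * cos (fac_arg b t) = fac_re b t.
  rewrite /fac_arg cos_atan.
  have -> : 1 + (fac_im b t / fac_re b t) ^+ 2 = fac_sqr b t / fac_re b t ^+ 2.
    by rewrite fac_sqrE; field; rewrite gt_eqF.
  rewrite sqrtrM ?(ltW h2)// sqrtrV ?exprn_ge0 ?(ltW h)//.
  rewrite sqrtr_sqr ger0_norm ?(ltW h)//.
  by field; rewrite !gt_eqF ?sqrtr_gt0.
split => //.
have c0 : cos (fac_arg b t) != 0.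
  by apply: contraTneq h => c0; rewrite -hc c0 mulr0 ltxx.
have : tan (fac_arg b t) = fac_im b t / fac_re b t by rewrite /fac_arg atanK.
rewrite /tan => E.
have -> : sin (fac_arg b t) = fac_im b t / fac_re b t * cos (fac_arg b t) by rewrite -E divfK.
rewrite mulrCA hc divfK// gt_eqF//.
Qed.

(** Multiplication by the factor, read on real parts. *)
Lemma fac_rotate b t X : 0 < fac_re b t ->
  Num.sqrt (fac_sqr b t) * cos (X + fac_arg b t) =
  (1 - b) * cos X + b * cos (X + t).
Proof.
move=> h; have [hc hs] := fac_polar h.
rewrite !cosD mulrBr mulrCA hc [X in _ - X]mulrCA hs /fac_re /fac_im; ring.
Qed.

Lemma continuous_fac_sqr b (k : R) : continuous (fun t => fac_sqr b (k * t)).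
Proof.
apply: continuousB_fun; first exact: continuous_cst_fun.
apply: continuousM_fun; first exact: continuous_cst_fun.
apply: (@continuousX_fun R (fun x => sin (k * x / 2))) => t.
apply: (@der_continuous R (fun x => sin (k * x / 2))).
apply: dsin; apply: dmul; last exact: dcst.
by apply: dmul; [exact: dcst|exact: did].
Qed.

Lemma continuous_fac_arg b (k : R) : (forall t, 0 < fac_re b t) ->
  continuous (fun t => fac_arg b (k * t)).
Proof.
move=> h t; apply: (@der_continuous R (fun x => fac_arg b (k * x))).
have dk : der t (fun x => k * x) (0 * t + k * 1) by apply: dmul; [exact: dcst|exact: did].
apply: datan; apply: dmul.
  by apply: dmul; [exact: dcst|apply: dsin; exact: dk].
apply: dinvr; first by rewrite gt_eqF.
apply: dadd; first exact: dcst.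
by apply: dmul; [exact: dcst|apply: dcos; exact: dk].
Qed.

End PolarFactor.

(** * Fourier coefficients of products *)

Section FourierCoefficients.
Variables (R : realType) (q : bool) (beta : nat -> R) (a : nat -> nat).
Variable kap : R.
Hypothesis kap0 : 0 < kap.
Hypothesis re_gt0 : forall m t, 0 < fac_re (beta m.+1) t.
Implicit Types (th s : R) (k : int) (M : nat).

Definition fac_mod m th : R := Num.sqrt (fac_sqr (beta m) ((a m)%:R * th)).

(** Modulus and argument of the product (for [q]) or of the inverse of the
    product (for [~~ q]) of the first [M] factors. *)
Definition ampl M th : R :=
  \prod_(1 <= m < M.+1) (if q then fac_mod m th else (fac_mod m th)^-1).
Definition phase M th : R :=
  \sum_(1 <= m < M.+1)
    (if q then fac_arg (beta m) ((a m)%:R * th) else - fac_arg (beta m) ((a m)%:R * th)).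

(** The coefficient of index [k] as an integral over the half period from 0 to [pi],
with the angle written as [kap * s]: the scale [kap] is free and later makes the
integrand converge to a Gaussian. *)
Definition fourier M k : R :=
  kap / pi * seg_int 0 (pi / kap)
    (fun s => ampl M (kap * s) * cos (phase M (kap * s) - k%:~R * (kap * s))).

Lemma fac_mod_gt0 m th : 0 < fac_mod m.+1 th.
Proof. by rewrite sqrtr_gt0 fac_sqr_gt0. Qed.

Lemma ampl0 th : ampl 0 th = 1. Proof. by rewrite /ampl big_geq. Qed.
Lemma phase0 th : phase 0 th = 0. Proof. by rewrite /phase big_geq. Qed.

Lemma amplS M th : ampl M.+1 th =
  ampl M th * (if q then fac_mod M.+1 th else (fac_mod M.+1 th)^-1).
Proof. by rewrite /ampl big_nat_recr. Qed.

Lemma phaseS M th : phase M.+1 th = phase M th +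
  (if q then fac_arg (beta M.+1) ((a M.+1)%:R * th)
        else - fac_arg (beta M.+1) ((a M.+1)%:R * th)).
Proof. by rewrite /phase big_nat_recr. Qed.

Lemma ampl_gt0 M th : 0 < ampl M th.
Proof.
elim: M => [|M IH]; first by rewrite ampl0.
by rewrite amplS mulr_gt0//; case: q; rewrite ?invr_gt0 fac_mod_gt0.
Qed.

Lemma continuous_ampl M : continuous (fun s => ampl M (kap * s)).
Proof.
have cm m : continuous (fun s => fac_mod m.+1 (kap * s)).
  move=> s; rewrite /fac_mod.
  have := @continuous_comp _ _ _ (fun s => fac_sqr (beta m.+1) ((a m.+1)%:R * kap * s)) Num.sqrt s.
  rewrite (_ : _ \o _ = fun s => Num.sqrt (fac_sqr (beta m.+1) ((a m.+1)%:R * (kap * s)))); last first.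
    by apply/funext => u /=; rewrite mulrA.
  by apply; [exact: continuous_fac_sqr|exact: sqrt_continuous].
elim: M => [|M IH]; first by under eq_fun do rewrite ampl0; exact: continuous_cst_fun.
under eq_fun do rewrite amplS.
apply: continuousM_fun => //; case: q => //.
by apply: continuousV_fun => // s; rewrite gt_eqF// fac_mod_gt0.
Qed.

Lemma continuous_phase M : continuous (fun s => phase M (kap * s)).
Proof.
have cm m : continuous (fun s => fac_arg (beta m.+1) ((a m.+1)%:R * (kap * s))).
  rewrite (_ : (fun _ => _) = fun s => fac_arg (beta m.+1) ((a m.+1)%:R * kap * s)); last first.
    by apply/funext => u /=; rewrite mulrA.
  exact: continuous_fac_arg.
elim: M => [|M IH]; first by under eq_fun do rewrite phase0; exact: continuous_cst_fun.
under eq_fun do rewrite phaseS.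
by apply: continuousD_fun => //; case: q => //; exact: continuousN_fun.
Qed.

Definition integrand M k s : R :=
  ampl M (kap * s) * cos (phase M (kap * s) - k%:~R * (kap * s)).

Lemma continuous_integrand M k : continuous (integrand M k).
Proof.
apply: continuousM_fun; first exact: continuous_ampl.
have h : continuous (fun s => phase M (kap * s) - k%:~R * (kap * s)).
  apply: continuousB_fun; first exact: continuous_phase.
  apply: continuousM_fun; first exact: continuous_cst_fun.
  by apply: continuousM_fun; [exact: continuous_cst_fun|exact: continuous_id_fun].
move=> s; apply: (@continuous_comp _ _ _ (fun s => phase M (kap * s) - k%:~R * (kap * s)) cos).
  exact: h.
exact: continuous_cos.
Qed.

Let shiftE M k s (Y : R) : Y - (k - (a M.+1)%:Z)%:~R * (kap * s) =
  Y - k%:~R * (kap * s) + (a M.+1)%:R * (kap * s).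
Proof. by rewrite intrD intrN -pmulrn; ring. Qed.

(** One factor [(1 - b) + b * exp (i a t)] shifts the index by [a]. *)
Lemma integrand_recQ M k s : q -> integrand M.+1 k s =
  (1 - beta M.+1) * integrand M k s + beta M.+1 * integrand M (k - (a M.+1)%:Z) s.
Proof.
move=> qT; have r0 := re_gt0 M ((a M.+1)%:R * (kap * s)).
rewrite /integrand amplS phaseS qT.
have := fac_rotate (phase M (kap * s) - k%:~R * (kap * s)) r0.
rewrite -shiftE -/(fac_mod M.+1 (kap * s)) => h.
by rewrite addrAC -mulrA h; ring.
Qed.

(** An inverse factor satisfies the same relation read from [M.+1] to [M]. *)
Lemma integrand_recP M k s : ~~ q -> integrand M k s =
  (1 - beta M.+1) * integrand M.+1 k s + beta M.+1 * integrand M.+1 (k - (a M.+1)%:Z) s.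
Proof.
move=> /negbTE qF; have r0 := re_gt0 M ((a M.+1)%:R * (kap * s)).
have m0 := fac_mod_gt0 M (kap * s).
rewrite /integrand amplS phaseS qF.
set A := fac_arg _ _.
have := fac_rotate (phase M (kap * s) - A - k%:~R * (kap * s)) r0.
rewrite -shiftE -/(fac_mod M.+1 (kap * s)) -/A.
rewrite (_ : _ - _ + A = phase M (kap * s) - k%:~R * (kap * s)); last by ring.
move: (fac_mod _ _) m0 => m m0 h.
rewrite (_ : ampl M (kap * s) * cos _ = ampl M (kap * s) * m^-1 *
    (m * cos (phase M (kap * s) - k%:~R * (kap * s)))); last by field; rewrite gt_eqF.
by rewrite h; ring.
Qed.

Lemma fourier_lin (c d : R) M M' k k' M1 k1 :
  (forall s, integrand M1 k1 s = c * integrand M k s + d * integrand M' k' s) ->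
  fourier M1 k1 = c * fourier M k + d * fourier M' k'.
Proof.
move=> h; rewrite /fourier.
have -> : seg_int 0 (pi / kap) (fun s => ampl M1 (kap * s) * cos (phase M1 (kap * s) - k1%:~R * (kap * s))) =
    seg_int 0 (pi / kap) (fun s => c * integrand M k s + d * integrand M' k' s).
  by apply: eq_seg_int => s _; rewrite -h.
rewrite seg_intD; try by apply: continuousM_fun; [exact: continuous_cst_fun|exact: continuous_integrand].
rewrite !seg_intZ; try exact: continuous_integrand.
rewrite /integrand; ring.
Qed.

Lemma fourier_recQ M k : q ->
  fourier M.+1 k = (1 - beta M.+1) * fourier M k + beta M.+1 * fourier M (k - (a M.+1)%:Z).
Proof. by move=> qT; apply: fourier_lin => s; exact: integrand_recQ. Qed.

Lemma fourier_recP M k : ~~ q ->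
  fourier M k = (1 - beta M.+1) * fourier M.+1 k + beta M.+1 * fourier M.+1 (k - (a M.+1)%:Z).
Proof. by move=> qF; apply: fourier_lin => s; exact: integrand_recP. Qed.

Lemma sin_natpi (n : nat) : sin (n%:R * pi) = 0 :> R.
Proof.
elim: n => [|n IH]; first by rewrite mul0r sin0.
by rewrite -natr1 mulrDl mul1r sinDpi IH oppr0.
Qed.

Lemma sin_intpi k : sin (k%:~R * pi) = 0 :> R.
Proof.
case: k => n; first exact: sin_natpi.
by rewrite NegzE intrN mulNr sinN -pmulrn sin_natpi oppr0.
Qed.

Lemma pikap_gt0 : 0 < pi / kap :> R.
Proof. by rewrite divr_gt0// pi_gt0. Qed.

Lemma fourier0 k : fourier 0 k = (k == 0)%:R.
Proof.
have p0 := pi_gt0 R.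
have E : seg_int 0 (pi / kap) (integrand 0 k) = (k == 0)%:R * (pi / kap).
  have [->|k0] := eqVneq k 0.
    rewrite (@eq_seg_int _ _ _ _ (fun=> 1)) ?seg_int_cst ?subr0 ?mul1r ?(ltW pikap_gt0)//.
    by move=> s _; rewrite /integrand ampl0 phase0 mul0r subr0 cos0 mulr1.
  have k0' : k%:~R != 0 :> R by rewrite intr_eq0.
  have kk : k%:~R * kap != 0 by rewrite mulf_neq0// gt_eqF.
  rewrite (seg_int_ftc (F := fun s => (k%:~R * kap)^-1 * sin (k%:~R * kap * s))) ?pikap_gt0//.
  - rewrite mulr0 sin0 mulr0 subr0 mul0r.
    rewrite (_ : _ * kap * (pi / kap) = k%:~R * pi); last first.
      by move: (pi : R) => p; field; rewrite gt_eqF.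
    by rewrite sin_intpi mulr0.
  - exact: continuous_integrand.
  - move=> s; apply: der_eq.
      apply: dscale; apply: dsin; apply: dmul; [exact: dcst|exact: did].
    rewrite /integrand ampl0 phase0 sub0r cosN mul1r mul0r add0r mulr1 mulrA.
    by rewrite mulrAC mulVf// mul1r mulrA.
rewrite /fourier -[seg_int _ _ _]/(seg_int 0 (pi / kap) (integrand 0 k)) E.
rewrite mulrCA (_ : kap / pi * (pi / kap) = 1) ?mulr1//.
by move: (pi : R) p0 => p p0; field; rewrite !gt_eqF.
Qed.

Lemma fourier_bound M k : (forall s, ampl M s <= 1) -> `|fourier M k| <= 1.
Proof.
move=> h; have p0 := pi_gt0 R.
have b s : `|integrand M k s| <= 1.
  rewrite normrM (gtr0_norm (ampl_gt0 _ _)) -[leRHS]mulr1 ler_pM//.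
    exact/ltW/ampl_gt0.
  exact: cos_max.
have ci := @continuous_integrand M k.
have b1 : seg_int 0 (pi / kap) (integrand M k) <= 1 * (pi / kap - 0).
  rewrite -seg_int_cst ?(ltW pikap_gt0)//; apply: seg_int_le => //.
    exact: continuous_cst_fun.
  by move=> s _; apply: le_trans (ler_norm _) (b s).
have b2 : (-1) * (pi / kap - 0) <= seg_int 0 (pi / kap) (integrand M k).
  rewrite -seg_int_cst ?(ltW pikap_gt0)//; apply: seg_int_le => //.
    exact: continuous_cst_fun.
  by move=> s _; have := b s; rewrite ler_norml => /andP[].
rewrite /fourier -[seg_int _ _ _]/(seg_int 0 (pi / kap) (integrand M k)).
rewrite normrM gtr0_norm ?divr_gt0//.
rewrite -ler_pdivlMl ?divr_gt0// mulr1 invf_div ler_norml.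
by move: b1 b2; rewrite subr0 mulN1r mul1r => -> ->.
Qed.

End FourierCoefficients.

(** * Partition counts as Fourier coefficients *)

Section OccupationNumbers.
Variable R : realType.

(** The success probability of a Bernoulli variable of odds [expR (- t)]: the probability
that a part with [t = x * a] is used in a partition into distinct parts. *)
Definition fermi (t : R) : R := (expR t + 1)^-1.

(** Throughout, [q = true] stands for distinct parts and [q = false] for repeated parts.
A geometric variable is an inverse Bernoulli one of negative mean [- bose t]: its
characteristic function is the inverse of [1 - bose t * (exp (i t) - 1)]. *)
Definition occ (q : bool) (t : R) : R := if q then fermi t else - bose t.
Lemma fermi_gt0 (t : R) : 0 < fermi t.
Proof. by rewrite invr_gt0 addr_gt0 ?expR_gt0. Qed.

Lemma fermi_lt_half (t : R) : 0 < t -> fermi t < 2^-1.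
Proof.
move=> t0; rewrite ltf_pV2 ?posrE ?addr_gt0 ?expR_gt0//.
have : 1 < expR t by rewrite expR_gt1.
lra.
Qed.

Lemma occ_re_pos q (t tau : R) : 0 < t -> 0 < fac_re (occ q t) tau.
Proof.
move=> t0; rewrite /fac_re /occ.
have c1 := cos_le1 tau; have c2 := cos_geN1 tau.
case: q.
  have f0 := fermi_gt0 t; have f1 := fermi_lt_half t0.
  have : fermi t * (1 - cos tau) <= fermi t * 2 by rewrite ler_pM2l//; lra.
  lra.
have b0 := bose_gt0 t0.
have : 0 <= bose t * (1 - cos tau) by rewrite mulr_ge0 ?(ltW b0) ?subr_ge0.
lra.
Qed.

End OccupationNumbers.

Section Generating.
Variables (R : realType) (a : nat -> nat) (x : R).
Hypothesis a_mono : {homo a : i j / (i < j)%N}.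
Hypothesis x0 : 0 < x.
Implicit Types (M n : nat) (k : int).

Definition occ_seq q m : R := occ q (x * (a m)%:R).

Lemma part_gt0 m : (0 < a m.+1)%N.
Proof. by apply: leq_trans (index_le_part a_mono m.+1). Qed.

Lemma arg_gt0 m : 0 < x * (a m.+1)%:R.
Proof. by rewrite mulr_gt0// ltr0n part_gt0. Qed.

Lemma occ_re_gt0 q m t : 0 < fac_re (occ_seq q m.+1) t.
Proof. by apply: occ_re_pos; exact: arg_gt0. Qed.

Definition count (q : bool) M n : nat := if q then ndparts a M n else nparts a M n.

(** Inverse of the generating function at [expR (- x)]. *)
Definition norm_cst q M : R :=
  \prod_(1 <= m < M.+1) (if q then 1 - occ_seq q m else (1 - occ_seq q m)^-1).

(** The probability that the sum of the parts is [k]. Negative [k] are allowed so that the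
recursions need no case distinction. *)
Definition prob q M k : R :=
  if k is Posz n then (count q M n)%:R * expR (- (x * n%:R)) * norm_cst q M else 0.

Lemma occ1_gt0 q m : 0 < 1 - occ_seq q m.+1.
Proof.
have := occ_re_gt0 q m 0; rewrite /fac_re cos0 mulr1 subrK => _.
rewrite /occ_seq /occ; have ha := arg_gt0 m; case: q.
  by have := fermi_lt_half ha; lra.
by have := bose_gt0 ha; lra.
Qed.

Lemma occ_ratio q m :
  expR (- (x * (a m.+1)%:R)) * (1 - occ_seq q m.+1) = if q then occ_seq q m.+1 else - occ_seq q m.+1.
Proof.
rewrite /occ_seq /occ expRN; have ha := arg_gt0 m.
have e0 := expR_gt0 (x * (a m.+1)%:R); have e1 := expR_sub1_gt0 ha.
case: q; rewrite /fermi /bose ?opprK.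
  by field; rewrite !gt_eqF// addr_gt0.
by field; rewrite !gt_eqF.
Qed.

Lemma prob_recQ M k : prob true M.+1 k =
  (1 - occ_seq true M.+1) * prob true M k + occ_seq true M.+1 * prob true M (k - (a M.+1)%:Z).
Proof.
have hr := occ_ratio true M.
have nS : norm_cst true M.+1 = norm_cst true M * (1 - occ_seq true M.+1).
  by rewrite /norm_cst big_nat_recr.
move: (occ_seq true M.+1) hr nS => o hr nS.
case: k => n; last first.
  have -> : Negz n - (a M.+1)%:Z = Negz (n + a M.+1) by rewrite !NegzE; lia.
  by rewrite /= !mulr0 addr0.
rewrite /prob /= ndpartsS// nS; case: leqP => an.
  rewrite subzn// natrD.
  have -> : expR (- (x * n%:R)) = expR (- (x * (a M.+1)%:R)) * expR (- (x * (n - a M.+1)%:R)).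
    by rewrite -expRD -opprD -mulrDr -natrD subnKC.
  by rewrite -{3}hr; ring.
have -> : n%:Z - (a M.+1)%:Z = Negz (a M.+1 - n).-1 by rewrite NegzE; lia.
by rewrite addn0 mulr0 addr0; ring.
Qed.

Lemma prob_recP M k : prob false M k =
  (1 - occ_seq false M.+1) * prob false M.+1 k + occ_seq false M.+1 * prob false M.+1 (k - (a M.+1)%:Z).
Proof.
have hr := occ_ratio false M; have o1 := occ1_gt0 false M.
have nS : norm_cst false M = norm_cst false M.+1 * (1 - occ_seq false M.+1).
  by rewrite [norm_cst _ M.+1]big_nat_recr//= -/(norm_cst false M) divfK// gt_eqF.
move: (occ_seq false M.+1) hr nS {o1} => o hr nS.
case: k => n; last first.
  have -> : Negz n - (a M.+1)%:Z = Negz (n + a M.+1) by rewrite !NegzE; lia.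
  by rewrite /= !mulr0 addr0.
rewrite /prob /= npartsS// nS; case: leqP => an.
  rewrite subzn// natrD.
  have -> : expR (- (x * n%:R)) = expR (- (x * (a M.+1)%:R)) * expR (- (x * (n - a M.+1)%:R)).
    by rewrite -expRD -opprD -mulrDr -natrD subnKC.
  apply: (eq_lincomb (k := - ((nparts a M.+1 (n - a M.+1))%:R *
    expR (- (x * (n - a M.+1)%:R)) * norm_cst false M.+1)) hr).
  by ring.
have -> : n%:Z - (a M.+1)%:Z = Negz (a M.+1 - n).-1 by rewrite NegzE; lia.
by rewrite addn0 mulr0 addr0; ring.
Qed.

Lemma norm_cst_gt0 q M : 0 < norm_cst q M.
Proof.
elim: M => [|M IH]; first by rewrite /norm_cst big_geq.
rewrite /norm_cst big_nat_recr//= mulr_gt0//.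
by case: q IH => _; rewrite ?invr_gt0 occ1_gt0.
Qed.

Lemma prob0 q k : prob q 0 k = (k == 0)%:R.
Proof.
case: k => n //=; rewrite /norm_cst big_geq// mulr1 /count.
case: q; rewrite ?ndparts0 ?nparts0; case: n => [|n] /=; rewrite ?mul0r//.
all: by rewrite mulr0 oppr0 expR0 mulr1.
Qed.

Variables (kap : R).
Hypothesis kap0 : 0 < kap.
Hypothesis ampl_le1 : forall M th, ampl false (occ_seq false) a M th <= 1.

(** Both sides satisfy the same recursion in [M]. For distinct parts this is an induction.
For repeated parts the recursion expresses [M] by [M.+1], so that the difference [D] of both
sides satisfies [D j = e * D (j - a M.+1)] with [e < 1]; since [D] is bounded on the negative
integers, where [prob] vanishes, iteration gives [D = 0]. *)
Theorem fourier_prob q M k : fourier q (occ_seq q) a kap M k = prob q M k.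
Proof.
have re0 := occ_re_gt0.
elim: M k => [|M IH] k; first by rewrite fourier0// prob0.
case: q IH => IH.
  by rewrite fourier_recQ// ?prob_recQ ?IH//; exact: re0.
pose D j := fourier false (occ_seq false) a kap M.+1 j - prob false M.+1 j.
have o1 := occ1_gt0 false M; have hr := occ_ratio false M.
set o := occ_seq false M.+1 in o1 hr; set e := expR _ in hr.
have aM : (0 < a M.+1)%N by exact: part_gt0.
have e1 : e < 1 by rewrite expR_lt1 oppr_lt0 arg_gt0.
have e0 : 0 < e by exact: expR_gt0.
have Drec j : D j = e * D (j - (a M.+1)%:Z).
  have h1 := @fourier_recP R false (occ_seq false) a kap (re0 false) M j isT.
  have h2 := prob_recP M j.
  rewrite IH h2 -/o in h1.
  have h3 : (1 - o) * D j = - o * D (j - (a M.+1)%:Z).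
    by rewrite /D; move/eqP: h1; rewrite eq_sym -subr_eq0 => /eqP h1; apply/eqP; rewrite -subr_eq0 -h1; apply/eqP; ring.
  by apply: (mulfI (lt0r_neq0 o1)); rewrite h3 mulrA [(1 - o) * e]mulrC hr.
have Diter i j : D j = e ^+ i * D (j - (i * a M.+1)%N%:Z).
  elim: i j => [|i IHi] j; first by rewrite expr0 mul1r mul0n subr0.
  by rewrite IHi Drec exprSr -mulrA; congr (_ * (_ * D _)); rewrite mulSn; lia.
have Dneg (j : int) : j < 0 -> `|D j| <= 1.
  case: j => // n _; rewrite /D /= subr0.
  by apply: fourier_bound => //; exact: re0.
have Dsmall i : (`|k| < i)%N -> `|D k| <= e ^+ i.
  move=> ki; rewrite (Diter i k) normrM ger0_norm ?exprn_ge0 ?(ltW e0)//.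
  rewrite ler_piMr ?exprn_ge0 ?(ltW e0)//; apply: Dneg.
  have : (i <= i * a M.+1)%N by rewrite leq_pmulr.
  by move: ki; lia.
suff : `|D k| <= 0 by rewrite normr_le0 subr_eq0 => /eqP.
have ce : (fun i => e ^+ i) @ \oo --> (0 : R).
  by apply: cvg_expr; rewrite gtr0_norm.
apply: (ler_cvg_to (cvg_cst `|D k|) ce).
by exists `|k|.+1%N => // i /= ki; exact: Dsmall.
Qed.

End Generating.

(** * Modulus and argument of a single factor *)

Section Occupation.
Variable R : realType.
Implicit Types (t tau : R) (q : bool).

(** Variance and mean of the multiplicity of a part. *)
Definition vocc q t : R :=
  if q then fermi t * (1 - fermi t) else bose t * (1 + bose t).
Definition socc q t : R := if q then fermi t else bose t.

(** This identity derives the moments for distinct parts from those for repeated parts;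
in products it is [1 + z = (1 - z ^+ 2) / (1 - z)]. *)
Lemma fermi_bose t : 0 < t -> fermi t = bose t - 2 * bose (2 * t).
Proof.
move=> t0; rewrite /fermi /bose.
have -> : expR (2 * t) = expR t ^+ 2 by rewrite expr2 -expRD; congr expR; ring.
have e1 : 1 < expR t by rewrite expR_gt1.
move: (expR t) e1 => e e1.
have h1 : e - 1 != 0 by rewrite gt_eqF//; lra.
have h2 : e + 1 != 0 by rewrite gt_eqF//; lra.
have h3 : e ^+ 2 - 1 != 0.
  by rewrite (_ : _ - 1 = (e - 1) * (e + 1)); [rewrite mulf_neq0|ring].
by field; rewrite h1 h2 h3.
Qed.

Lemma vfermi_bose t : 0 < t ->
  fermi t * (1 - fermi t) = bose t * (1 + bose t) - 4 * (bose (2 * t) * (1 + bose (2 * t))).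
Proof.
move=> t0; rewrite /fermi /bose.
have -> : expR (2 * t) = expR t ^+ 2 by rewrite expr2 -expRD; congr expR; ring.
have e1 : 1 < expR t by rewrite expR_gt1.
move: (expR t) e1 => e e1.
have h1 : e - 1 != 0 by rewrite gt_eqF//; lra.
have h2 : e + 1 != 0 by rewrite gt_eqF//; lra.
have h3 : e ^+ 2 - 1 != 0.
  by rewrite (_ : _ - 1 = (e - 1) * (e + 1)); [rewrite mulf_neq0|ring].
by field; rewrite h1 h2 h3.
Qed.

Lemma fermi_le_bose t : 0 < t -> fermi t <= bose t.
Proof.
move=> t0; rewrite lef_pV2 ?posrE ?expR_sub1_gt0 ?addr_gt0 ?expR_gt0//; lra.
Qed.

Lemma socc_le q t : 0 < t -> socc q t <= bose t.
Proof. by move=> t0; case: q; rewrite /= ?fermi_le_bose. Qed.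

Lemma abs_occ q t : 0 < t -> `|occ q t| = socc q t.
Proof.
move=> t0; rewrite /occ /socc; case: q; first by rewrite gtr0_norm// fermi_gt0.
by rewrite normrN gtr0_norm// bose_gt0.
Qed.

Lemma vocc_ge0 q t : 0 < t -> 0 <= vocc q t.
Proof.
move=> t0; rewrite /vocc; case: q.
  rewrite mulr_ge0 ?(ltW (fermi_gt0 _))// subr_ge0.
  by have := fermi_lt_half t0; lra.
by rewrite mulr_ge0 ?addr_ge0 ?(ltW (bose_gt0 t0)).
Qed.

Lemma vocc_le q t : 0 < t -> vocc q t <= bose t * (1 + bose t).
Proof.
move=> t0; rewrite /vocc; case: q => //.
have f0 := fermi_gt0 t; have fb := fermi_le_bose t0; have b0 := bose_gt0 t0.
by rewrite ler_pM ?(ltW f0)//; have := fermi_lt_half t0; lra.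
Qed.

Lemma vocc_sqr_le q t : 0 < t -> vocc q t * t ^+ 2 <= 1.
Proof.
move=> t0; apply: le_trans (boseV_le1 t0); rewrite /boseV mulrC.
by rewrite ler_wpM2l ?sqr_ge0// vocc_le.
Qed.

Lemma fac_sqr_occ q t tau : fac_sqr (occ q t) tau =
  if q then 1 - 4 * vocc q t * sin (tau / 2) ^+ 2
       else 1 + 4 * vocc q t * sin (tau / 2) ^+ 2.
Proof. by rewrite /fac_sqr /vocc /occ; case: q; ring. Qed.

(** Modulus of the characteristic function of the multiplicity of one part. *)
Definition fac_amp q t tau : R :=
  if q then Num.sqrt (fac_sqr (occ q t) tau) else (Num.sqrt (fac_sqr (occ q t) tau))^-1.

Lemma fac_sqr_occ_gt0 q t tau : 0 < t -> 0 < fac_sqr (occ q t) tau.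
Proof. by move=> t0; apply: fac_sqr_gt0; exact: occ_re_pos. Qed.

Lemma fac_amp_gt0 q t tau : 0 < t -> 0 < fac_amp q t tau.
Proof.
move=> t0; have := fac_sqr_occ_gt0 q tau t0; rewrite /fac_amp; case: q => h.
  by rewrite sqrtr_gt0.
by rewrite invr_gt0 sqrtr_gt0.
Qed.

Lemma ln_sqrt z : 0 < z -> ln (Num.sqrt z) = ln z / 2 :> R.
Proof. by move=> z0; rewrite -powR12_sqrt ?(ltW z0)// ln_powR mulrC. Qed.

Lemma ln_fac_amp q t tau : 0 < t -> ln (fac_amp q t tau) =
  if q then ln (fac_sqr (occ q t) tau) / 2 else - (ln (fac_sqr (occ q t) tau) / 2).
Proof.
move=> t0; have := fac_sqr_occ_gt0 q tau t0; rewrite /fac_amp; case: q => h.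
  by rewrite ln_sqrt.
by rewrite lnV ?posrE ?sqrtr_gt0// ln_sqrt.
Qed.

Lemma ln_le_leE (u v : R) : 0 < u -> ln u <= v -> u <= expR v.
Proof. by move=> u0 h; rewrite -(lnK (u0 : u \in Num.pos)) ler_expR. Qed.

Lemma fac_amp_le1 q t tau : 0 < t -> fac_amp q t tau <= 1.
Proof.
move=> t0; have v0 := vocc_ge0 q t0; have s0 := sqr_ge0 (sin (tau / 2)).
have h := fac_sqr_occ_gt0 q tau t0.
rewrite -expR0; apply: ln_le_leE; first exact: fac_amp_gt0.
rewrite ln_fac_amp//; rewrite fac_sqr_occ in h *.
have vs := mulr_ge0 (mulr_ge0 (ler0n R 4) v0) s0.
case: q v0 h vs => v0 h vs.
  have : ln (1 - 4 * vocc true t * sin (tau / 2) ^+ 2) <= 0 by apply: ln_le0; lra.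
  lra.
have : 0 <= ln (1 + 4 * vocc false t * sin (tau / 2) ^+ 2) by apply: ln_ge0; lra.
lra.
Qed.

(** A lower bound of the variances on the interval from 0 to 1. *)
Definition decay_cst : R := expR (-1) / 4.

Lemma decay_cst_gt0 : 0 < decay_cst.
Proof. by rewrite divr_gt0// expR_gt0. Qed.

Lemma vocc_ge_low q t : 0 < t <= 1 -> decay_cst <= vocc q t.
Proof.
move=> /andP[t0 t1]; have e1 : 1 < expR t by rewrite expR_gt1.
have h : expR (- 1) <= (expR t)^-1 by rewrite -expRN ler_expR lerN2.
apply: le_trans (_ : (expR t)^-1 / 4 <= _).
  by rewrite ler_wpM2r ?invr_ge0.
rewrite /vocc /fermi /bose; move: (expR t) e1 => e e1.
have e0 : 0 < e by lra.
case: q.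
  rewrite (_ : _ * _ = e / (e + 1) ^+ 2); last by field; rewrite gt_eqF//; lra.
  rewrite ler_pdivlMr ?exprn_gt0//; last lra.
  rewrite mulrAC ler_pdivrMr// mulrC ler_pdivrMr//; nra.
rewrite (_ : _ * _ = e / (e - 1) ^+ 2); last by field; rewrite gt_eqF//; lra.
rewrite ler_pdivlMr ?exprn_gt0//; last lra.
rewrite mulrAC ler_pdivrMr// mulrC ler_pdivrMr//; nra.
Qed.

Lemma fac_amp_le_exp q t tau : 0 < t <= 1 ->
  fac_amp q t tau <= expR (- (decay_cst * sin (tau / 2) ^+ 2)).
Proof.
move=> ht; have /andP[t0 t1] := ht.
have v0 := vocc_ge_low q ht; have s0 := sqr_ge0 (sin (tau / 2)).
have s1 : sin (tau / 2) ^+ 2 <= 1 by rewrite sin2cos2 gerBl sqr_ge0.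
have h := fac_sqr_occ_gt0 q tau t0.
apply: ln_le_leE; first exact: fac_amp_gt0.
rewrite ln_fac_amp//; rewrite fac_sqr_occ in h *.
have d0 := decay_cst_gt0.
have vs : decay_cst * sin (tau / 2) ^+ 2 <= vocc q t * sin (tau / 2) ^+ 2 by rewrite ler_wpM2r.
have ds : 0 <= decay_cst * sin (tau / 2) ^+ 2 by rewrite mulr_ge0// ltW.
have d1 : decay_cst * sin (tau / 2) ^+ 2 <= 1 / 4.
  have e1 : expR (-1) <= 1 :> R by rewrite expR_le1; lra.
  apply: le_trans (_ : decay_cst <= _); first by rewrite ler_piMr// ltW.
  by rewrite /decay_cst; lra.
set w := _ * _ ^+ 2 in vs ds d1 *.
case: q v0 h vs => v0 h vs.
  set u := vocc true t * _ in vs; rewrite -mulrA -/u in h *.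
  by have := ln_le_sub1 h; lra.
set u := vocc false t * _ in vs; rewrite -mulrA -/u in h *.
have h4 : 0 < 1 + 4 * w by lra.
have l1 : ln (1 + 4 * w) <= ln (1 + 4 * u) by rewrite ler_ln ?posrE//; lra.
have : - ln (1 + 4 * w) <= - (2 * w).
  rewrite -lnV ?posrE//; apply: le_trans (ln_le_sub1 _) _; first by rewrite invr_gt0.
  rewrite lerBlDr -[leLHS]mul1r ler_pdivrMr//; nra.
lra.
Qed.

Lemma four_sin_sqr_le tau : 4 * sin (tau / 2) ^+ 2 <= tau ^+ 2.
Proof.
have h : `|sin (tau / 2)| ^+ 2 <= `|tau / 2| ^+ 2.
  by rewrite lerXn2r ?nnegrE// abs_sin_le.
rewrite !real_normK ?num_real// in h.
have : (tau / 2) ^+ 2 = tau ^+ 2 / 4 by field.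
lra.
Qed.

Lemma ln_fac_amp_approx q t tau : 0 < t -> vocc q t * tau ^+ 2 <= 2^-1 ->
  `|ln (fac_amp q t tau) + vocc q t * tau ^+ 2 / 2| <= (vocc q t ^+ 2 + vocc q t) * tau ^+ 4.
Proof.
move=> t0 hv; have v0 := vocc_ge0 q t0.
rewrite ln_fac_amp// fac_sqr_occ.
have s0 := sqr_ge0 (sin (tau / 2)); have s1 := four_sin_sqr_le tau; have s2 := sin_sqr_approx tau.
set S := sin (tau / 2) ^+ 2 in s0 s1 s2 *; set v := vocc q t in v0 hv *.
have w0 := mulr_ge0 (mulr_ge0 (ler0n R 4) v0) s0.
have w1 : 4 * v * S <= v * tau ^+ 2.
  by rewrite [4 * v]mulrC -mulrA ler_wpM2l.
have w2 : `|4 * v * S - v * tau ^+ 2| <= v * tau ^+ 4.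
  rewrite (_ : _ - _ = v * (4 * S - tau ^+ 2)); last by ring.
  by rewrite normrM ger0_norm// ler_wpM2l.
have w3 : (4 * v * S) ^+ 2 <= v ^+ 2 * tau ^+ 4.
  rewrite (_ : v ^+ 2 * tau ^+ 4 = (v * tau ^+ 2) ^+ 2); last by ring.
  by rewrite lerXn2r// ?nnegrE// (le_trans w0).
have nw : `|4 * v * S| <= 2^-1 by rewrite ger0_norm//; lra.
have t4 : 0 <= v * tau ^+ 4 by rewrite mulr_ge0// exprn_even_ge0.
case: q @v v0 hv w0 w1 w2 w3 nw t4 => v v0 hv w0 w1 w2 w3 nw t4.
- have := @ln1D_bound R (- (4 * v * S)); rewrite normrN => /(_ nw).
  rewrite opprK sqrrN; move: (ln _) => l.
  move: (4 * v * S) (v * tau ^+ 2) w0 w1 w2 w3 => w u w0 w1 w2 w3.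
  rewrite [(v ^+ 2 + v) * _]mulrDl; move: (v ^+ 2 * tau ^+ 4) (v * tau ^+ 4) w2 w3 t4 => z y w2 w3 t4.
  move: w2; rewrite !ler_norml => /andP[h1 h2] /andP[h3 h4].
  by apply/andP; split; lra.
- have := @ln1D_bound R (4 * v * S) nw.
  move: (ln _) => l.
  move: (4 * v * S) (v * tau ^+ 2) w0 w1 w2 w3 => w u w0 w1 w2 w3.
  rewrite [(v ^+ 2 + v) * _]mulrDl; move: (v ^+ 2 * tau ^+ 4) (v * tau ^+ 4) w2 w3 t4 => z y w2 w3 t4.
  move: w2; rewrite !ler_norml => /andP[h1 h2] /andP[h3 h4].
  by apply/andP; split; lra.
Qed.

Lemma fac_arg_approx q t tau : 0 < t -> bose t * tau ^+ 2 <= 1 ->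
  `|fac_arg (occ q t) tau - occ q t * tau| <=
  (8 * bose t ^+ 3 + 2 * bose t + 2 * bose t ^+ 2) * `|tau| ^+ 3.
Proof.
move=> t0 hb; have b0 := bose_gt0 t0.
have o1 : `|occ q t| <= bose t by rewrite abs_occ// socc_le.
have re : 2^-1 <= fac_re (occ q t) tau.
  rewrite /fac_re; have c0 := one_sub_cos_le tau; have c1 := cos_le1 tau.
  have : occ q t * (1 - cos tau) <= bose t * (tau ^+ 2 / 2).
    apply: (@le_trans _ _ (bose t * (1 - cos tau))).
      by rewrite ler_wpM2r ?subr_ge0//; apply: le_trans (ler_norm _) o1.
    by rewrite ler_wpM2l// ltW.
  lra.
rewrite /fac_arg.
set rr := fac_re _ _ in re *; have r0 : 0 < rr by lra.
have ri : rr^-1 <= 2 by rewrite -[2]invrK lef_pV2 ?posrE.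
set v0 := fac_im _ _ / _.
have hv0 : `|v0| <= 2 * bose t * `|tau|.
  rewrite /v0 normrM normfV (gtr0_norm r0) /fac_im normrM.
  have : `|occ q t| * `|sin tau| <= bose t * `|tau| by rewrite ler_pM// abs_sin_le.
  move=> h; have := ler_pM _ _ h ri; rewrite mulr_ge0// invr_ge0 (ltW r0) => /(_ isT isT).
  lra.
have e1 : `|atan v0 - v0| <= 8 * bose t ^+ 3 * `|tau| ^+ 3.
  apply: le_trans (abs_atan_sub_id_le v0) _.
  rewrite (_ : 8 * _ * _ = (2 * bose t * `|tau|) ^+ 3); last by ring.
  by rewrite lerXn2r ?nnegrE// !mulr_ge0// ltW.
have e2 : `|v0 - occ q t * tau| <= 2 * (bose t * `|tau| ^+ 3 + bose t ^+ 2 * `|tau| ^+ 3).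
  rewrite (_ : v0 - _ = (occ q t * (sin tau - tau) + occ q t ^+ 2 * (tau * (1 - cos tau))) / rr); last first.
    by rewrite /v0 /fac_im /rr /fac_re in r0 *; field; rewrite gt_eqF.
  rewrite normrM normfV (gtr0_norm r0) mulrC ler_pM ?invr_ge0 ?(ltW r0)//.
  apply: le_trans (ler_normD _ _) _; apply: lerD.
    by rewrite normrM ler_pM// abs_sin_sub_id_le.
  rewrite normrM normrX ler_pM// ?lerXn2r ?nnegrE ?(ltW b0)//.
  rewrite normrM exprS ler_wpM2l// ger0_norm ?subr_ge0 ?cos_le1//.
  apply: le_trans (one_sub_cos_le tau) _; rewrite real_normK ?num_real//.
  by have := sqr_ge0 tau; lra.
rewrite (_ : _ - _ = (atan v0 - v0) + (v0 - occ q t * tau)); last by ring.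
apply: le_trans (ler_normD _ _) _; apply: le_trans (lerD e1 e2) _.
by rewrite le_eqVlt; apply/orP; left; apply/eqP; ring.
Qed.

(** The remainders of [ln_fac_amp_approx] and [fac_arg_approx], with [tau = h * t], are
brought to the summable weight of [sum_inv_sqr]. The constant 1000 exceeds the factorials
produced by [bose_pow_le]. *)
Lemma quartic_weight q t : 0 < t ->
  (vocc q t ^+ 2 + vocc q t) * t ^+ 4 <= 1000 / (1 + t ^+ 2).
Proof.
move=> t0; have v0 := vocc_ge0 q t0; have v1 := vocc_le q t0; have b0 := bose_gt0 t0.
have v2 := vocc_sqr_le q t0.
rewrite ler_pdivlMr ?ltr_pwDl ?sqr_ge0//.
have h1 : bose t * t <= 1 := bose_pow_le 0 t0.
have h2 : bose t * t ^+ 2 <= 2 := bose_pow_le 1 t0.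
have h3 : bose t * t ^+ 3 <= 6 := bose_pow_le 2 t0.
have h4 : bose t * t ^+ 4 <= 24 := bose_pow_le 3 t0.
have h6 : bose t * t ^+ 6 <= 720 := bose_pow_le 5 t0.
have p k : 0 <= bose t * t ^+ k by rewrite mulr_ge0 ?exprn_ge0 ?(ltW b0)// ltW.
have p1 : 0 <= bose t * t by rewrite mulr_ge0 ?(ltW b0)// ltW.
have g2 : (bose t * t) * (bose t * t) <= 1 * 1 by rewrite ler_pM.
have g4 : (bose t * t ^+ 2) * (bose t * t ^+ 2) <= 2 * 2 by rewrite ler_pM.
have g6 : (bose t * t ^+ 3) * (bose t * t ^+ 3) <= 6 * 6 by rewrite ler_pM.
have w1 : (vocc q t * t ^+ 2) * (vocc q t * t ^+ 2 * (1 + t ^+ 2)) <= vocc q t * t ^+ 2 * (1 + t ^+ 2).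
  by rewrite ler_piMl// !mulr_ge0 ?exprn_ge0 ?(ltW t0)// addr_ge0// sqr_ge0.
have w2 : vocc q t * (t ^+ 2 * (1 + t ^+ 2)) <= bose t * (1 + bose t) * (t ^+ 2 * (1 + t ^+ 2)).
  by rewrite ler_wpM2r// mulr_ge0 ?sqr_ge0// addr_ge0// sqr_ge0.
have w3 : vocc q t * (t ^+ 4 * (1 + t ^+ 2)) <= bose t * (1 + bose t) * (t ^+ 4 * (1 + t ^+ 2)).
  by rewrite ler_wpM2r// mulr_ge0 ?exprn_ge0 ?(ltW t0)// addr_ge0// sqr_ge0.
move: (vocc q t) (bose t) w1 w2 w3 h1 h2 h3 h4 h6 g2 g4 g6 => v b w1 w2 w3 h1 h2 h3 h4 h6 g2 g4 g6.
lra.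
Qed.

Lemma cubic_weight t : 0 < t ->
  (8 * bose t ^+ 3 + 2 * bose t + 2 * bose t ^+ 2) * t ^+ 3 <= 1000 / (1 + t ^+ 2).
Proof.
move=> t0; have b0 := bose_gt0 t0.
rewrite ler_pdivlMr ?ltr_pwDl ?sqr_ge0//.
have h1 : bose t * t <= 1 := bose_pow_le 0 t0.
have h2 : bose t * t ^+ 2 <= 2 := bose_pow_le 1 t0.
have h3 : bose t * t ^+ 3 <= 6 := bose_pow_le 2 t0.
have h5 : bose t * t ^+ 5 <= 120 := bose_pow_le 4 t0.
have p k : 0 <= bose t * t ^+ k by rewrite mulr_ge0 ?exprn_ge0 ?(ltW b0)// ltW.
have p1 : 0 <= bose t * t by rewrite mulr_ge0 ?(ltW b0)// ltW.
have g2 : (bose t * t) * (bose t * t) <= 1 * 1 by rewrite ler_pM.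
have g3 : (bose t * t) * (bose t * t ^+ 2) <= 1 * 2 by rewrite ler_pM.
have g5 : (bose t * t ^+ 2) * (bose t * t ^+ 3) <= 2 * 6 by rewrite ler_pM.
have k3 : (bose t * t) * (bose t * t) * (bose t * t) <= 1 * 1 * 1.
  exact: ler_pM (mulr_ge0 p1 p1) p1 g2 h1.
have k5 : (bose t * t) * (bose t * t) * (bose t * t ^+ 3) <= 1 * 1 * 6.
  exact: ler_pM (mulr_ge0 p1 p1) (p _) g2 h3.
move: (bose t) h1 h2 h3 h5 g2 g3 g5 k3 k5 => b h1 h2 h3 h5 g2 g3 g5 k3 k5.
lra.
Qed.

End Occupation.

(** * Small angles *)

Section MajorArc.
Variables (R : realType) (alpha : R).
Hypothesis a1 : 1 < alpha.
Implicit Types (q : bool) (M m : nat) (h x : R).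
Local Notation a := (bty alpha).

Let a0 : 0 < alpha. Proof. exact: lt_trans a1. Qed.

Let arg0 x m : 0 < x -> 0 < x * (a m.+1)%:R.
Proof. by move=> x0; rewrite mulr_gt0// bty_gt0. Qed.

(** Modulus and argument of the characteristic function of the sum of the parts. *)
Definition amp q x M th : R := ampl q (occ_seq a x q) a M th.
Definition pha q x M th : R := phase q (occ_seq a x q) a M th.

Lemma ampS q x M th : amp q x M.+1 th =
  amp q x M th * fac_amp q (x * (a M.+1)%:R) ((a M.+1)%:R * th).
Proof. by rewrite /amp amplS. Qed.

Lemma amp_gt0 q x M th : 0 < x -> 0 < amp q x M th.
Proof.
move=> x0; elim: M => [|M IH]; first by rewrite /amp ampl0.
by rewrite ampS mulr_gt0// fac_amp_gt0// arg0.
Qed.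

Lemma amp_le1 q x M th : 0 < x -> amp q x M th <= 1.
Proof.
move=> x0; elim: M => [|M IH]; first by rewrite /amp ampl0.
rewrite ampS -[leRHS]mulr1 ler_pM ?fac_amp_le1 ?arg0//.
  exact/ltW/amp_gt0.
by rewrite ltW// fac_amp_gt0// arg0.
Qed.

Lemma amp_anti q x N M th : 0 < x -> (N <= M)%N -> amp q x M th <= amp q x N th.
Proof.
move=> x0 NM; rewrite -(subnK NM); elim: (M - N)%N => [//|k IH].
rewrite addSn ampS; apply: le_trans IH.
by rewrite ler_piMr ?fac_amp_le1 ?arg0// ltW// amp_gt0.
Qed.

(** Angles are written [h * x], so that [tau = h * t] with [t = x * a m] in every factor
and the approximations sum to Riemann sums. *)
Lemma ln_amp_approx q x M h : 0 < x -> 0 <= h <= 2^-1 ->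
  `|ln (amp q x M (h * x)) +
    h ^+ 2 / 2 * \sum_(1 <= m < M.+1) vocc q (x * (a m)%:R) * (x * (a m)%:R) ^+ 2|
  <= 2000 * h ^+ 4 / x.
Proof.
move=> x0 /andP[h0 h1].
have key m : `|ln (fac_amp q (x * (a m.+1)%:R) ((a m.+1)%:R * (h * x))) +
     h ^+ 2 / 2 * (vocc q (x * (a m.+1)%:R) * (x * (a m.+1)%:R) ^+ 2)| <=
   h ^+ 4 * (1000 * (1 + (x * (a m.+1)%:R) ^+ 2)^-1).
  have t0 := arg0 m x0.
  rewrite (_ : (a m.+1)%:R * (h * x) = h * (x * (a m.+1)%:R)); last by ring.
  move: (x * (a m.+1)%:R) t0 => t t0.
  have v2 := vocc_sqr_le q t0; have v0 := vocc_ge0 q t0.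
  have hv : vocc q t * (h * t) ^+ 2 <= 2^-1.
    have hh : h ^+ 2 <= 2^-1 by rewrite expr2; nra.
    have := ler_pM (mulr_ge0 v0 (sqr_ge0 t)) (sqr_ge0 h) v2 hh.
    rewrite mul1r => /(le_trans _); apply.
    by rewrite le_eqVlt; apply/orP; left; apply/eqP; ring.
  have := ln_fac_amp_approx t0 hv; have w := quartic_weight q t0.
  rewrite (_ : vocc q t * (h * t) ^+ 2 / 2 = h ^+ 2 / 2 * (vocc q t * t ^+ 2)); last by field.
  move=> /le_trans; apply.
  rewrite (_ : _ * (h * t) ^+ 4 = h ^+ 4 * ((vocc q t ^+ 2 + vocc q t) * t ^+ 4)); last by ring.
  by rewrite ler_wpM2l// exprn_ge0.
have sm : `|ln (amp q x M (h * x)) +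
    h ^+ 2 / 2 * \sum_(1 <= m < M.+1) vocc q (x * (a m)%:R) * (x * (a m)%:R) ^+ 2| <=
    h ^+ 4 * (1000 * \sum_(1 <= m < M.+1) (1 + (x * (a m)%:R) ^+ 2)^-1).
  elim: M => [|M IH].
    by rewrite /amp ampl0 ln1 !big_geq// !mulr0 addr0 normr0.
  rewrite ampS lnM ?posrE ?amp_gt0 ?fac_amp_gt0 ?arg0//.
  rewrite !(big_nat_recr M.+1)//= !mulrDr.
  set u := ln (amp _ _ _ _) in IH *; set v := ln (fac_amp _ _ _).
  rewrite addrACA; apply: le_trans (ler_normD _ _) (lerD IH (key M)).
apply: le_trans sm _.
have s2 := sum_inv_sqr a1 M x0.
rewrite (_ : 2000 * h ^+ 4 / x = h ^+ 4 * (1000 * (2 / x))); last by ring.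
have s3 : \sum_(1 <= m < M.+1) (1 + (x * (a m)%:R) ^+ 2)^-1 <= 2 / x by rewrite ler_pdivlMr// mulrC.
by apply: ler_wpM2l; [rewrite exprn_ge0|apply: ler_wpM2l s3; exact: ler0n].
Qed.

Lemma pha_approx q x M h : 0 < x -> 0 <= h <= 2^-1 ->
  `|pha q x M (h * x) -
    h * \sum_(1 <= m < M.+1) socc q (x * (a m)%:R) * (x * (a m)%:R)|
  <= 2000 * h ^+ 3 / x.
Proof.
move=> x0 /andP[h0 h1].
pose f m : R := if q then fac_arg (occ_seq a x q m) ((a m)%:R * (h * x))
  else - fac_arg (occ_seq a x q m) ((a m)%:R * (h * x)).
have key m : `|f m.+1 - h * (socc q (x * (a m.+1)%:R) * (x * (a m.+1)%:R))| <=
   h ^+ 3 * (1000 * (1 + (x * (a m.+1)%:R) ^+ 2)^-1).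
  have t0 := arg0 m x0; rewrite /f /occ_seq.
  rewrite (_ : (a m.+1)%:R * (h * x) = h * (x * (a m.+1)%:R)); last by ring.
  move: (x * (a m.+1)%:R) t0 => t t0.
  have b2 : bose t * t ^+ 2 <= 2 := bose_pow_le 1 t0.
  have b0 := bose_gt0 t0.
  have hb : bose t * (h * t) ^+ 2 <= 1.
    have hh : h ^+ 2 <= 2^-1 by rewrite expr2; nra.
    have := ler_pM (mulr_ge0 (ltW b0) (sqr_ge0 t)) (sqr_ge0 h) b2 hh.
    rewrite mulfV// => /(le_trans _); apply.
    by rewrite le_eqVlt; apply/orP; left; apply/eqP; ring.
  have := fac_arg_approx q t0 hb; have w := cubic_weight t0.
  rewrite normrM (ger0_norm h0) (gtr0_norm t0).
  have e3 : (8 * bose t ^+ 3 + 2 * bose t + 2 * bose t ^+ 2) * (h * t) ^+ 3 <=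
      h ^+ 3 * (1000 * (1 + t ^+ 2)^-1).
    rewrite (_ : _ * (h * t) ^+ 3 = h ^+ 3 * ((8 * bose t ^+ 3 + 2 * bose t + 2 * bose t ^+ 2) * t ^+ 3)); last by ring.
    by rewrite ler_wpM2l// exprn_ge0.
  move=> /le_trans/(_ e3) {}e3; apply: le_trans e3.
  rewrite le_eqVlt; apply/orP; left; apply/eqP.
  case: (q); rewrite /occ /socc; first by congr (`|_|); ring.
  by rewrite -normrN; congr (`|_|); ring.
have sm : `|pha q x M (h * x) -
    h * \sum_(1 <= m < M.+1) socc q (x * (a m)%:R) * (x * (a m)%:R)| <=
    h ^+ 3 * (1000 * \sum_(1 <= m < M.+1) (1 + (x * (a m)%:R) ^+ 2)^-1).
  elim: M => [|M IH].
    by rewrite /pha phase0 !big_geq// !mulr0 subr0 normr0.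
  rewrite /pha phaseS -/(f M.+1) -/(pha q x M (h * x)).
  rewrite !(big_nat_recr M.+1)//= !mulrDr.
  by rewrite opprD addrACA; apply: le_trans (ler_normD _ _) (lerD IH (key M)).
apply: le_trans sm _.
have s2 := sum_inv_sqr a1 M x0.
rewrite (_ : 2000 * h ^+ 3 / x = h ^+ 3 * (1000 * (2 / x))); last by ring.
have s3 : \sum_(1 <= m < M.+1) (1 + (x * (a m)%:R) ^+ 2)^-1 <= 2 / x by rewrite ler_pdivlMr// mulrC.
by apply: ler_wpM2l; [rewrite exprn_ge0|apply: ler_wpM2l s3; exact: ler0n].
Qed.

Local Notation zeta2 := (pi ^+ 2 / 6 : R).

(** The integral of [t * socc q t] over the positive half-line; the integral of
[t ^+ 2 * vocc q t] is twice as large. *)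
Definition zq q : R := if q then zeta2 / 2 else zeta2.

Lemma zeta2_gt0 : 0 < zeta2.
Proof. by rewrite divr_gt0// exprn_gt0// pi_gt0. Qed.

Lemma zq_gt0 q : 0 < zq q.
Proof. by rewrite /zq; have z := zeta2_gt0; case: q; [rewrite divr_gt0|]. Qed.

(** For distinct parts, [fermi_bose] writes the mean as a difference of two Bose sums, the
second at [2 * x]; hence the factor [1 - 1 / 2] in [zq]. *)
Lemma sum_socc q x M : 0 < x ->
  `|alpha * x * \sum_(1 <= m < M.+2) socc q (x * (a m)%:R) * (x * (a m)%:R) - zq q|
  <= 2 * (alpha * x) + 2 * (zeta2 + 2) / (alpha * x * M.+1%:R).
Proof.
move=> x0; have z0 := zeta2_gt0.
have h1 := sum_bosephi a1 M x0.
have T0 : 0 < alpha * x * M.+1%:R by rewrite !mulr_gt0.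
have b0 : 0 <= (zeta2 + 2) / (alpha * x * M.+1%:R) by rewrite divr_ge0 ?(ltW T0)//; lra.
have ax : 0 < alpha * x by rewrite mulr_gt0.
rewrite -[2 * (zeta2 + 2) / _]mulrA /zq; case: q; last first.
  rewrite (_ : \sum_(1 <= m < M.+2) _ = \sum_(1 <= m < M.+2) bosephi (x * (a m)%:R)); last first.
    by apply: eq_bigr => m _; rewrite /socc /bosephi mulrC.
  apply: le_trans h1 _; move: (_ / (alpha * x * _)) b0 => B b0; move: (alpha * x) ax => u u0; clear -b0 u0; lra.
have x20 : 0 < 2 * x by rewrite mulr_gt0.
have h2 := sum_bosephi a1 M x20.
rewrite (_ : \sum_(1 <= m < M.+2) _ = \sum_(1 <= m < M.+2) bosephi (x * (a m)%:R)
   - \sum_(1 <= m < M.+2) bosephi (2 * x * (a m)%:R)); last first.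
  rewrite -sumrB big_nat_cond [RHS]big_nat_cond; apply: eq_bigr => -[//|m] _.
  rewrite /socc fermi_bose ?arg0// /bosephi.
  by rewrite (_ : 2 * x * (a m.+1)%:R = 2 * (x * (a m.+1)%:R)); ring.
have e2 : (zeta2 + 2) / (alpha * (2 * x) * M.+1%:R) = (zeta2 + 2) / (alpha * x * M.+1%:R) / 2.
  rewrite (_ : alpha * (2 * x) * M.+1%:R = 2 * (alpha * x * M.+1%:R)); last by ring.
  by rewrite invfM; ring.
rewrite e2 in h2.
move: (\sum_(_ <= _ < _) _) (\sum_(_ <= _ < _) _) ((zeta2 + 2) / _) h1 h2 b0 => S S2 B h1 h2 b0.
rewrite (_ : alpha * (2 * x) = 2 * (alpha * x)) in h2; last by ring.
rewrite (_ : alpha * x * (S2 - S) = alpha * x * S2 - (2 * (alpha * x) * S) / 2); last by field.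
move: (alpha * x * S2) (2 * (alpha * x) * S) h1 h2 => U U2.
move: (pi ^+ 2 / 6) => z.
rewrite !ler_norml => /andP[g1 g2] /andP[g3 g4]; apply/andP; split; lra.
Qed.

Lemma sum_vocc q x M : 0 < x ->
  `|alpha * x * \sum_(1 <= m < M.+2) vocc q (x * (a m)%:R) * (x * (a m)%:R) ^+ 2 - 2 * zq q|
  <= 2 * (alpha * x) + 2 * (2 * zeta2 + 10) / (alpha * x * M.+1%:R).
Proof.
move=> x0; have z0 := zeta2_gt0.
have h1 := sum_boseV a1 M x0.
have T0 : 0 < alpha * x * M.+1%:R by rewrite !mulr_gt0.
have b0 : 0 <= (2 * zeta2 + 10) / (alpha * x * M.+1%:R) by rewrite divr_ge0 ?(ltW T0)//; lra.
have ax : 0 < alpha * x by rewrite mulr_gt0.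
rewrite -[2 * (2 * zeta2 + 10) / _]mulrA /zq; case: q; last first.
  rewrite (_ : \sum_(1 <= m < M.+2) _ = \sum_(1 <= m < M.+2) boseV (x * (a m)%:R)); last first.
    by apply: eq_bigr => m _; rewrite /vocc /boseV mulrC.
  apply: le_trans h1 _; move: (_ / (alpha * x * _)) b0 => B b0; move: (alpha * x) ax => u u0; clear -b0 u0; lra.
have x20 : 0 < 2 * x by rewrite mulr_gt0.
have h2 := sum_boseV a1 M x20.
rewrite (_ : \sum_(1 <= m < M.+2) _ = \sum_(1 <= m < M.+2) boseV (x * (a m)%:R)
   - \sum_(1 <= m < M.+2) boseV (2 * x * (a m)%:R)); last first.
  rewrite -sumrB big_nat_cond [RHS]big_nat_cond; apply: eq_bigr => -[//|m] _.
  rewrite /vocc vfermi_bose ?arg0// /boseV.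
  by rewrite (_ : 2 * x * (a m.+1)%:R = 2 * (x * (a m.+1)%:R)); ring.
have e2 : (2 * zeta2 + 10) / (alpha * (2 * x) * M.+1%:R) = (2 * zeta2 + 10) / (alpha * x * M.+1%:R) / 2.
  rewrite (_ : alpha * (2 * x) * M.+1%:R = 2 * (alpha * x * M.+1%:R)); last by ring.
  by rewrite invfM; ring.
rewrite e2 in h2.
move: (\sum_(_ <= _ < _) _) (\sum_(_ <= _ < _) _) ((2 * zeta2 + 10) / _) h1 h2 b0 => S S2 B h1 h2 b0.
rewrite (_ : alpha * (2 * x) = 2 * (alpha * x)) in h2; last by ring.
rewrite (_ : alpha * x * (S2 - S) = alpha * x * S2 - (2 * (alpha * x) * S) / 2); last by field.
move: (alpha * x * S2) (2 * (alpha * x) * S) h1 h2 => U U2.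
move: (pi ^+ 2 / 6) => z.
rewrite !ler_norml => /andP[g1 g2] /andP[g3 g4]; apply/andP; split; lra.
Qed.

End MajorArc.

(** * Large angles *)

Section MinorArcs.
Variables (R : realType) (alpha : R).
Hypothesis a1 : 1 < alpha.
Hypothesis irr : irrational alpha.
Implicit Types (q : bool) (M N m K : nat) (th x : R).
Local Notation a := (bty alpha).

Let a0 : 0 < alpha. Proof. exact: lt_trans a1. Qed.

Lemma bty_itv m : (a m)%:R <= alpha * m%:R < (a m)%:R + 1.
Proof.
rewrite btyE//; have := frac_part_ge0 (alpha * m%:R); have := frac_part_lt1 (alpha * m%:R).
by move: (frac_part _) => f f1 f0; apply/andP; split; lra.
Qed.

Lemma bty_gap m : a m.+1 = (a m + a 1)%N \/ a m.+1 = (a m + a 1).+1.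
Proof.
have /andP[h1 h2] := bty_itv m; have /andP[h3 h4] := bty_itv m.+1.
have /andP[h5 h6] := bty_itv 1; rewrite mulr1 in h5 h6.
rewrite -natr1 mulrDr mulr1 in h3 h4.
have l1 : (a m + a 1 < (a m.+1).+1)%N.
  by rewrite -(ltr_nat R) -natr1 natrD; lra.
have l2 : (a m.+1 < (a m + a 1).+2)%N.
  by rewrite -(ltr_nat R) -2!natr1 natrD; lra.
by lia.
Qed.

(** If only one of the two gaps of [bty_gap] occurred in a window of length [K], the parts
would grow there at an integer rate and drift away from [alpha * m] by [K] times the
distance of [alpha] to that integer; but the drift is less than 1. *)
Lemma gap_window : exists K, forall m,
  (exists2 i, (i < K)%N & a (m + i).+1 = (a (m + i) + a 1)%N) /\
  (exists2 i, (i < K)%N & a (m + i).+1 = (a (m + i) + a 1).+1).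
Proof.
pose f : R := alpha - (a 1)%:R.
have /andP[h5 h6] := bty_itv 1; rewrite mulr1 in h5 h6.
have f0 : 0 < f.
  rewrite lt_def subr_ge0 h5 andbT subr_eq0; apply/eqP => E.
  by apply: irr; apply/rationalP; exists (a 1)%:Z, 1%N; rewrite divr1 -pmulrn.
have f1 : 0 < 1 - f by rewrite /f; lra.
pose K := ((Num.truncn f^-1).+1 + (Num.truncn (1 - f)^-1).+1)%N.
have K1 : 1 <= K%:R * f.
  rewrite -ler_pdivrMr// div1r; apply: le_trans (ltW (truncnS_gt _)) _.
  by rewrite ler_nat leq_addr.
have K2 : 1 <= K%:R * (1 - f).
  rewrite -ler_pdivrMr// div1r; apply: le_trans (ltW (truncnS_gt _)) _.
  by rewrite ler_nat leq_addl.
exists K => m; have /andP[g1 g2] := bty_itv m; have /andP[g3 g4] := bty_itv (m + K).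
rewrite natrD mulrDr in g3 g4.
split; apply: contrapT => H.
- have E k : (k <= K)%N -> a (m + k) = (a m + k * (a 1).+1)%N.
    elim: k => [|k IH] kK; first by rewrite addn0 mul0n addn0.
    rewrite addnS; case: (bty_gap (m + k)) => [E'|->]; first by case: H; exists k.
    by rewrite (IH (ltnW kK)) mulSn -addnS -addnA [(_ + (a 1).+1)%N]addnC.
  have := E K (leqnn K) => EK.
  rewrite EK natrD natrM -natr1 in g3; rewrite /f in K2; nra.
- have E k : (k <= K)%N -> a (m + k) = (a m + k * a 1)%N.
    elim: k => [|k IH] kK; first by rewrite addn0 mul0n addn0.
    rewrite addnS; case: (bty_gap (m + k)) => [->|E']; first by rewrite (IH (ltnW kK)) mulSn -addnA [(_ + a 1)%N]addnC.
    by case: H; exists k.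
  have := E K (leqnn K) => EK.
  rewrite EK natrD natrM in g4; rewrite /f in K1; nra.
Qed.

Local Notation S th b e := (\sum_(b <= m < e) sin ((a m)%:R * th / 2) ^+ 2).

Lemma abs_sinB_le (u v : R) : `|sin (u - v)| <= `|sin u| + `|sin v|.
Proof.
rewrite sinB; apply: le_trans (ler_normB _ _) _; rewrite !normrM.
apply: lerD; first by rewrite ler_piMr// cos_max.
by rewrite ler_piMl// cos_max.
Qed.

(** Two gaps differing by 1 occur in the window, so [th / 2] is a signed sum of four of
its angles and [|sin (th / 2)|] is at most the sum of four sines. This prevents the parts
from being simultaneously close to multiples of a common period. *)
Lemma window_bound : exists L, (0 < L)%N /\ forall m th,
  sin (th / 2) ^+ 2 / 16 <= S th m (m + L).
Proof.
have [K hK] := gap_window; exists K.+1; split=> // m th.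
have [[i iK Ei] [j jK Ej]] := hK m.
have term k : (k <= K)%N -> sin ((a (m + k))%:R * th / 2) ^+ 2 <= S th m (m + K.+1).
  move=> kK; have kin : (m + k < m + K.+1)%N by rewrite ltn_add2l ltnS.
  rewrite (big_cat_nat (n := (m + k)%N)) ?leq_addr 1?ltnW//=.
  rewrite [X in _ + X]big_ltn//= [X in _ <= _ + X]addrC addrA lerDr.
  by rewrite addr_ge0// sumr_ge0// => ? _; exact: sqr_ge0.
have i1 := term i (ltnW iK); have i2 := term i.+1 iK.
have j1 := term j (ltnW jK); have j2 := term j.+1 jK.
rewrite !addnS in i2 j2.
have E : th / 2 = ((a (m + j).+1)%:R * th / 2 - (a (m + j))%:R * th / 2) -
    ((a (m + i).+1)%:R * th / 2 - (a (m + i))%:R * th / 2).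
  by rewrite Ei Ej -natr1 !natrD; field.
have le4 := abs_sinB_le ((a (m + j).+1)%:R * th / 2 - (a (m + j))%:R * th / 2)
   ((a (m + i).+1)%:R * th / 2 - (a (m + i))%:R * th / 2).
rewrite -E in le4.
have lj := abs_sinB_le ((a (m + j).+1)%:R * th / 2) ((a (m + j))%:R * th / 2).
have li := abs_sinB_le ((a (m + i).+1)%:R * th / 2) ((a (m + i))%:R * th / 2).
have W0 : 0 <= S th m (m + K.+1) by apply: sumr_ge0 => ? _; exact: sqr_ge0.
rewrite -!addnS in le4 lj li i1 i2 j1 j2 E.
rewrite -(real_normK (num_real (sin (th / 2)))).
rewrite -(real_normK (num_real (sin _))) in i1.
rewrite -(real_normK (num_real (sin _))) in i2.
rewrite -(real_normK (num_real (sin _))) in j1.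
rewrite -(real_normK (num_real (sin _))) in j2.
move: (S th m _) W0 i1 i2 j1 j2 le4 lj li => W W0.
move: (normr_ge0 (sin (th / 2))) (normr_ge0 (sin ((a (m + i))%:R * th / 2))).
move: (normr_ge0 (sin ((a (m + i.+1))%:R * th / 2))) (normr_ge0 (sin ((a (m + j))%:R * th / 2))).
move: (normr_ge0 (sin ((a (m + j.+1))%:R * th / 2))).
move: `|sin (_ - _)| `|sin (_ - _)|.
move: `|sin (th / 2)| `|sin ((a (m + i))%:R * th / 2)| `|sin ((a (m + i.+1))%:R * th / 2)|.
move: `|sin ((a (m + j))%:R * th / 2)| `|sin ((a (m + j.+1))%:R * th / 2)|.
clear => s r v p u d1 d2 s0 r0 u0 p0 v0 pW uW rW sW vd d1s d2s.
have vs : v <= s + r + u + p by move: vd d1s d2s; clear; lra.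
have v2 : v ^+ 2 <= (s + r + u + p) ^+ 2 by rewrite ler_pXn2r ?nnegrE// !addr_ge0.
rewrite ler_pdivrMr//; apply: le_trans v2 _.
have q1 := sqr_ge0 (s - r); have q2 := sqr_ge0 (u - p); have q3 := sqr_ge0 (s - u).
have q4 := sqr_ge0 (s - p); have q5 := sqr_ge0 (r - u); have q6 := sqr_ge0 (r - p).
rewrite !expr2 in pW uW rW sW q1 q2 q3 q4 q5 q6 *; move: pW uW rW sW q1 q2 q3 q4 q5 q6; clear; lra.
Qed.

Lemma sum_sqr_sin_ge : exists L, (0 < L)%N /\ forall N th,
  (N %/ L)%:R * (sin (th / 2) ^+ 2 / 16) <= S th 1 N.+1.
Proof.
have [L [L0 HL]] := window_bound; exists L; split=> // N th.
have key k : k%:R * (sin (th / 2) ^+ 2 / 16) <= S th 1 (1 + k * L)%N.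
  elim: k => [|k IH]; first by rewrite mul0n mul0r big_geq.
  rewrite -natr1 mulrDl mul1r (big_cat_nat (n := (1 + k * L)%N))//=; last first.
    by rewrite leq_add2l leq_mul2r leqnSn orbT.
  apply: lerD IH _; apply: le_trans (HL (1 + k * L)%N th) _.
  by rewrite mulSn -addnA [(k * L + L)%N]addnC.
apply: le_trans (key _) _.
rewrite [leRHS](big_cat_nat (n := (1 + N %/ L * L)%N))//=; last first.
  by rewrite add1n ltnS leq_trunc_div.
by rewrite lerDl; apply: sumr_ge0 => ? _; exact: sqr_ge0.
Qed.

Lemma sum_sqr_ge N : N%:R ^+ 3 / 3 <= \sum_(1 <= m < N.+1) m%:R ^+ 2 :> R.
Proof.
elim: N => [|N IH]; first by rewrite expr0n/= mul0r big_geq.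
rewrite big_nat_recr//= -natr1; apply: le_trans _ (lerD IH (lexx _)).
have := ler0n R N; move: (N%:R : R) => n n0; rewrite -subr_ge0 (_ : _ - _ = n + 2 / 3); last by field.
by rewrite addr_ge0.
Qed.

(** For small angles all sines are comparable with their arguments. *)
Lemma sum_sqr_sin_small N th : 0 <= th -> (a N)%:R * th <= 2 ->
  th ^+ 2 * N%:R ^+ 3 / 48 <= S th 1 N.+1.
Proof.
move=> th0 aN.
have e : th ^+ 2 * N%:R ^+ 3 / 48 = th ^+ 2 / 16 * (N%:R ^+ 3 / 3) by field.
rewrite e; apply: le_trans (ler_wpM2l _ (sum_sqr_ge N)) _; first by rewrite divr_ge0 ?sqr_ge0.
rewrite mulr_sumr !big_nat; apply: ler_sum => m /andP[m1 mN].
have am : (m <= a m)%N by apply: index_le_part; exact: bty_mono.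
have aam : (a m <= a N)%N by move: mN; rewrite ltnS leq_eqVlt => /predU1P[->//|/(bty_mono a1)/ltnW].
set u := (a m)%:R * th / 2.
have u1 : m%:R * th / 2 <= u by rewrite ler_wpM2r// ler_wpM2r// ler_nat.
have mt0 : 0 <= m%:R * th by rewrite mulr_ge0.
have u2 : u <= 1.
  by rewrite /u ler_pdivrMr// mul1r; apply: le_trans aN; rewrite ler_wpM2r// ler_nat.
have u0 : 0 <= u by apply: le_trans u1; rewrite divr_ge0.
have s := half_le_sin (introT andP (conj u0 u2)).
have s' : m%:R * th / 4 <= sin u by move: s u1; lra.
have -> : th ^+ 2 / 16 * m%:R ^+ 2 = (m%:R * th / 4) ^+ 2 by field.
by rewrite ler_pXn2r ?nnegrE//; [rewrite divr_ge0|apply: le_trans s; rewrite divr_ge0].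
Qed.

Lemma amp_decay q x N M th : 0 < x -> (N <= M)%N -> x * (a N)%:R <= 1 ->
  amp alpha q x M th <= expR (- (decay_cst R * S th 1 N.+1)).
Proof.
move=> x0 NM xN; apply: le_trans (amp_anti a1 q th x0 NM) _.
elim: N xN {NM} => [|N IH] xN; first by rewrite /amp ampl0 big_geq// mulr0 oppr0 expR0.
rewrite ampS big_nat_recr//= mulrDr opprD expRD.
have t0 : 0 < x * (a N.+1)%:R by rewrite mulr_gt0// bty_gt0.
apply: ler_pM; [exact/ltW/amp_gt0|by rewrite ltW// fac_amp_gt0| |]; last first.
  by apply: fac_amp_le_exp; rewrite t0.
apply: IH; apply: le_trans xN; rewrite ler_pM2l// ler_nat ltnW//.
exact: bty_mono.
Qed.

(** The number of parts, about [1 / (alpha * t)], whose angle at [t] stays below 1. *)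
Lemma truncn_inv (t : R) : 0 < t -> alpha * t <= 1 -> exists2 N,
  N%:R * (alpha * t) <= 1 & 1 <= N%:R * (2 * alpha * t).
Proof.
move=> t0 t1; have at0 : 0 < alpha * t by rewrite mulr_gt0.
have u1 : 1 <= (alpha * t)^-1 by rewrite -div1r ler_pdivlMr// mul1r.
exists (Num.truncn (alpha * t)^-1).
  by rewrite -ler_pdivlMr// div1r truncn_le// invr_ge0 ltW.
have N1 : 1 <= (Num.truncn (alpha * t)^-1)%:R :> R by rewrite ler1n truncn_gt0.
have N2 := truncnS_gt (alpha * t)^-1; move: N2; rewrite -natr1 => N2.
rewrite -ler_pdivrMr; last by rewrite -mulrA mulr_gt0.
by rewrite -mulrA invfM mulrA mul1r; move: N1 N2; lra.
Qed.

Lemma bty_le N : (a N)%:R <= alpha * N%:R.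
Proof. by have /andP[] := bty_itv N. Qed.

Lemma sum_sqr_sin_inv N (t : R) th : 0 < t -> 0 <= th <= t ->
  N%:R * (alpha * t) <= 1 -> 1 <= N%:R * (2 * alpha * t) ->
  th ^+ 2 / t ^+ 3 / (384 * alpha ^+ 3) <= S th 1 N.+1.
Proof.
move=> t0 /andP[th0 tht] N1 N2; apply: le_trans (sum_sqr_sin_small th0 _); last first.
  apply: le_trans (ler_wpM2r th0 (bty_le N)) _.
  apply: le_trans (_ : alpha * N%:R * t <= _).
    by rewrite ler_wpM2l// mulr_ge0// ltW.
  by rewrite mulrAC mulrC (le_trans N1)// ler1n.
have c0 : 0 < t ^+ 3 * (384 * alpha ^+ 3).
  apply: mulr_gt0; first by rewrite exprn_gt0.
  by apply: mulr_gt0; [rewrite ltr0n|rewrite exprn_gt0].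
rewrite -mulrA -invfM -[leRHS]mulrA ler_wpM2l ?sqr_ge0// -div1r ler_pdivrMr//.
have h : 1 <= (N%:R * (2 * alpha * t)) ^+ 3 by rewrite exprn_ege1.
apply: le_trans h _; rewrite le_eqVlt; apply/orP; left; apply/eqP.
by move: (N%:R : R) => n; field.
Qed.

(** The power 12 is chosen for [w ^+ 12 = x ^+ 3] when [w ^+ 4 = x]. *)
Lemma exp_inv_pow (c w : R) : 0 < c -> 0 < w ->
  expR (- (c / w)) <= 12`!%:R / c ^+ 12 * w ^+ 12.
Proof.
move=> c0 w0; have u0 : 0 < c / w by rewrite divr_gt0.
have e : (12`!%:R / c ^+ 12 * w ^+ 12 : R) = ((c / w) ^+ 12 / 12`!%:R)^-1.
  rewrite expr_div_n; move: (12`!%:R : R) (c ^+ 12) (w ^+ 12) => F d e.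
  by rewrite !invf_div; ring.
rewrite e expRN lef_pV2 ?posrE ?expR_gt0 ?divr_gt0 ?exprn_gt0 ?ltr0n ?fact_gt0//.
by apply: le_trans (expR_ge1Dxn 11 (ltW u0)); rewrite lerDr.
Qed.

(** Domination of the rescaled integrand. Up to the angle [x] the sum of squares of sines
is of order [th ^+ 2 / x ^+ 3]. Beyond, it is at least of order [1 / w] with [w = x ^ (1/4)],
so that the modulus is smaller than any power of [x]: up to the angle [w] the first
[1 / (alpha * th)] parts suffice, past [w] the windows of [window_bound] do. *)
Lemma amp_dominated (A : R) : 0 < A -> exists C x1 : R, [/\ 0 < C, 0 < x1 &
  forall q x M th, 0 < x <= x1 -> 1 <= M%:R * (alpha * x) -> 0 <= th <= pi ->
  amp alpha q x M th * (1 + A * (th ^+ 2 / x ^+ 3)) <= C].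
Proof.
move=> A0; have [L [L0 HL]] := sum_sqr_sin_ge.
have LR : 1 <= L%:R :> R by rewrite ler1n.
have dc := decay_cst_gt0 R.
pose v : R := (4 * alpha * L%:R)^-1.
pose u1 : R := (384 * alpha ^+ 3)^-1.
pose u2 : R := (4096 * alpha * L%:R)^-1.
have v0 : 0 < v by rewrite invr_gt0 mulr_gt0 ?mulr_gt0 ?ltr0n.
have u10 : 0 < u1 by rewrite invr_gt0 mulr_gt0 ?exprn_gt0 ?ltr0n.
have u20 : 0 < u2 by rewrite invr_gt0 mulr_gt0 ?mulr_gt0 ?ltr0n.
have v1 : alpha * v * L%:R <= 4^-1.
  rewrite /v le_eqVlt; apply/orP; left; apply/eqP; field.
  by rewrite (gt_eqF a0) (gt_eqF (lt_le_trans ltr01 LR)).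
have v2 : alpha * v <= 4^-1.
  apply: le_trans v1; rewrite ler_peMr// mulr_ge0 ?(ltW v0)//; exact: ltW.
have v3 : v <= 4^-1.
  by apply: le_trans v2; rewrite ler_peMl ?(ltW v0)// ltW.
pose C1 : R := 1 + A / (decay_cst R * u1).
pose c2 : R := decay_cst R * Num.min u1 u2.
have c20 : 0 < c2 by rewrite mulr_gt0// lt_min u10.
pose C2 : R := 12`!%:R / c2 ^+ 12 * (1 + A * pi ^+ 2).
have C10 : 0 < C1 by rewrite addr_gt0// divr_gt0// mulr_gt0.
have C20 : 0 < C2.
  rewrite mulr_gt0 ?divr_gt0 ?exprn_gt0 ?ltr0n ?fact_gt0//.
  by rewrite addr_gt0// mulr_gt0// exprn_gt0// pi_gt0.
exists (C1 + C2), (v ^+ 4); split; [exact: addr_gt0|exact: exprn_gt0|].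
move=> q x M th /andP[x0 xv] Mx /andP[th0 thpi].
pose w := Num.sqrt (Num.sqrt x).
have w0 : 0 < w by rewrite !sqrtr_gt0.
have w4 : w ^+ 4 = x by rewrite (exprM w 2 2) !sqr_sqrtr// ?sqrtr_ge0 ?(ltW x0).
have wv : w <= v by rewrite -(ler_pXn2r (n := 4)) ?nnegrE ?(ltW w0) ?(ltW v0)// w4.
have w1 : w <= 1 by move: wv v3; lra.
have xw : x <= w.
  by rewrite -w4 -[leRHS]expr1 ler_wiXn2l ?(ltW w0).
have Nle N : N%:R * (alpha * x) <= 1 -> (N <= M)%N /\ x * (a N)%:R <= 1.
  move=> Nx; split.
    have ax0 : 0 < alpha * x by rewrite mulr_gt0.
    by rewrite -(ler_nat R) -(ler_pM2r ax0) (le_trans Nx).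
  rewrite (le_trans _ Nx)// (_ : N%:R * _ = x * (alpha * N%:R)); last by ring.
  by rewrite ler_wpM2l ?(ltW x0)// bty_le.
have x3 : 0 < x ^+ 3 by rewrite exprn_gt0.
have y0 : 0 <= th ^+ 2 / x ^+ 3 by rewrite divr_ge0 ?sqr_ge0// ltW.
(* a lower bound of order [1 / w] for the sum of squares is enough *)
have far N : N%:R * (alpha * x) <= 1 -> Num.min u1 u2 / w <= S th 1 N.+1 ->
    amp alpha q x M th * (1 + A * (th ^+ 2 / x ^+ 3)) <= C2.
  move=> /Nle[NM aN] Sw.
  have h1 : amp alpha q x M th <= 12`!%:R / c2 ^+ 12 * x ^+ 3.
    apply: le_trans (amp_decay _ _ x0 NM aN) _.
    apply: le_trans (_ : expR (- (c2 / w)) <= _).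
      by rewrite ler_expR lerN2 /c2 -mulrA ler_wpM2l// ltW.
    by rewrite -w4 -exprM; exact: exp_inv_pow.
  have h2 : 1 + A * (th ^+ 2 / x ^+ 3) <= (1 + A * pi ^+ 2) / x ^+ 3.
    rewrite ler_pdivlMr// mulrDl mul1r -[A * _ * _]mulrA divfK ?gt_eqF//.
    apply: lerD; first by rewrite exprn_ile1 ?(ltW x0)//; apply: le_trans xw w1.
    by rewrite ler_wpM2l ?(ltW A0)// ler_pXn2r ?nnegrE ?pi_ge0.
  apply: le_trans (ler_pM _ _ h1 h2) _; first exact/ltW/amp_gt0.
    by rewrite addr_ge0// mulr_ge0// ltW.
  by rewrite /C2 -[leLHS]mulrA [x ^+ 3 * _]mulrC divfK// gt_eqF.
have [thx|xth] := leP th x.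
  apply: le_trans (_ : C1 <= _); last by rewrite lerDl ltW.
  have ax1 : alpha * x <= 1.
    have := ler_wpM2l (ltW a0) (le_trans xw wv); move: v2; lra.
  have [N N1 N2] := truncn_inv x0 ax1.
  have [NM aN] := Nle _ N1.
  have Sb : th ^+ 2 / x ^+ 3 * u1 <= S th 1 N.+1 by apply: sum_sqr_sin_inv; rewrite ?th0.
  have h := amp_decay q th x0 NM aN.
  move: y0 Sb; move: (th ^+ 2 / x ^+ 3) => y y0 Sb.
  have du0 : 0 < decay_cst R * u1 by rewrite mulr_gt0.
  have p0 : 0 < 1 + decay_cst R * u1 * y by rewrite ltr_wpDr// mulr_ge0// ltW.
  have g : amp alpha q x M th <= (1 + decay_cst R * u1 * y)^-1.
    apply: le_trans h _; apply: le_trans (expN_le_inv _); last by rewrite mulr_ge0// ltW.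
    by rewrite ler_expR lerN2 -mulrA ler_wpM2l ?(ltW dc)// mulrC.
  apply: le_trans (ler_wpM2r _ g) _; first by rewrite addr_ge0// mulr_ge0// ltW.
  rewrite ler_pdivrMl// /C1.
  rewrite (_ : _ * (1 + _) = 1 + decay_cst R * u1 * y + A / (decay_cst R * u1) + A * y); last first.
    by field; rewrite !gt_eqF.
  have t1 : 0 <= decay_cst R * u1 * y by rewrite mulr_ge0// ltW.
  have t2 : 0 <= A / (decay_cst R * u1) by rewrite divr_ge0// ltW.
  by rewrite lerD2r -addrA lerDl addr_ge0.
apply: le_trans (_ : C2 <= _); last by rewrite lerDr ltW.
have t0 : 0 < th by apply: lt_trans xth.
have [thw|wth] := leP th w.
  have ath : alpha * th <= 1.
    have := ler_wpM2l (ltW a0) (le_trans thw wv); move: v2; lra.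
  have [N N1 N2] := truncn_inv t0 ath.
  apply: (far N).
    by apply: le_trans N1; rewrite ler_wpM2l// ler_wpM2l ?(ltW a0)// ltW.
  have Sb : th ^+ 2 / th ^+ 3 * u1 <= S th 1 N.+1.
    by apply: sum_sqr_sin_inv => //; rewrite th0 lexx.
  apply: le_trans Sb; rewrite (_ : th ^+ 2 / th ^+ 3 = th^-1); last first.
    by field; rewrite gt_eqF.
  rewrite mulrC; apply: ler_pM; rewrite ?invr_ge0 ?(ltW w0)//.
  - by rewrite le_min !ltW.
  - by rewrite lef_pV2.
  - by rewrite ge_min lexx.
have ax1 : alpha * x <= 1.
  have := ler_wpM2l (ltW a0) (le_trans xw wv); move: v2; lra.
have [N N1 N2] := truncn_inv x0 ax1.
apply: (far N) => //; apply: le_trans (HL N th).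
have s8 : w / 8 <= sin (th / 2).
  have : th / 2 <= 4 * sin (th / 2).
    by apply: id_le_4sin; rewrite divr_ge0//= ler_pM2r.
  by move: wth; lra.
have s64 : w ^+ 2 / 1024 <= sin (th / 2) ^+ 2 / 16.
  have : (w / 8) ^+ 2 <= sin (th / 2) ^+ 2.
    rewrite ler_pXn2r ?nnegrE//; first by rewrite divr_ge0// ltW.
    by apply: le_trans s8; rewrite divr_ge0// ltW.
  by rewrite exprMn; lra.
have Nb : (4 * alpha * x * L%:R)^-1 <= (N %/ L)%:R.
  have : N%:R < ((N %/ L)%:R + 1) * L%:R :> R.
    by rewrite natr1 -natrM ltr_nat ltn_ceil.
  have xL : alpha * x * L%:R <= 4^-1.
    apply: le_trans v1; rewrite ler_wpM2r// ler_wpM2l ?(ltW a0)//; exact: le_trans wv.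
  have axL : 0 < 4 * alpha * x * L%:R by rewrite mulr_gt0 ?mulr_gt0 ?ltr0n.
  rewrite -div1r ler_pdivrMr//; move: N2 xL.
  move: (N%:R : R) ((N %/ L)%:R : R) => n k N2 xL nk.
  have ax0 : 0 < alpha * x by rewrite mulr_gt0.
  have : n * (alpha * x) < (k + 1) * L%:R * (alpha * x) by rewrite ltr_pM2r.
  rewrite (_ : (k + 1) * L%:R * (alpha * x) = k * (alpha * x * L%:R) + alpha * x * L%:R); last by ring.
  rewrite (_ : k * (4 * _ * _ * _) = 4 * (k * (alpha * x * L%:R))); last by ring.
  rewrite (_ : n * _ = 2 * (n * (alpha * x))) in N2; last by ring.
  by move: N2 xL; set n' := n * _; set k' := k * (alpha * _ * _); set z := alpha * x * L%:R; lra.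
apply: le_trans (ler_pM _ _ Nb s64); last 2 first.
- by rewrite invr_ge0 mulr_ge0 ?mulr_ge0 ?ler0n// ltW.
- by apply: divr_ge0; [exact: sqr_ge0|exact: ler0n].
apply: le_trans (_ : u2 / w <= _).
  by rewrite ler_wpM2r ?invr_ge0 ?(ltW w0)// ge_min lexx orbT.
rewrite -w4 (_ : _ * (w ^+ 2 / 1024) = u2 / w ^+ 2); last first.
  by rewrite /u2; field; rewrite ?gt_eqF// (lt_le_trans ltr01 LR).
rewrite ler_wpM2l ?(ltW u20)// lef_pV2 ?posrE ?exprn_gt0//.
by rewrite expr2 ler_piMl// ltW.
Qed.

End MinorArcs.

(** * The local limit theorem *)

Section GaussLimit.
Variable R : realType.
Local Notation mu := (@lebesgue_measure R).

(** Dominated convergence on growing segments, with majorant [C * (1 + s ^+ 2)^-1]. *)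
Lemma seg_int_dominated (f : nat -> R -> R) (T : nat -> R) (C : R) :
  (forall n, continuous (f n)) ->
  (forall n s, 0 <= s <= T n -> `|f n s| <= C * (1 + s ^+ 2)^-1) ->
  (forall s, 0 <= s -> \forall n \near \oo, s <= T n) ->
  (forall s, 0 <= s -> f n s @[n --> \oo] --> expR (- s ^+ 2)) ->
  seg_int 0 (T n) (f n) @[n --> \oo] --> Num.sqrt pi / 2.
Proof.
move=> cf fb Tn fl.
pose D : set R := `[0, +oo[%classic.
pose F n : R -> \bar R := (EFin \o f n) \_ `[0, T n].
pose G s : \bar R := (C * (1 + s ^+ 2)^-1)%:E.
have mD : measurable D by exact: measurable_itv.
have ig1 : mu.-integrable D (fun s : R => ((oneDsqr s)^-1)%:E).
  apply/integrableP; split.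
    apply/measurable_EFinP; apply: measurable_funTS.
    by apply: continuous_measurable_fun; exact: continuous_oneDsqrV.
  under eq_integral do rewrite gee0_abs ?lee_fin ?invr_ge0 ?(le_trans ler01 (oneDsqr_ge1 _))//.
  by rewrite integral0y_oneDsqr ltry.
have igG : mu.-integrable D G.
  by rewrite (_ : G = fun s => (C%:E * ((oneDsqr s)^-1)%:E)%E)//; exact: integrableZl.
have [] := @dominated_convergence _ _ _ mu D mD F (fun s => (gauss_fun s)%:E) G _ _ _ igG _.
- move=> n; apply/measurable_restrict => //; apply: measurable_funTS.
  by apply/measurable_EFinP; exact: continuous_measurable_fun.
- by apply/measurable_EFinP; apply: measurable_funTS; exact: measurable_gauss_fun.
- apply/aeW => s; rewrite /D /= in_itv/= andbT => s0.
  apply: cvg_EFin; first by apply: nearW => n; rewrite /F patchE; case: ifP.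
  apply: cvg_trans (fl s s0); apply: near_eq_cvg; near=> n.
  by rewrite /= /F patchE mem_set//= in_itv/= s0/=; near: n; exact: Tn.
- apply/aeW => s n; rewrite /D /= in_itv/= andbT => s0.
  rewrite /F patchE; case: ifPn => [|_].
    by rewrite inE/= in_itv/= => sT; rewrite lee_fin; exact: fb.
  rewrite abse0 lee_fin mulr_ge0 ?invr_ge0 ?addr_ge0 ?sqr_ge0//.
  near \oo => k; have Tk : 0 <= T k by near: k; exact: Tn.
  have := fb k 0; rewrite lexx Tk expr0n addr0 invr1 mulr1 => /(_ isT).
  exact: le_trans.
move=> _ _; rewrite integral0y_gauss => /fine_cvg; apply: cvg_trans.
apply: near_eq_cvg; apply: nearW => n /=.
rewrite /seg_int /Rintegral -integral_mkcondr; congr (fine _).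
congr (integral _ _ _); apply/seteqP; split => s; rewrite /D /= !in_itv/= andbT.
  by case.
by move=> h; split => //; case/andP: h.
Unshelve. all: by end_near.
Qed.

End GaussLimit.

Section LocalLimit.
Variables (R : realType) (alpha : R) (q : bool).
Hypothesis a1 : 1 < alpha.
Hypothesis irr : irrational alpha.
Local Notation a := (bty alpha).
Local Notation zeta2 := (pi ^+ 2 / 6 : R).

Let a0 : 0 < alpha. Proof. exact: lt_trans a1. Qed.

(** The logarithm of the counts grows like [2 * sqrt (growth * n)]. *)
Definition growth : R := zq R q / alpha.
Local Notation A := growth.

(** The saddle point is the [x] for which the expected sum of the parts is about [n], namely
[growth / x ^+ 2 = n]. The variance of the sum is then about [2 * growth / x ^+ 3], twice the
inverse square of [width]. *)
Definition saddle (n : nat) : R := Num.sqrt (A / n%:R).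
Definition width (n : nat) : R := saddle n * Num.sqrt (saddle n / A).
Local Notation x n := (saddle n.+1).
Local Notation k n := (width n.+1).

Lemma growth_gt0 : 0 < A. Proof. by rewrite divr_gt0// zq_gt0. Qed.
Let A0 := growth_gt0.

Lemma saddle_gt0 n : 0 < x n. Proof. by rewrite sqrtr_gt0 divr_gt0. Qed.
Let x0 n : 0 < x n := saddle_gt0 n.

Lemma width_gt0 n : 0 < k n.
Proof. by rewrite mulr_gt0// sqrtr_gt0 divr_gt0. Qed.
Let k0 n : 0 < k n := width_gt0 n.

Lemma saddle_sqr n : n.+1%:R * x n ^+ 2 = A.
Proof.
rewrite /saddle sqr_sqrtr; last by rewrite divr_ge0// ltW.
by rewrite mulrC divfK// pnatr_eq0.
Qed.

Lemma ratio_sqr n : Num.sqrt (x n / A) ^+ 2 = x n / A.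
Proof. by rewrite sqr_sqrtr// divr_ge0// ltW. Qed.

Lemma saddle_mul n : n.+1%:R * x n = A / x n.
Proof. by apply/(canRL (mulfK _)); [rewrite gt_eqF|rewrite -mulrA -expr2 saddle_sqr]. Qed.

Lemma width_sqr n : k n ^+ 2 = x n ^+ 3 / A.
Proof.
by rewrite /width exprMn ratio_sqr mulrA -exprSr.
Qed.

Lemma saddle_cvg0 : x n @[n --> \oo] --> (0 : R).
Proof.
rewrite -[X in _ --> X]sqrtr0; apply: (continuous_cvg _ (@sqrt_continuous R 0)).
rewrite -[X in _ --> X](mulr0 A); apply: cvgMr; exact: cvg_harmonic.
Qed.

Lemma width_ratio_cvg0 : Num.sqrt (x n / A) @[n --> \oo] --> (0 : R).
Proof.
rewrite -[X in _ --> X]sqrtr0; apply: (continuous_cvg _ (@sqrt_continuous R 0)).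
by rewrite -[X in _ --> X](mul0r A^-1); apply: cvgMl; exact: saddle_cvg0.
Qed.

Lemma near_saddle_le e : 0 < e -> \forall n \near \oo, x n <= e.
Proof.
move=> e0; have /cvgrPdist_le/(_ e e0) := saddle_cvg0; apply: filterS => n.
by rewrite sub0r normrN gtr0_norm.
Qed.

Lemma near_ratio_le e : 0 < e -> \forall n \near \oo, Num.sqrt (x n / A) <= e.
Proof.
move=> e0; have /cvgrPdist_le/(_ e e0) := width_ratio_cvg0; apply: filterS => n.
by rewrite sub0r normrN ger0_norm// sqrtr_ge0.
Qed.

Let Bv : R := 2 * (2 * zeta2 + 10) / (alpha * A).
Let Bs : R := 2 * (zeta2 + 2) / (alpha * A).

Let inv_arg B n : B / (alpha * x n * n.+1%:R) = B / (alpha * A) * x n.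
Proof.
rewrite -mulrA [x n * _]mulrC saddle_mul.
by have := x0 n; have := A0; move: (x n) A => y b b0 y0; field; rewrite !gt_eqF.
Qed.

Lemma ln_amp_saddle s n : 0 <= s -> s * Num.sqrt (x n / A) <= 2^-1 ->
  `|ln (amp alpha q (x n) n.+1 (k n * s)) + s ^+ 2| <=
    (s ^+ 2 / (2 * alpha * A) * (2 * alpha + Bv) + 2000 * s ^+ 4 / A ^+ 2) * x n.
Proof.
move=> s0 h1; set h := s * _ in h1.
have h0 : 0 <= h by rewrite mulr_ge0// sqrtr_ge0.
have hx : k n * s = h * x n by rewrite /width /h; ring.
have h2 : h ^+ 2 = s ^+ 2 * x n / A.
  by rewrite /h exprMn ratio_sqr mulrA.
have := ln_amp_approx a1 q n.+1 (x0 n) (introT andP (conj h0 h1)).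
have := sum_vocc a1 q n (x0 n); rewrite inv_arg -/Bv -hx.
have -> : zq R q = alpha * A by rewrite /growth mulrC divfK// gt_eqF.
move: (\sum_(_ <= _ < _) _) => V hV; rewrite h2.
have -> : h ^+ 4 = s ^+ 4 * x n ^+ 2 / A ^+ 2.
  by rewrite (exprM h 2 2) h2; field; rewrite gt_eqF.
set L := ln _ => hL.
have -> : L + s ^+ 2 = (L + s ^+ 2 * x n / A / 2 * V) -
     s ^+ 2 / (2 * alpha * A) * (alpha * x n * V - 2 * (alpha * A)).
  by have := A0; have := a0; move: A => b *; field; rewrite !gt_eqF.
apply: le_trans (ler_normB _ _) _; rewrite [leRHS]mulrDl [leLHS]addrC; apply: lerD; last first.
  apply: le_trans hL _; rewrite le_eqVlt; apply/orP; left; apply/eqP.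
  by have := x0 n; have := A0; move: (x n) A => y b b0 y0; field; rewrite !gt_eqF.
have c0 : 0 <= s ^+ 2 / (2 * alpha * A).
  by apply: divr_ge0; [exact: sqr_ge0|rewrite ltW// mulr_gt0// mulr_gt0].
rewrite normrM (ger0_norm c0) -[leRHS]mulrA ler_wpM2l//.
by apply: le_trans hV _; rewrite [leRHS]mulrDl mulrA.
Qed.

Lemma pha_saddle s n : 0 <= s -> s * Num.sqrt (x n / A) <= 2^-1 ->
  `|pha alpha q (x n) n.+1 (k n * s) - n.+1%:R * (k n * s)| <=
    (s * ((2 * alpha + Bs) / alpha) + 2000 * s ^+ 3 / A) * Num.sqrt (x n / A).
Proof.
move=> s0 h1; set r := Num.sqrt _ in h1 *; set h := s * r in h1.
have h0 : 0 <= h by rewrite mulr_ge0// sqrtr_ge0.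
have hx : k n * s = h * x n by rewrite /width /h /r; ring.
have r2 : r ^+ 2 = x n / A.
  exact: ratio_sqr.
have := pha_approx a1 q n.+1 (x0 n) (introT andP (conj h0 h1)).
have := sum_socc a1 q n (x0 n); rewrite inv_arg -/Bs -hx.
have -> : zq R q = alpha * A by rewrite /growth mulrC divfK// gt_eqF.
move: (\sum_(_ <= _ < _) _) => V hV.
have -> : n.+1%:R * (k n * s) = h * (A / x n).
  by rewrite hx mulrCA mulrC -saddle_mul mulrC.
set L := pha _ _ _ _ _ => hL.
have -> : L - h * (A / x n) = (L - h * V) +
     h / (alpha * x n) * (alpha * x n * V - alpha * A).
  by have := x0 n; have := a0; move: (x n) => y *; field; rewrite !gt_eqF.
apply: le_trans (ler_normD _ _) _; rewrite [leRHS]mulrDl [leLHS]addrC; apply: lerD; last first.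
  apply: le_trans hL _; rewrite le_eqVlt; apply/orP; left; apply/eqP.
  rewrite /h exprMn [r ^+ 3]exprSr r2.
  by have := x0 n; have := A0; move: (x n) A => y b b0 y0; field; rewrite !gt_eqF.
have hax : 0 < alpha * x n by rewrite mulr_gt0.
rewrite normrM ger0_norm; last by rewrite divr_ge0// ltW.
apply: le_trans (ler_wpM2l _ hV) _; first by rewrite divr_ge0// ltW.
rewrite le_eqVlt; apply/orP; left; apply/eqP; rewrite /h.
by have := x0 n; have := a0; move: (x n) => y *; field; rewrite !gt_eqF.
Qed.

Lemma integrand_cvg s : 0 <= s ->
  integrand q (occ_seq a (x n) q) a (k n) n.+1 n.+1%:Z s @[n --> \oo] --> expR (- s ^+ 2).
Proof.
move=> s0.
have hs : \forall n \near \oo, s * Num.sqrt (x n / A) <= 2^-1.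
  have s1 : 0 < 2 * (s + 1) by rewrite mulr_gt0// ltr_wpDl.
  have := near_ratio_le (e := (2 * (s + 1))^-1); rewrite invr_gt0 => /(_ s1).
  apply: filterS => n h.
  apply: le_trans (ler_wpM2l s0 h) _.
  by rewrite ler_pdivrMr// mulrA mulVf// mul1r lerDl.
have l1 : ln (amp alpha q (x n) n.+1 (k n * s)) @[n --> \oo] --> - s ^+ 2.
  pose K : R := s ^+ 2 / (2 * alpha * A) * (2 * alpha + Bv) + 2000 * s ^+ 4 / A ^+ 2.
  apply: (@cvg_of_dist _ _ _ _ (fun n => K * x n)).
    by apply: filterS hs => n hn; rewrite opprK; exact: ln_amp_saddle.
  by rewrite -[X in _ --> X](mulr0 K); apply: cvgMr; exact: saddle_cvg0.
have l2 : (pha alpha q (x n) n.+1 (k n * s) - n.+1%:R * (k n * s)) @[n --> \oo] --> (0 : R).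
  pose K : R := s * ((2 * alpha + Bs) / alpha) + 2000 * s ^+ 3 / A.
  apply: (@cvg_of_dist _ _ _ _ (fun n => K * Num.sqrt (x n / A))).
    by apply: filterS hs => n hn; rewrite subr0; exact: pha_saddle.
  by rewrite -[X in _ --> X](mulr0 K); apply: cvgMr; exact: width_ratio_cvg0.
have e1 : expR (ln (amp alpha q (x n) n.+1 (k n * s))) @[n --> \oo] --> expR (- s ^+ 2).
  exact: continuous_cvg _ (@continuous_expR R _) l1.
have e2 : cos (pha alpha q (x n) n.+1 (k n * s) - n.+1%:R * (k n * s)) @[n --> \oo] --> cos 0.
  exact: continuous_cvg _ (@continuous_cos R _) l2.
rewrite -[X in _ --> X]mulr1 -(@cos0 R); apply: cvg_trans (cvgM e1 e2).
apply: near_eq_cvg; apply: nearW => n.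
by rewrite /integrand /= lnK// posrE amp_gt0.
Qed.

(** The integrand converges to [expR (- s ^+ 2)] and is dominated, so the integral tends to
half a Gaussian integral. The phase disappears in the limit because the mean differs from [n]
by [O (1 / x)], which is small against the standard deviation [x ^ (-3/2)]. *)
Theorem local_limit :
  prob a (x n) q n.+1 n.+1%:Z / k n @[n --> \oo] --> (2 * Num.sqrt pi)^-1.
Proof.
have [C [x1 [C0 x10 dom]]] := amp_dominated a1 irr A0.
pose f n := integrand q (occ_seq a (x n) q) a (k n) n.+1 n.+1%:Z.
pose T n : R := pi / k n.
have near_dom : \forall n \near \oo, forall s, 0 <= s <= T n -> `|f n s| <= C * (1 + s ^+ 2)^-1.
  have aA : 0 < alpha * A by rewrite mulr_gt0.
  apply: filterS2 (near_saddle_le x10) (near_saddle_le aA) => n xn xa s /andP[s0 sT].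
  have th : 0 <= k n * s <= pi.
    by rewrite mulr_ge0// ?(ltW (k0 n))//= mulrC -ler_pdivlMr.
  have Mx : 1 <= n.+1%:R * (alpha * x n).
    by rewrite mulrCA saddle_mul mulrA ler_pdivlMr// mul1r.
  have xx : 0 < x n <= x1 by rewrite x0.
  have := dom q (x n) n.+1 (k n * s) xx Mx th.
  have -> : A * ((k n * s) ^+ 2 / x n ^+ 3) = s ^+ 2.
    rewrite exprMn width_sqr.
    by have := x0 n; have := A0; move: (x n) A => y b b0 y0; field; rewrite !gt_eqF.
  rewrite -ler_pdivlMr; last by rewrite ltr_pwDl ?sqr_ge0.
  apply: le_trans; rewrite /f /integrand normrM ger0_norm; last first.
    exact/ltW/(amp_gt0 a1).
  by rewrite ler_piMr ?cos_max//; exact/ltW/(amp_gt0 a1).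
have [N _ hN] := near_dom.
have near_T s : 0 <= s -> \forall n \near \oo, s <= T n.
  move=> s0; have e0 : 0 < pi / (s + 1) :> R by rewrite divr_gt0 ?pi_gt0// ltr_wpDl.
  apply: filterS2 (near_saddle_le ltr01) (near_ratio_le e0) => n xn rn.
  rewrite /T ler_pdivlMr// mulrC.
  apply: le_trans (ler_pM _ _ (ler_pM _ _ xn rn) (lexx s)) _ => //; rewrite ?(ltW (k0 n)) ?sqrtr_ge0 ?(ltW (x0 n))//.
  by rewrite mul1r mulrAC ler_pdivrMr ?ltr_wpDl// ler_wpM2l ?pi_ge0// lerDl.
have lim : seg_int 0 (T n) (f n) @[n --> \oo] --> Num.sqrt pi / 2.
  rewrite -(cvg_shiftn N).
  apply: (@seg_int_dominated _ (fun n => f (n + N)%N) (fun n => T (n + N)%N) C).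
  - move=> n; apply: continuous_integrand => m t.
    by apply: occ_re_gt0 => //; exact: bty_mono.
  - by move=> n s; apply: hN; exact: leq_addl.
  - move=> s s0; have [N' _ h] := near_T s s0; exists N' => // n /= nN.
    by apply: h => /=; exact: leq_trans nN (leq_addr _ _).
  - by move=> s s0; rewrite (cvg_shiftn N (fun n => f n s)); exact: integrand_cvg.
have -> : (2 * Num.sqrt pi)^-1 = pi^-1 * (Num.sqrt pi / 2) :> R.
  have sp : 0 < Num.sqrt pi :> R by rewrite sqrtr_gt0 pi_gt0.
  rewrite -[in X in X^-1 * _](sqr_sqrtr (pi_ge0 R)).
  by move: (Num.sqrt pi) sp => r r0; field; rewrite gt_eqF.
have lim2 : pi^-1 * seg_int 0 (T n) (f n) @[n --> \oo] --> pi^-1 * (Num.sqrt pi / 2).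
  exact: cvgMr.
apply: cvg_trans lim2; apply: near_eq_cvg; apply: nearW => n.
rewrite -(fourier_prob (bty_mono a1) (x0 n) (k0 n)); last by move=> M th; exact: (@amp_le1 R alpha a1 false (x n) M th (x0 n)).
rewrite /fourier; change (pi^-1 * seg_int 0 (T n) (f n) = k n / pi * seg_int 0 (T n) (f n) / k n).
have := k0 n; have := pi_gt0 R; move: (seg_int _ _ _) (k n) (pi : R) => S u v v0 u0.
by field; rewrite !gt_eqF.
Qed.

End LocalLimit.

(** * Harmonic sums *)

Section Harmonic.
Variable R : realType.
Implicit Types M N : nat.

Definition harmonic_sum N : R := \sum_(1 <= k < N.+1) (k%:R)^-1.

Lemma harmonic_sumS N : harmonic_sum N.+1 = harmonic_sum N + N.+1%:R^-1.
Proof. by rewrite /harmonic_sum big_nat_recr. Qed.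

Lemma ln_succ_itv N : N.+2%:R^-1 <= ln (N.+2%:R : R) - ln (N.+1%:R : R) <= N.+1%:R^-1.
Proof.
have n0 : 0 < N.+1%:R :> R by []. have n1 : 0 < N.+2%:R :> R by [].
have q1 : 0 < N.+2%:R / N.+1%:R :> R by rewrite divr_gt0.
have q2 : 0 < N.+1%:R / N.+2%:R :> R by rewrite divr_gt0.
have h1 := ln_le_sub1 q1; have h2 := ln_le_sub1 q2.
have e : N.+2%:R = N.+1%:R + 1 :> R by rewrite -[in LHS]natr1.
rewrite !ln_div ?posrE// in h1 h2; rewrite e in h1 h2 n1 *.
move: n0 n1 h1 h2; move: (N.+1%:R : R) => n n0 n1 h1 h2.
have e1 : (n + 1) / n - 1 = n^-1 by field; rewrite gt_eqF.
have e2 : n / (n + 1) - 1 = - (n + 1)^-1 by field; rewrite gt_eqF.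
by rewrite e1 e2 in h1 h2; apply/andP; split; lra.
Qed.

Lemma harmonic_sum_le N : harmonic_sum N.+1 <= 1 + ln N.+1%:R.
Proof.
elim: N => [|N IH]; first by rewrite /harmonic_sum big_nat1 ln1 invr1 addr0.
have /andP[h _] := ln_succ_itv N.
rewrite harmonic_sumS; move: IH h.
move: (harmonic_sum _) (ln (N.+2%:R : R)) (ln (N.+1%:R : R)) (N.+2%:R^-1 : R) => *; lra.
Qed.

Lemma euler_gamma_cvg : harmonic_sum N - ln N%:R @[N --> \oo] --> euler_gamma R.
Proof.
suff : cvgn (fun N => harmonic_sum N - ln (N%:R : R)) by [].
suff : cvgn (fun N => harmonic_sum N.+1 - ln (N.+1%:R : R)).
  move=> /cvg_ex[l hl]; apply/cvg_ex; exists l.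
  by rewrite -cvg_shiftS.
apply: nonincreasing_is_cvgn.
  apply/nonincreasing_seqP => N; rewrite harmonic_sumS.
  have /andP[h _] := ln_succ_itv N; move: h.
  move: (harmonic_sum _) (ln (N.+2%:R : R)) (ln (N.+1%:R : R)) (N.+2%:R^-1 : R) => *; lra.
exists 0 => _ [N _ <-]; rewrite subr_ge0.
suff h : ln (N.+2%:R : R) <= harmonic_sum N.+1.
  by apply: le_trans h; rewrite ler_ln ?posrE ?ler_nat.
elim: N => [|N IH].
  by have /andP[_] := ln_succ_itv 0; rewrite ln1 subr0 /harmonic_sum big_nat1.
rewrite harmonic_sumS; have /andP[_ h] := ln_succ_itv N.+1; move: IH h.
move: (harmonic_sum _) (ln (N.+3%:R : R)) (ln (N.+2%:R : R)) (N.+2%:R^-1 : R) => *; lra.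
Qed.

Lemma sum_inv_sqr_le M : \sum_(1 <= k < M.+2) (k%:R ^+ 2)^-1 <= 2 - M.+1%:R^-1 :> R.
Proof.
elim: M => [|M IH]; first by rewrite big_nat1; lra.
rewrite big_nat_recr//=; apply: le_trans (lerD IH (lexx _)) _.
have n0 : 0 < M.+1%:R :> R by [].
rewrite (_ : M.+2%:R = M.+1%:R + 1 :> R); last by rewrite -[in LHS]natr1.
move: n0; move: (M.+1%:R : R) => n n0; have n1 : 0 < n + 1 by lra.
rewrite -subr_ge0 (_ : _ - _ = (n * (n + 1) ^+ 2)^-1).
  by rewrite invr_ge0 mulr_ge0 ?sqr_ge0// ltW.
by field; rewrite !gt_eqF.
Qed.

End Harmonic.

(** * The oscillating sums *)

Section BernoulliSums.
Variables (R : realType) (alpha : R).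
Hypothesis a1 : 1 < alpha.
Hypothesis irr : irrational alpha.
Implicit Types (y e : R) (M N m : nat).

Let a0 : 0 < alpha. Proof. exact: lt_trans a1. Qed.
Local Notation B m := (bernoulli1 (alpha * m%:R)).

Lemma discrepancy e : 0 < e -> exists2 C, 0 <= C &
  forall M, `|\sum_(1 <= j < M.+1) B j| <= e * M%:R + C.
Proof.
move=> e0; have [C hC] := bernoulli1_discrepancy irr e0; exists C => //.
by have := hC 0; rewrite big_geq// normr0 mulr0 add0r.
Qed.

(** The weights [(1 - bosephi (y * m)) / m = y * dlreg_fun (y * m)] decrease, so summation
by parts applies; their sum is at most logarithmic. *)
Lemma beatty_error_bound e : 0 < e -> exists2 C, 0 <= C & forall y M, 0 < y ->
  `|beatty_error alpha y M.+1| <= e * (1 + ln M.+1%:R) + C * y.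
Proof.
move=> e0; have [C C0 hC] := discrepancy e0; exists C => // y M y0.
pose w m := y * dlreg_fun (y * m%:R).
have ym m : 0 < y * m.+1%:R by rewrite mulr_gt0.
have w0 m : 0 <= w m.+1 by rewrite mulr_ge0 ?dlreg_fun_ge0// ltW.
have wd m : w m.+2 <= w m.+1.
  by rewrite ler_wpM2l ?(ltW y0)// dlreg_decr// ler_wpM2l ?(ltW y0)// ler_nat.
have wm m : w m.+1 = m.+1%:R^-1 * (1 - bosephi (y * m.+1%:R)).
  by rewrite -dlreg_bosephi// /w [y * m.+1%:R]mulrC -mulrA mulKf// pnatr_eq0.
have -> : beatty_error alpha y M.+1 = \sum_(1 <= m < M.+2) B m * w m.
  rewrite /beatty_error big_nat [RHS]big_nat; apply: eq_bigr => -[//|m] _.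
  by rewrite wm mulrA.
apply: le_trans (abel_decreasing M hC w0 wd) _; apply: lerD.
  rewrite ler_wpM2l ?(ltW e0)//; apply: le_trans (harmonic_sum_le R M).
  rewrite /harmonic_sum !big_nat; apply: ler_sum => -[//|m] _.
  by rewrite wm ler_piMr// gerBl bosephi_ge0.
rewrite ler_wpM2l// /w ler_piMr ?(ltW y0)// dlreg_fun_le1// mulr1.
Qed.

Lemma J1_partial_bound e : 0 < e -> exists2 C, 0 <= C & forall M,
  `|J1_partial alpha M.+1| <= e * (1 + ln M.+1%:R) + C.
Proof.
move=> e0; have [C C0 hC] := discrepancy e0; exists C => // M.
have w0 m : 0 <= m.+1%:R^-1 :> R by [].
have wd m : m.+2%:R^-1 <= m.+1%:R^-1 :> R by rewrite lef_pV2 ?posrE// ler_nat.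
apply: le_trans (abel_decreasing (w := fun m => m%:R^-1) M hC w0 wd) _.
rewrite invr1 mulr1 lerD2r ler_wpM2l ?(ltW e0)//.
exact: harmonic_sum_le.
Qed.

Lemma sum_exp_grid_le y M : 0 <= y ->
  \sum_(1 <= m < M.+1) y * expR (- (y * m%:R)) <= 1.
Proof.
move=> y0.
suff : \sum_(1 <= m < M.+1) y * expR (- (y * m%:R)) <= 1 - expR (- (y * M%:R)).
  by move=> /le_trans; apply; rewrite gerBl expR_ge0.
elim: M => [|M IH]; first by rewrite big_geq// mulr0 oppr0 expR0 subrr.
rewrite big_nat_recr//=; apply: le_trans (lerD IH (lexx _)) _.
have -> : expR (- (y * M%:R)) = expR y * expR (- (y * M.+1%:R)).
  by rewrite -expRD -natr1; congr expR; ring.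
have := expR_ge1Dx y; have := expR_ge0 (- (y * M.+1%:R)).
move: (expR y) (expR _) => u v v0 uy.
have : (1 + y) * v <= u * v by rewrite ler_wpM2r.
by move: (u * v) => w; rewrite mulrDl mul1r; lra.
Qed.

(** The difference has the weights [y * fermi (y * m)], whose sum is bounded; hence it
tends to 0 for every irrational [alpha], which is why the asymptotics for distinct parts
need no assumption on the series. *)
Lemma beatty_error_double e : 0 < e -> exists2 C, 0 <= C & forall y M, 0 < y ->
  `|beatty_error alpha (2 * y) M.+1 - beatty_error alpha y M.+1| <= e + C * y.
Proof.
move=> e0; have [C C0 hC] := discrepancy e0; exists C => // y M y0.
pose w m := y * fermi (y * m%:R).
have ym m : 0 < y * m.+1%:R by rewrite mulr_gt0.
have w0 m : 0 <= w m.+1 by rewrite mulr_ge0 ?(ltW (fermi_gt0 _))// ltW.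
have wd m : w m.+2 <= w m.+1.
  rewrite ler_wpM2l ?(ltW y0)// /fermi lef_pV2 ?posrE ?addr_gt0 ?expR_gt0//.
  by rewrite lerD2r ler_expR ler_wpM2l ?(ltW y0)// ler_nat.
have -> : beatty_error alpha (2 * y) M.+1 - beatty_error alpha y M.+1 =
    \sum_(1 <= m < M.+2) B m * w m.
  rewrite /beatty_error -sumrB big_nat [RHS]big_nat; apply: eq_bigr => -[//|m] _.
  rewrite -mulrBr -!mulrA; congr (_ * _); rewrite mulrC.
  rewrite /w fermi_bose// /bosephi ?[2 * y * _]mulrA.
  move: (bose (2 * _)) (bose (y * _)) => b2 b1.
  have n0 : m.+1%:R != 0 :> R by rewrite pnatr_eq0.
  by move: (m.+1%:R : R) n0 => n n0; field.
apply: le_trans (abel_decreasing M hC w0 wd) _; apply: lerD.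
  rewrite ler_piMr ?(ltW e0)//; apply: le_trans (sum_exp_grid_le M.+1 (ltW y0)).
  rewrite !big_nat; apply: ler_sum => m _.
  rewrite ler_wpM2l ?(ltW y0)// /fermi expRN lef_pV2 ?posrE ?addr_gt0 ?expR_gt0//.
  by rewrite lerDl.
rewrite ler_wpM2l// /w mulr1 ler_piMr ?(ltW y0)//.
by apply/ltW; apply: lt_trans (fermi_lt_half y0) _; lra.
Qed.

(** Here the weights [1 - bosephi (y * m)] increase to at most 1 and the series itself is
summed by parts; a fixed number of initial terms is of order [y]. *)
Lemma beatty_error_cvg e : cvgn (J1_partial alpha) -> 0 < e ->
  exists2 C, 0 <= C & forall y M, 0 < y -> `|beatty_error alpha y M| <= e + C * y.
Proof.
move=> /cvg_ex[c Jc] e0.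
have e2 : 0 < e / 2 by rewrite divr_gt0.
have /cvgrPdist_le/(_ _ e2)[N _ hN] := Jc.
have {N}[N N1 {}hN] : exists2 N, (0 < N)%N &
    forall m, (N <= m)%N -> `|J1_partial alpha m - c| <= e / 2.
  by exists N.+1 => // m Nm; rewrite distrC; apply: hN => /=; exact: ltnW.
exists (N%:R * N%:R) => [|y M y0]; first by rewrite mulr_ge0.
pose j m := B m / m%:R; pose u m : R := 1 - bosephi (y * m%:R).
have ym m : 0 < y * m.+1%:R by rewrite mulr_gt0.
have u1 m : 0 <= u m.+1 <= 1.
  by rewrite /u subr_ge0 bosephi_le1//= gerBl bosephi_ge0.
have uy m : u m.+1 <= y * m.+1%:R.
  by rewrite /u -dlreg_bosephi// ler_piMr ?(ltW (ym _))// dlreg_fun_le1.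
have head K : (K <= N)%N -> `|\sum_(1 <= m < K.+1) j m * u m| <= N%:R * N%:R * y.
  move=> KN; apply: le_trans (ler_norm_sum _ _ _) _.
  apply: le_trans (_ : \sum_(1 <= m < K.+1) N%:R * y <= _); last first.
    rewrite sumr_const_nat subn1 -[leLHS]mulr_natl mulrA ler_wpM2r ?(ltW y0)// ler_wpM2r//.
    by rewrite ler_nat.
  rewrite !big_nat; apply: ler_sum => -[//|m] /andP[_ mK].
  have /andP[v0 v1] := u1 m.
  rewrite normrM [ `|u _|]ger0_norm//.
  have j1 : `|j m.+1| <= 1.
    rewrite normrM normfV (ger0_norm (ler0n _ _)) ler_pdivrMr// mul1r.
    apply: le_trans (bernoulli1_bound _) _; apply: le_trans (_ : 1 <= _); first by lra.
    by rewrite ler1n.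
  apply: le_trans (ler_pM _ _ j1 (uy m)) _ => //.
  by rewrite mul1r mulrC ler_wpM2r ?(ltW y0)// ler_nat (leq_trans _ KN).
rewrite /beatty_error -/(\sum_(1 <= m < M.+1) j m * u m).
have [MN|NM] := leqP M N; first by apply: le_trans (head _ MN) _; rewrite lerDr ltW.
rewrite (big_cat_nat (n := N.+1))//=; last by rewrite ltnS ltnW.
rewrite addrC; apply: le_trans (ler_normD _ _) _; apply: lerD; last exact: head.
have ud m : (N <= m)%N -> u m <= u m.+1.
  case: m => [|m _]; first by rewrite leqNgt N1.
  by rewrite /u lerD2l lerN2 bosephi_decr// ler_wpM2l ?(ltW y0)// ler_nat.
have hJ m : (N <= m <= N + (M - N))%N -> `|\sum_(1 <= i < m.+1) j i - c| <= e / 2.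
  by move=> /andP[Nm _]; exact: hN.
have := abel_increasing hJ ud; rewrite subnKC ?(ltnW NM)//.
have := hN M (ltnW NM); have := hN N (leqnn N).
rewrite /J1_partial -/(\sum_(1 <= i < M.+1) j i) -/(\sum_(1 <= i < N.+1) j i).
have /andP[] := u1 M.-1; have /andP[] := u1 N.-1.
rewrite !prednK//; last by apply: leq_trans NM.
move: (u M) (u N) => s r r0 r1 s0 s1.
move: (\sum_(1 <= i < M.+1) j i - c) (\sum_(1 <= i < N.+1) j i - c) => p t.
move: (\sum_(_ <= _ < _) _) => S tb pb h.
rewrite (_ : S = (S - p * s + t * r) + (p * s - t * r)); last by ring.
apply: le_trans (ler_normD _ _) _.
have h2 : `|p * s - t * r| <= e / 2 * s + e / 2 * r.
  apply: le_trans (ler_normB _ _) _; rewrite !normrM (ger0_norm s0) (ger0_norm r0).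
  by apply: lerD; rewrite ler_wpM2r.
apply: le_trans (lerD h h2) _.
rewrite (_ : e / 2 * (s - r) + _ = e * s); last by field.
by rewrite ler_piMr// ltW.
Qed.

Lemma Lambda_prod_gt0 M : 0 < Lambda_prod_partial alpha M.
Proof.
rewrite /Lambda_prod_partial big_nat; apply: prodr_gt0 => -[//|m] _.
by rewrite mulr_gt0 ?expR_gt0//; exact: beatty_defect_lt1.
Qed.

Lemma ln_Lambda_prod M : ln (Lambda_prod_partial alpha M) =
  \sum_(1 <= m < M.+1) ln (1 - beatty_defect alpha m) + harmonic_sum R M / (2 * alpha).
Proof.
elim: M => [|M IH].
  by rewrite /Lambda_prod_partial /harmonic_sum !big_geq// ln1 mul0r addr0.
have pS : Lambda_prod_partial alpha M.+1 = Lambda_prod_partial alpha M *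
    ((1 - beatty_defect alpha M.+1) * expR (1 / (2 * alpha * M.+1%:R))).
  by rewrite /Lambda_prod_partial big_nat_recr.
have d0 := beatty_defect_lt1 a1 M.
rewrite pS lnM ?posrE ?Lambda_prod_gt0 ?mulr_gt0 ?expR_gt0//.
rewrite lnM ?posrE ?expR_gt0// expRK IH harmonic_sumS (big_nat_recr M.+1)//=.
have -> : 1 / (2 * alpha * M.+1%:R) = M.+1%:R^-1 / (2 * alpha).
  by rewrite mul1r invfM mulrC.
by rewrite mulrDl; ring.
Qed.

(** By [ln_Lambda_prod_J] the infinite product has a positive limit exactly when the series
converges; this is the part that always converges. *)
Definition defect_rem M : R :=
  \sum_(1 <= m < M.+1) (- ln (1 - beatty_defect alpha m) - beatty_defect alpha m).

Lemma ln_Lambda_prod_J M : ln (Lambda_prod_partial alpha M) =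
  - J1_partial alpha M / alpha - defect_rem M.
Proof.
rewrite ln_Lambda_prod /J1_partial /defect_rem /harmonic_sum.
rewrite !mulr_suml -sumrN mulr_suml -sumrB -big_split/=.
rewrite big_nat [RHS]big_nat; apply: eq_bigr => -[//|m] _.
rewrite /beatty_defect /bernoulli1; move: (frac_part _) (ln _) => f l.
have n0 : m.+1%:R != 0 :> R by rewrite pnatr_eq0.
have := gt_eqF a0; move: (m.+1%:R : R) n0 => n n0 an.
by field; rewrite n0 an.
Qed.

Lemma beatty_defect_itv m : 0 <= beatty_defect alpha m.+1 <= m.+1%:R^-1.
Proof.
have m0 : 0 < m.+1%:R :> R by [].
have f0 := frac_part_ge0 (alpha * m.+1%:R); have f1 := frac_part_lt1 (alpha * m.+1%:R).
apply/andP; split; first by rewrite divr_ge0// mulr_ge0// ltW.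
rewrite ler_pdivrMr ?mulr_gt0// mulrCA mulVf ?mulr1 ?gt_eqF//.
exact: le_trans (ltW f1) (ltW a1).
Qed.

Lemma defect_rem_cvg : cvgn defect_rem.
Proof.
pose r m : R := - ln (1 - beatty_defect alpha m) - beatty_defect alpha m.
have r0 m : 0 <= r m.+1.
  have := ln_le_sub1 (beatty_defect_lt1 a1 m); rewrite /r.
  by move: (beatty_defect _ _) => d; move: (ln _) => l h; lra.
have r2 m : r m.+2 <= 2 * (m.+2%:R ^+ 2)^-1.
  have /andP[d0 d1] := beatty_defect_itv m.+1.
  have i2 : m.+2%:R^-1 <= 2^-1 :> R by rewrite lef_pV2 ?posrE// ler_nat.
  have := @ln1D_bound R (- beatty_defect alpha m.+2).
  rewrite normrN (ger0_norm d0) => /(_ (le_trans d1 i2)).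
  rewrite opprK sqrrN => /ler_normlP[h _]; rewrite /r.
  rewrite -opprD; apply: le_trans h _; rewrite ler_wpM2l// -exprVn.
  by rewrite ler_pXn2r ?nnegrE.
apply: nondecreasing_is_cvgn.
  by apply/nondecreasing_seqP => n; rewrite /defect_rem (big_nat_recr n.+1)//= lerDl; exact: r0.
exists (r 1%N + 4) => _ [M _ <-].
case: M => [|M]; first by rewrite /defect_rem big_geq// addr_ge0.
rewrite /defect_rem -/(\sum_(1 <= m < M.+2) r m).
have : \sum_(1 <= m < M.+2) r m <= r 1%N + 2 * \sum_(1 <= k < M.+2) (k%:R ^+ 2)^-1.
  elim: M => [|M IH]; first by rewrite !big_nat1 lerDl mulr_ge0// invr_ge0 sqr_ge0.
  rewrite !(big_nat_recr M.+2)//= [2 * (_ + _)]mulrDr [leRHS]addrA; exact: lerD IH (r2 M).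
move=> /le_trans; apply; rewrite lerD2l.
have := sum_inv_sqr_le R M; have : 0 <= M.+1%:R^-1 :> R by [].
by move: (_^-1) (\sum_(_ <= _ < _) _) => *; lra.
Qed.

Lemma Lambda_prod_cvg : cvgn (J1_partial alpha) ->
  exists2 l : R, 0 < l & Lambda_prod_partial alpha @ \oo --> l.
Proof.
move=> /cvg_ex[c Jc]; have /cvg_ex[r hr] := defect_rem_cvg.
exists (expR (- c / alpha - r)); first exact: expR_gt0.
have h : (fun M => - J1_partial alpha M / alpha - defect_rem M) @ \oo --> - c / alpha - r.
  by apply: cvgB => //; apply: cvgMl; exact: cvgN.
have h2 : expR (- J1_partial alpha M / alpha - defect_rem M) @[M --> \oo] --> expR (- c / alpha - r).
  exact: continuous_cvg _ (@continuous_expR R _) h.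
apply: cvg_trans h2; apply: near_eq_cvg; apply: nearW => M.
by rewrite -ln_Lambda_prod_J lnK// posrE Lambda_prod_gt0.
Qed.

Lemma ln_Lambda_prod_bound e : 0 < e -> exists2 C, 0 <= C & forall M,
  `|ln (Lambda_prod_partial alpha M.+1)| <= e * (1 + ln M.+1%:R) + C.
Proof.
move=> e0; have [C C0 hC] := J1_partial_bound e0.
have /cvg_ex[r hr] := defect_rem_cvg.
have bd : exists K, forall M, `|defect_rem M| <= K.
  have [K [_ hK]] := cvg_seq_bounded (cvgP _ hr).
  by exists (K + 1) => M; apply: hK => //; rewrite ltrDl.
have [K hK] := bd; exists (C + K) => [|M]; first by rewrite addr_ge0// (le_trans _ (hK 0%N)).
rewrite ln_Lambda_prod_J; apply: le_trans (ler_normB _ _) _.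
rewrite addrA; apply: lerD (hK _).
rewrite normrM normrN; apply: le_trans (hC M).
by rewrite ler_piMr// normfV (gtr0_norm a0) invf_le1// ltW.
Qed.

End BernoulliSums.

(** * Saddle point estimates *)

Section PositiveAxis.
Variables (R : realType) (alpha : R).
Hypothesis a1 : 1 < alpha.
Hypothesis irr : irrational alpha.
Local Notation a := (bty alpha).
Local Notation zeta2 := (pi ^+ 2 / 6 : R).
Implicit Types (x y : R) (M N m n : nat) (q : bool).

Let a0 : 0 < alpha. Proof. exact: lt_trans a1. Qed.
Let arg0 x m : 0 < x -> 0 < x * (a m.+1)%:R.
Proof. by move=> x0; rewrite mulr_gt0// bty_gt0. Qed.

Lemma ln_norm_cst_all x M : 0 < x ->
  - ln (norm_cst a x false M) = \sum_(1 <= m < M.+1) lgeo (x * (a m)%:R).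
Proof.
move=> x0; elim: M => [|M IH]; first by rewrite /norm_cst !big_geq// ln1 oppr0.
rewrite /norm_cst !(big_nat_recr M.+1)//= -/(norm_cst a x false M).
have b0 := bose1D_gt0 (arg0 M x0).
rewrite /occ_seq /occ opprK lnM ?posrE ?invr_gt0//.
  by rewrite lnV ?posrE// opprD opprK IH.
by apply: norm_cst_gt0 => //; exact: bty_mono.
Qed.

Lemma ln_fermiN t : 0 < t -> - ln (1 - fermi t) = lgeo t - lgeo (2 * t) :> R.
Proof.
move=> t0; have t2 : 0 < 2 * t by rewrite mulr_gt0.
apply: expR_inj; rewrite expRD !expRN !lgeoE// invrK lnK; last first.
  by rewrite posrE subr_gt0 (lt_trans (fermi_lt_half t0))// invf_lt1// ltr1n.
have -> : - (2 * t) = - t + - t by ring.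
rewrite expRD /fermi expRN.
have := expR_gt1 t; rewrite t0; move: (expR t) => u u1.
field; rewrite !gt_eqF//; lra.
Qed.

(** The product of [1 + expR (- x * a)] is a quotient of two products for repeated parts. *)
Lemma ln_norm_cst_distinct x M : 0 < x ->
  - ln (norm_cst a x true M) = \sum_(1 <= m < M.+1) lgeo (x * (a m)%:R)
    - \sum_(1 <= m < M.+1) lgeo (2 * x * (a m)%:R).
Proof.
move=> x0; elim: M => [|M IH]; first by rewrite /norm_cst !big_geq// ln1 oppr0 addr0.
rewrite /norm_cst !(big_nat_recr M.+1)//= -/(norm_cst a x true M).
have o0 := occ1_gt0 (bty_mono a1) x0 true M.
rewrite lnM ?posrE//; last by apply: norm_cst_gt0 => //; exact: bty_mono.
by rewrite opprD IH /occ_seq /occ ln_fermiN ?arg0// -mulrA; ring.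
Qed.

Lemma axis_error_le y T B : 0 < y -> 0 < T -> 0 < B -> T = B / y ->
  5 * y + 2 * lgeo T + dilog_exp T / y <= (5 + 2 / B + 2 * zeta2 / B ^+ 2) * y.
Proof.
move=> y0 T0 B0 TE; have b0 := bose_gt0 T0.
have z0 := zeta2_gt0 R.
have h1 : lgeo T <= y / B.
  apply: le_trans (lgeo_le T0) _; have := bose_pow_le 0 T0; rewrite expr1.
  rewrite -ler_pdivlMr// => /le_trans; apply.
  by rewrite TE invf_div mulrA mul1r.
have h2 : dilog_exp T / y <= 2 * zeta2 / B ^+ 2 * y.
  rewrite ler_pdivrMr//; apply: le_trans (dilog_exp_decay T0) _.
  have e1 : expR (- T) <= bose T.
    by rewrite /bose expRN lef_pV2 ?posrE ?expR_gt0 ?expR_sub1_gt0// gerBl.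
  have e2 : bose T <= 2 / T ^+ 2.
    by rewrite ler_pdivlMr ?exprn_gt0//; exact: (bose_pow_le 1 T0).
  apply: le_trans (ler_wpM2r (ltW z0) (le_trans e1 e2)) _.
  rewrite TE le_eqVlt; apply/orP; left; apply/eqP.
  by move: (pi : R) => p; field; rewrite !gt_eqF.
rewrite [leRHS]mulrDl; apply: lerD h2; rewrite [leRHS]mulrDl lerD2l.
by rewrite -[leRHS]mulrA [B^-1 * y]mulrC ler_wpM2l.
Qed.

(** [T = y * n.+1] is of order [1 / y]: the parts beyond the index [n.+1] are negligible. *)
Lemma saddle_argE q n : alpha * saddle alpha q n.+1 * n.+1%:R =
  alpha ^+ 2 * growth alpha q / (alpha * saddle alpha q n.+1).
Proof.
have x0 := saddle_gt0 q a1 n.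
rewrite -mulrA [saddle _ _ _ * _]mulrC saddle_mul//.
by move: (growth _ _) (saddle _ _ _) x0 => g x x0; field; rewrite !gt_eqF.
Qed.

Lemma saddle_arg_cvg0 q : alpha * saddle alpha q n.+1 @[n --> \oo] --> (0 : R).
Proof.
by rewrite -[X in _ --> X](mulr0 alpha); apply: cvgMr; exact: saddle_cvg0.
Qed.

Lemma axis_all (x := fun n => saddle alpha false n.+1) :
  (- ln (norm_cst a (x n) false n.+1)
   - (growth alpha false / x n + ln (alpha * x n) / 2 - ln (2 * pi) / 2
      + (euler_gamma R - ln (alpha * x n)) / (2 * alpha)
      - ln (Lambda_prod_partial alpha n.+1)
      - beatty_error alpha (alpha * x n) n.+1 / alpha)) @[n --> \oo] --> (0 : R).
Proof.
have x0 n : 0 < x n := saddle_gt0 false a1 n.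
pose B := alpha ^+ 2 * growth alpha false.
have B0 : 0 < B by rewrite mulr_gt0 ?exprn_gt0// growth_gt0.
pose K := 5 + 2 / B + 2 * zeta2 / B ^+ 2.
pose d n := (ln (2 * pi) / 2 - stirling_dev R n.+1) +
  (harmonic_sum R n.+1 - ln n.+1%:R - euler_gamma R) / (2 * alpha).
have d0 : d n @[n --> \oo] --> (0 : R).
  rewrite -[X in _ --> X](addr0 0); apply: cvgD.
    rewrite -(subrr (ln (2 * pi) / 2)); apply: cvgB; first exact: cvg_cst.
    by have := @stirling R; rewrite -cvg_shiftS.
  rewrite -[X in _ --> X](mul0r (2 * alpha)^-1); apply: cvgMl.
  rewrite -(subrr (euler_gamma R)); apply: cvgB; last exact: cvg_cst.
  by have := @euler_gamma_cvg R; rewrite -cvg_shiftS.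
apply: (@cvg_of_dist _ _ _ _ (fun n => K * (alpha * x n) + `|d n|)); last first.
  rewrite -[X in _ --> X](addr0 0); apply: cvgD; last by rewrite -(normr0 R); exact: cvg_norm.
  by rewrite -[X in _ --> X](mulr0 K); apply: cvgMr; exact: saddle_arg_cvg0.
apply: nearW => n; rewrite subr0 ln_norm_cst_all//.
have y0 : 0 < alpha * x n by rewrite mulr_gt0.
have TE := saddle_argE false n; rewrite -/(x n) in TE.
have T0 : 0 < alpha * x n * n.+1%:R by rewrite mulr_gt0.
have lT : ln (alpha * x n * n.+1%:R) = ln (alpha * x n) + ln n.+1%:R by rewrite lnM ?posrE.
have := sum_lgeo_asymp a1 (x0 n) erefl (erefl (alpha * x n * n.+1%:R)).
have := axis_error_le y0 T0 B0 TE; rewrite -/K lT ln_Lambda_prod//.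
have -> : zeta2 / (alpha * x n) = growth alpha false / x n.
  by rewrite /growth /zq invfM mulrA.
rewrite /d; move: (5 * _ + _ + _) => er er_le hS.
set D := ln (2 * pi) / 2 - _ + _.
set S := \sum_(1 <= m < n.+2) lgeo _ in hS *.
rewrite [X in `|X|](_ : _ = (S - (growth alpha false / x n + ln (alpha * x n) / 2 -
    stirling_dev R n.+1 - \sum_(1 <= m < n.+2) ln (1 - beatty_defect alpha m) -
    (ln (alpha * x n) + ln n.+1%:R) / (2 * alpha) -
    beatty_error alpha (alpha * x n) n.+1 / alpha)) + D).
  by apply: le_trans (ler_normD _ _) _; rewrite lerD2r (le_trans hS).
rewrite /D; move: (stirling_dev R _) (harmonic_sum R _) (beatty_error _ _ _) (euler_gamma R).
move: (ln (alpha * x n)) (ln (n.+1%:R : R)) (ln (2 * pi)) (growth _ _ / _) => *.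
by field; rewrite gt_eqF.
Qed.

(** The terms that depend on the fractional parts cancel between [x] and [2 * x], up to the
difference estimated in [beatty_error_double]. *)
Lemma axis_distinct (x := fun n => saddle alpha true n.+1) :
  (- ln (norm_cst a (x n) true n.+1) - growth alpha true / x n)
     @[n --> \oo] --> (2 * alpha)^-1 * ln 2 - ln 2 / 2.
Proof.
have x0 n : 0 < x n := saddle_gt0 true a1 n.
pose B := alpha ^+ 2 * growth alpha true.
have B0 : 0 < B by rewrite mulr_gt0 ?exprn_gt0// growth_gt0.
pose Kf b := 5 + 2 / b + 2 * zeta2 / b ^+ 2.
pose K := Kf B + Kf (4 * B) * 2.
pose D n := beatty_error alpha (2 * (alpha * x n)) n.+1 - beatty_error alpha (alpha * x n) n.+1.
have D0 : D n @[n --> \oo] --> (0 : R).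
  apply/cvgrPdist_le => e e0; have e2 : 0 < e / 2 by rewrite divr_gt0.
  have [C C0 hC] := beatty_error_double irr e2.
  have e3 : 0 < e / 2 / (C + 1) by rewrite divr_gt0// ltr_wpDl.
  have /cvgrPdist_le/(_ _ e3) := saddle_arg_cvg0 true.
  apply: filterS => n; rewrite !sub0r !normrN => h.
  have y0 : 0 < alpha * x n by rewrite mulr_gt0.
  apply: le_trans (hC (alpha * x n) n y0) _.
  have h' : alpha * x n <= e / 2 / (C + 1) by apply: le_trans (ler_norm _) h.
  rewrite [leRHS](_ : e = e / 2 + e / 2); last by field.
  rewrite lerD2l; apply: le_trans (ler_wpM2l C0 h') _.
  by rewrite mulrCA ler_piMr ?(ltW e2)// ler_pdivrMr ?mul1r ?lerDl// ltr_wpDl.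
apply: (@cvg_of_dist _ _ _ _ (fun n => K * (alpha * x n) + alpha^-1 * `|D n|)); last first.
  rewrite -[X in _ --> X](addr0 0); apply: cvgD; last first.
    rewrite -[X in _ --> X](mulr0 alpha^-1) -(normr0 R).
    by apply: cvgMr; exact: cvg_norm.
  by rewrite -[X in _ --> X](mulr0 K); apply: cvgMr; exact: saddle_arg_cvg0.
apply: nearW => n; rewrite ln_norm_cst_distinct//.
have y0 : 0 < alpha * x n by rewrite mulr_gt0.
have y20 : 0 < 2 * (alpha * x n) by rewrite mulr_gt0.
have x20 : 0 < 2 * x n by rewrite mulr_gt0.
have TE := saddle_argE true n; rewrite -/(x n) -/B in TE.
have T0 : 0 < alpha * x n * n.+1%:R by rewrite mulr_gt0.
have T20 : 0 < 2 * (alpha * x n) * n.+1%:R by rewrite mulr_gt0.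
have TE2 : 2 * (alpha * x n) * n.+1%:R = 4 * B / (2 * (alpha * x n)).
  by rewrite -mulrA TE; move: y0; move: (alpha * x n) => y y0; field; rewrite gt_eqF.
have B40 : 0 < 4 * B by rewrite mulr_gt0.
have lT : ln (alpha * x n * n.+1%:R) = ln (alpha * x n) + ln n.+1%:R by rewrite lnM ?posrE.
have lT2 : ln (2 * (alpha * x n) * n.+1%:R) = ln 2 + ln (alpha * x n) + ln n.+1%:R.
  by rewrite !lnM ?posrE.
have ly2 : ln (2 * (alpha * x n)) = ln 2 + ln (alpha * x n) by rewrite lnM ?posrE.
have g1 := sum_lgeo_asymp a1 (x0 n) erefl (erefl (alpha * x n * n.+1%:R)).
have yE2 : 2 * (alpha * x n) = alpha * (2 * x n) by ring.
have g2 := sum_lgeo_asymp a1 x20 yE2 (erefl (2 * (alpha * x n) * n.+1%:R)).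
have := le_trans g2 (axis_error_le y20 T20 B40 TE2); have := le_trans g1 (axis_error_le y0 T0 B0 TE).
rewrite -/(Kf B) -/(Kf (4 * B)) lT lT2 ly2.
have -> : zeta2 / (alpha * x n) = 2 * (growth alpha true / x n).
  by rewrite /growth /zq invfM; move: (pi : R) => p; field; rewrite !gt_eqF.
have -> : zeta2 / (2 * (alpha * x n)) = growth alpha true / x n.
  by rewrite /growth /zq; move: (pi : R) => p; field; rewrite !gt_eqF.
rewrite /D /K; move: (Kf _) (Kf _) => k1 k2.
have := ltW y0; have := gt_eqF a0.
move: (beatty_error _ _ _) (beatty_error _ _ _) => E1 E2.
move: (\sum_(1 <= m < n.+2) lgeo _) (\sum_(1 <= m < n.+2) lgeo _) => S1 S2.
move: (\sum_(_ <= _ < _) _) (growth _ _ / _) (stirling_dev R _).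
move: (ln (n.+1%:R : R)) (ln (alpha * x n)) (ln (2 : R)) (alpha * x n).
move=> lN ly l2 y U A st an yp; set F2 := (X in S2 - X); set F1 := (X in S1 - X) => h1 h2.
rewrite [X in `|X|](_ : _ = (S2 - F2) - (S1 - F1) + alpha^-1 * (E1 - E2)); last first.
  by rewrite /F1 /F2; field; rewrite an.
apply: le_trans (ler_normD _ _) _; rewrite normrM [ `|alpha^-1|]ger0_norm ?invr_ge0 ?(ltW a0)//.
rewrite lerD2r; apply: le_trans (ler_normB _ _) _; apply: le_trans (lerD h1 h2) _.
by rewrite [leRHS]mulrDl -[k1 * 2 * y]mulrA.
Qed.

Section Counts.
Variable q : bool.
Local Notation A := (growth alpha q).
Local Notation x n := (saddle alpha q n.+1).

Lemma count_near_gt0 : \forall n \near \oo, 0 < (count a q n.+1 n.+1)%:R :> R.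
Proof.
have l0 : 0 < (2 * Num.sqrt pi)^-1 :> R by rewrite invr_gt0 mulr_gt0// sqrtr_gt0 pi_gt0.
have := local_limit q a1 irr => /cvgr_gt/(_ _ l0); apply: filterS => n.
rewrite /prob pmulr_lgt0 ?invr_gt0 ?width_gt0// pmulr_lgt0 ?norm_cst_gt0//.
- by rewrite pmulr_lgt0 ?expR_gt0.
- exact: bty_mono.
- exact: saddle_gt0.
Qed.

Lemma ln_saddle n : ln (x n) = (ln A - ln n.+1%:R) / 2.
Proof.
have A0 : 0 < A := growth_gt0 q a1.
have An : 0 < A / n.+1%:R by rewrite divr_gt0.
by rewrite /saddle (ln_sqrt An) ln_div ?posrE.
Qed.

Lemma ln_width n : ln (width alpha q n.+1) = ln A / 4 - 3 / 4 * ln n.+1%:R.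
Proof.
have A0 : 0 < A := growth_gt0 q a1; have x0 := saddle_gt0 q a1 n.
have xA : 0 < x n / A by rewrite divr_gt0.
have sA : 0 < Num.sqrt (x n / A) by rewrite sqrtr_gt0.
rewrite /width lnM ?posrE// (ln_sqrt xA) ln_div ?posrE// ln_saddle.
by move: (ln A) (ln _) => u v; field.
Qed.

Lemma saddle_sqrt n : A / x n = Num.sqrt (A * n.+1%:R).
Proof.
have A0 : 0 < A := growth_gt0 q a1.
have x0 := saddle_gt0 q a1 n.
rewrite -(saddle_sqr q a1 n) -[in RHS]mulrA [_ ^+ 2 * _]mulrC [in RHS]mulrA -[in RHS]expr2 -exprMn sqrtr_sqr.
rewrite ger0_norm ?mulr_ge0 ?(ltW x0)//; apply/(canLR (mulfK _)); rewrite ?gt_eqF//.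
by rewrite -mulrA -expr2.
Qed.

(** The count is [prob] times [expR (x * n)] over [norm_cst], with [prob] close to
[width / (2 * sqrt pi)]. *)
Lemma ln_count_cvg :
  (ln (count a q n.+1 n.+1)%:R - (2 * Num.sqrt (A * n.+1%:R) - 3 / 4 * ln n.+1%:R)
     - (- ln (norm_cst a (x n) q n.+1) - A / x n))
   @[n --> \oo] --> ln A / 4 - ln (2 * Num.sqrt pi).
Proof.
have A0 : 0 < A := growth_gt0 q a1.
have s0 : 0 < 2 * Num.sqrt pi :> R by rewrite mulr_gt0// sqrtr_gt0 pi_gt0.
have l0 : 0 < (2 * Num.sqrt pi)^-1 :> R by rewrite invr_gt0.
have h : ln (prob a (x n) q n.+1 n.+1%:Z / width alpha q n.+1) @[n --> \oo] --> ln (2 * Num.sqrt pi)^-1.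
  exact: continuous_cvg _ (continuous_ln l0) (local_limit q a1 irr).
have -> : ln A / 4 - ln (2 * Num.sqrt pi) = ln (2 * Num.sqrt pi)^-1 + ln A / 4.
  by rewrite lnV// addrC.
have h2 : ln (prob a (x n) q n.+1 n.+1%:Z / width alpha q n.+1) + ln A / 4 @[n --> \oo]
    --> ln (2 * Num.sqrt pi)^-1 + ln A / 4.
  by apply: cvgD => //; exact: cvg_cst.
apply: cvg_trans h2; apply: near_eq_cvg.
apply: filterS count_near_gt0 => n c0.
have x0 := saddle_gt0 q a1 n; have k0 := width_gt0 q a1 n.
have N0 := norm_cst_gt0 (bty_mono a1) x0 q n.+1.
have e0 := expR_gt0 (- (x n * n.+1%:R)); have ce0 := mulr_gt0 c0 e0; have cn0 := mulr_gt0 ce0 N0.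
rewrite /= /prob ln_div ?posrE// lnM ?posrE// lnM ?posrE// expRK.
rewrite [x n * _]mulrC saddle_mul// saddle_sqrt ln_width.
move: (Num.sqrt _) (ln _%:R) => s c.
by move: (ln A) (ln _) (ln _) => *; field.
Qed.

End Counts.

End PositiveAxis.

(** * The asymptotic formulas *)

Lemma equiv_of_ln (R : realType) (f g : nat -> R) :
  (\forall n \near \oo, 0 < f n.+1) -> (forall n, 0 < g n.+1) ->
  (ln (f n.+1) - ln (g n.+1)) @[n --> \oo] --> (0 : R) -> f ~_\oo g.
Proof.
move=> f0 g0 fg; apply/eqaddoP => e e0.
have fg1 : f n.+1 / g n.+1 @[n --> \oo] --> (1 : R).
  rewrite -(@expR0 R).
  have h : expR (ln (f n.+1) - ln (g n.+1)) @[n --> \oo] --> expR (0 : R).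
    exact: continuous_cvg _ (@continuous_expR R _) fg.
  apply: cvg_trans h; apply: near_eq_cvg; apply: filterS f0 => n fn.
  by rewrite expRD expRN !lnK ?posrE.
apply: near_inftyS; have /cvgrPdist_le/(_ e e0) := fg1.
apply: filterS => n; have gn := g0 n; rewrite distrC => h.
have -> : (f - g) n.+1 = (f n.+1 / g n.+1 - 1) * g n.+1.
  by rewrite mulrBl mul1r divfK// gt_eqF.
by rewrite normrM ler_wpM2r.
Qed.

Lemma cvg_near_eq (R : realType) (u v : nat -> R) (l : R) :
  (\forall n \near \oo, u n = v n) -> u @ \oo --> l -> v @ \oo --> l.
Proof. by move=> uv; apply: cvg_trans; exact: near_eq_cvg. Qed.

Lemma near_ln_ge (R : realType) (r : R) : \forall n \near \oo, r <= ln (n.+1%:R : R).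
Proof.
apply: filterS (nbhs_infty_ger (expR r)) => n h.
rewrite -[leLHS]expRK ler_ln ?posrE ?expR_gt0//.
by apply: le_trans h _; rewrite ler_nat.
Qed.

Section Asymptotics.
Variables (R : realType) (alpha : R).
Hypothesis a1 : 1 < alpha.
Hypothesis irr : irrational alpha.
Local Notation Aq := (growth alpha true).
Local Notation Ap := (growth alpha false).
Local Notation x n := (saddle alpha false n.+1).

Let a0 : 0 < alpha. Proof. exact: lt_trans a1. Qed.

Lemma q_beatty_gt0 : \forall n \near \oo, 0 < (q_beatty alpha n.+1)%:R :> R.
Proof.
apply: filterS (count_near_gt0 a1 irr true) => n.
by rewrite (q_beattyE a1 (leqnn _)).
Qed.

Lemma p_beatty_gt0 : \forall n \near \oo, 0 < (p_beatty alpha n.+1)%:R :> R.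
Proof.
apply: filterS (count_near_gt0 a1 irr false) => n.
by rewrite (p_beattyE a1 (leqnn _)).
Qed.

Lemma ln_q_beatty :
  (ln (q_beatty alpha n.+1)%:R - (2 * Num.sqrt (Aq * n.+1%:R) - 3 / 4 * ln n.+1%:R))
  @[n --> \oo] --> ln Aq / 4 - ln (2 * Num.sqrt pi) + ((2 * alpha)^-1 * ln 2 - ln 2 / 2).
Proof.
have h1 := ln_count_cvg a1 irr (q := true).
have h2 := axis_distinct a1 irr.
apply: cvg_near_eq (cvgD h1 h2); apply: nearW => n.
by rewrite !fctE subrK (q_beattyE a1 (leqnn _)).
Qed.

(** The contribution of the fractional parts to the logarithm of [p_beatty]. *)
Definition frac_error n : R := ln (Lambda_prod_partial alpha n.+1) +
  beatty_error alpha (alpha * x n) n.+1 / alpha.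

(** When [frac_error] converges, this constant minus its limit is [- ln (Lambda alpha)]. *)
Definition p_const : R := ln Ap / 4 - ln (2 * Num.sqrt pi)
  + (2^-1 - (2 * alpha)^-1) * (ln alpha + ln Ap / 2) - ln (2 * pi) / 2
  + euler_gamma R / (2 * alpha).

Lemma ln_p_beatty :
  (ln (p_beatty alpha n.+1)%:R - 2 * Num.sqrt (Ap * n.+1%:R)
    + (1 - 1 / (4 * alpha)) * ln n.+1%:R + frac_error n) @[n --> \oo] --> p_const.
Proof.
have h1 := ln_count_cvg a1 irr (q := false).
have h2 := axis_all a1.
rewrite /p_const.
pose c : R := (2^-1 - (2 * alpha)^-1) * (ln alpha + ln Ap / 2) +
   (- (ln (2 * pi) / 2) + euler_gamma R / (2 * alpha)).
rewrite [X in _ --> X](_ : _ = ln Ap / 4 - ln (2 * Num.sqrt pi) + c); last by rewrite /c; ring.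
rewrite -[X in _ --> X + c]addr0.
apply: cvg_near_eq (cvgD (cvgD h1 h2) (cvg_cst c)); apply: nearW => n.
rewrite !fctE (p_beattyE a1 (leqnn _)) /c /frac_error.
have x0 := saddle_gt0 false a1 n.
rewrite lnM ?posrE// ln_saddle//.
move: (ln _%:R) (ln (norm_cst _ _ _ _)) (ln (Lambda_prod_partial _ _)) => ? ? ?.
move: (beatty_error _ _ _) (euler_gamma R) (Num.sqrt _) (_ / x n) => ? ? ? ?.
move: (ln alpha) (ln Ap) (ln (2 * pi)) (ln _) => *.
by field; rewrite gt_eqF.
Qed.

Lemma frac_error_small : frac_error n / ln n.+1%:R @[n --> \oo] --> (0 : R).
Proof.
apply/cvgrPdist_le => e e0; have e5 : 0 < e / 5 by rewrite divr_gt0.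
have [C1 C10 h1] := ln_Lambda_prod_bound a1 irr e5.
have [C2 C20 h2] := beatty_error_bound irr e5.
have near_y : \forall n \near \oo, alpha * x n <= 1.
  have := saddle_arg_cvg0 alpha false => /cvgrPdist_le/(_ _ ltr01); apply: filterS => n.
  by rewrite sub0r normrN; apply: le_trans; exact: ler_norm.
near=> n.
have L1 : 1 <= ln n.+1%:R :> R by near: n; exact: near_ln_ge.
have L2 : (C1 + C2) / (e / 5) <= ln n.+1%:R by near: n; exact: near_ln_ge.
have y1 : alpha * x n <= 1 by near: n.
have x0 := saddle_gt0 false a1 n; have y0 : 0 < alpha * x n by rewrite mulr_gt0.
have L0 : 0 < ln n.+1%:R :> R by apply: lt_le_trans L1.
rewrite sub0r normrN normrM normfV (gtr0_norm L0) ler_pdivrMr//.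
rewrite ler_pdivrMr// in L2.
have g1 := h1 n; have g2 := h2 _ n y0.
have g3 : `|beatty_error alpha (alpha * x n) n.+1 / alpha| <= e / 5 * (1 + ln n.+1%:R) + C2.
  rewrite normrM normfV (gtr0_norm a0) ler_pdivrMr//.
  have t0 : 0 <= e / 5 * (1 + ln n.+1%:R) + C2.
    by rewrite addr_ge0// mulr_ge0 ?(ltW e5)// addr_ge0// ltW.
  apply: le_trans (_ : e / 5 * (1 + ln n.+1%:R) + C2 <= _); last first.
    by rewrite ler_peMr ?(ltW a1)//; exact: t0.
  by apply: le_trans g2 _; rewrite lerD2l ler_piMr.
apply: le_trans (ler_normD _ _) _; apply: le_trans (lerD g1 g3) _.
move: L1 L2 e5; move: (ln _) => l l1; rewrite mulrC => l2 e5.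
rewrite (_ : e * l = e / 5 * l + e / 5 * l + e / 5 * l + e / 5 * l + e / 5 * l); last by field.
have l3 : e / 5 <= e / 5 * l by rewrite ler_peMr// ltW.
rewrite !mulrDr !mulr1; move: l2 l3; move: (e / 5 * l) (e / 5) => u v; lra.
Unshelve. all: by end_near.
Qed.

Lemma frac_error_cvg (l : R) : cvgn (J1_partial alpha) -> 0 < l ->
  Lambda_prod_partial alpha @ \oo --> l -> frac_error n @[n --> \oo] --> ln l.
Proof.
move=> Jc l0 hl; rewrite -[X in _ --> X]addr0; apply: cvgD.
  apply: continuous_cvg (continuous_ln l0) _.
  by have := hl; rewrite -cvg_shiftS.
rewrite -[X in _ --> X](mul0r alpha^-1); apply: cvgMl.
apply/cvgrPdist_le => e e0; have e2 : 0 < e / 2 by rewrite divr_gt0.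
have [C C0 hC] := beatty_error_cvg Jc e2.
have e3 : 0 < e / 2 / (C + 1) by rewrite divr_gt0// ltr_wpDl.
have /cvgrPdist_le/(_ _ e3) := saddle_arg_cvg0 alpha false.
apply: filterS => n; rewrite !sub0r !normrN => h.
have y0 : 0 < alpha * x n by rewrite mulr_gt0// saddle_gt0.
apply: le_trans (hC (alpha * x n) n.+1 y0) _.
rewrite (gtr0_norm y0) in h.
rewrite [leRHS](_ : e = e / 2 + e / 2); last by field.
rewrite lerD2l; apply: le_trans (ler_wpM2l C0 h) _.
by rewrite mulrCA ler_piMr ?(ltW e2)// ler_pdivrMr ?mul1r ?lerDl// ltr_wpDl.
Qed.

Lemma sqrt_growth_distinct (n : R) : 0 <= n ->
  2 * Num.sqrt (Aq * n) = pi * Num.sqrt (n / (3 * alpha)).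
Proof.
move=> n0; have -> : Aq * n = (pi / 2) ^+ 2 * (n / (3 * alpha)).
  by rewrite /growth /zq; move: (pi : R) => p; field; rewrite gt_eqF.
rewrite sqrtrM ?sqr_ge0// sqrtr_sqr ger0_norm ?divr_ge0 ?pi_ge0//.
by rewrite mulrA mulrCA mulfV ?mulr1.
Qed.

Lemma sqrt_growth_all (n : R) : 0 <= n ->
  2 * Num.sqrt (Ap * n) = 2 * pi * Num.sqrt (n / (6 * alpha)).
Proof.
move=> n0; have -> : Ap * n = pi ^+ 2 * (n / (6 * alpha)).
  by rewrite /growth /zq; move: (pi : R) => p; field; rewrite gt_eqF.
by rewrite sqrtrM ?sqr_ge0// sqrtr_sqr ger0_norm ?pi_ge0// mulrA.
Qed.

Lemma ln_growth_all : ln Ap = 2 * ln pi - (ln 2 + ln 3) - ln alpha.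
Proof.
rewrite /growth /zq -mulrA -invfM ln_div ?posrE ?exprn_gt0 ?pi_gt0 ?mulr_gt0//.
rewrite expr2 lnM ?posrE ?pi_gt0// lnM ?posrE//.
have -> : 6 = 2 * 3 :> R by rewrite -natrM.
by rewrite lnM ?posrE//; ring.
Qed.

Lemma ln_growth_distinct : ln Aq = 2 * ln pi - (2 * ln 2 + ln 3) - ln alpha.
Proof.
have e : Aq = Ap / 2 by rewrite /growth /zq mulrAC.
rewrite e ln_div ?posrE ?growth_gt0// ln_growth_all; ring.
Qed.

Lemma ln_2sqrtpi : ln (2 * Num.sqrt pi) = ln 2 + ln pi / 2 :> R.
Proof. by rewrite lnM ?posrE ?sqrtr_gt0 ?pi_gt0// ln_sqrt ?pi_gt0. Qed.

Theorem q_beatty_equiv : (fun n => (q_beatty alpha n)%:R) ~_\oo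
  (fun n : nat => expR (pi * Num.sqrt (n%:R / (3 * alpha)))
     / (2 `^ (2 - 1 / (2 * alpha)) * (3 * alpha) `^ (1 / 4) * n%:R `^ (3 / 4))).
Proof.
have a30 : 0 < 3 * alpha by rewrite mulr_gt0.
apply: equiv_of_ln; first exact: q_beatty_gt0.
  by move=> n; rewrite divr_gt0 ?expR_gt0// !mulr_gt0// powR_gt0.
have h := ln_q_beatty.
set c := (X in _ --> X) in h.
rewrite -(subrr c); apply: cvg_near_eq (cvgB h (cvg_cst c)); apply: nearW => n; rewrite !fctE.
have p1 : 0 < 2 `^ (2 - 1 / (2 * alpha)) :> R by rewrite powR_gt0.
have p2 : 0 < (3 * alpha) `^ (1 / 4) by rewrite powR_gt0.
have p3 : 0 < n.+1%:R `^ (3 / 4) :> R by rewrite powR_gt0.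
have p12 := mulr_gt0 p1 p2; have p123 := mulr_gt0 p12 p3.
rewrite ln_div ?posrE ?expR_gt0// expRK !lnM ?posrE// !ln_powR.
rewrite -sqrt_growth_distinct// /c ln_growth_distinct ln_2sqrtpi lnM ?posrE//.
move: (ln (q_beatty _ _)%:R) (Num.sqrt _) => ? ?.
move: (ln n.+1%:R) (ln alpha) (ln pi) (ln 2) (ln 3) => *.
by field; rewrite gt_eqF.
Qed.

Theorem p_beatty_exponent : exists2 e : nat -> R, e @ \oo --> (0 : R) &
  \forall n \near \oo, (p_beatty alpha n)%:R =
    expR (2 * pi * Num.sqrt (n%:R / (6 * alpha))) / n%:R `^ (1 - 1 / (4 * alpha) + e n).
Proof.
pose e n : R := (2 * Num.sqrt (Ap * n%:R) - ln (p_beatty alpha n)%:R) / ln n%:R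
  - (1 - 1 / (4 * alpha)).
exists e.
  suff h : e n.+1 @[n --> \oo] --> (0 : R) by rewrite -cvg_shiftS; exact: h.
  have inv0 : (ln n.+1%:R)^-1 @[n --> \oo] --> (0 : R).
    apply/cvgrPdist_le => d d0; near=> n.
    have L : d^-1 <= ln n.+1%:R :> R by near: n; exact: near_ln_ge.
    have L0 : 0 < ln n.+1%:R :> R by apply: lt_le_trans L; rewrite invr_gt0.
    by rewrite sub0r normrN normfV gtr0_norm// -[leRHS]invrK lef_pV2 ?posrE ?invr_gt0.
  rewrite (_ : 0 = 0 - p_const * 0 :> R); last by rewrite mulr0 subr0.
  apply: cvg_near_eq (cvgB frac_error_small (cvgM ln_p_beatty inv0)); near=> n.
  have L1 : 1 <= ln n.+1%:R :> R by near: n; exact: near_ln_ge.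
  have L0 : ln n.+1%:R != 0 :> R by rewrite gt_eqF// (lt_le_trans ltr01).
  rewrite !fctE /= /e; move: (frac_error n) (ln (p_beatty _ _)%:R) (Num.sqrt _) => ? ? ?.
  by move: (ln _) L0 => l l0; field; rewrite l0 gt_eqF.
apply: near_inftyS; near=> n.
have L1 : 1 <= ln n.+1%:R :> R by near: n; exact: near_ln_ge.
have L0 : ln n.+1%:R != 0 :> R by rewrite gt_eqF// (lt_le_trans ltr01).
have p0 : 0 < (p_beatty alpha n.+1)%:R :> R by near: n; exact: p_beatty_gt0.
rewrite /powR pnatr_eq0 /= -expRN -expRD -[LHS]lnK ?posrE//; congr expR.
rewrite -sqrt_growth_all// /e; move: (ln (p_beatty _ _)%:R) (Num.sqrt _) => ? ?.
by move: (ln _) L0 => l l0; field; rewrite l0 gt_eqF.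
Unshelve. all: by end_near.
Qed.

Theorem p_beatty_equiv : cvgn (J1_partial alpha) ->
  cvgn (Lambda_prod_partial alpha) /\
  (fun n => (p_beatty alpha n)%:R) ~_\oo
    (fun n : nat => expR (2 * pi * Num.sqrt (n%:R / (6 * alpha)))
         / (Lambda alpha * n%:R `^ (1 - 1 / (4 * alpha)))).
Proof.
move=> Jc; have [l l0 hl] := Lambda_prod_cvg a1 Jc.
split; first by apply/cvg_ex; exists l.
have g0 : 0 < pi * expR (- euler_gamma R) by rewrite mulr_gt0 ?pi_gt0 ?expR_gt0.
have a60 : 0 < alpha / 6 by rewrite divr_gt0.
have s3 : 0 < Num.sqrt 3 :> R by rewrite sqrtr_gt0.
have LE : Lambda alpha = 4 * Num.sqrt 3 * (pi * expR (- euler_gamma R)) `^ (1 / (2 * alpha))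
  * (alpha / 6) `^ (1 / (4 * alpha)) * l by rewrite /Lambda (cvg_lim _ hl).
have c1 : 0 < 4 * Num.sqrt 3 :> R by rewrite mulr_gt0.
have c2 : 0 < (pi * expR (- euler_gamma R)) `^ (1 / (2 * alpha)) by rewrite powR_gt0.
have c3 : 0 < (alpha / 6) `^ (1 / (4 * alpha)) by rewrite powR_gt0.
have c12 := mulr_gt0 c1 c2; have c123 := mulr_gt0 c12 c3; have c1234 := mulr_gt0 c123 l0.
have lL : ln (Lambda alpha) = 2 * ln 2 + ln 3 / 2 + (ln pi - euler_gamma R) / (2 * alpha)
    + (ln alpha - (ln 2 + ln 3)) / (4 * alpha) + ln l.
  rewrite LE lnM ?posrE// lnM ?posrE// lnM ?posrE// lnM ?posrE// !ln_powR.
  rewrite lnM ?posrE ?pi_gt0 ?expR_gt0// expRK ln_sqrt// ln_div ?posrE//.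
  rewrite (_ : 4 = 2 * 2 :> R); last by rewrite -natrM.
  rewrite (_ : 6 = 2 * 3 :> R); last by rewrite -natrM.
  rewrite !lnM ?posrE//.
  move: (ln pi) (ln alpha) (ln l) (ln 2) (ln 3) (euler_gamma R) => *.
  by field; rewrite gt_eqF.
have L0 : 0 < Lambda alpha by rewrite LE.
apply: equiv_of_ln; first exact: p_beatty_gt0.
  by move=> n; rewrite divr_gt0 ?expR_gt0// mulr_gt0// powR_gt0.
rewrite -(subrr (p_const - ln l)).
apply: cvg_near_eq (cvgB (cvgB ln_p_beatty (frac_error_cvg Jc l0 hl)) (cvg_cst _)).
apply: nearW => n; rewrite !fctE.
have p3 : 0 < n.+1%:R `^ (1 - 1 / (4 * alpha)) :> R by rewrite powR_gt0.
have p4 := mulr_gt0 L0 p3.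
rewrite ln_div ?posrE ?expR_gt0// expRK lnM ?posrE// ln_powR lL.
rewrite -sqrt_growth_all// /p_const ln_growth_all ln_2sqrtpi lnM ?posrE ?pi_gt0//.
move: (ln (p_beatty _ _)%:R) (Num.sqrt _) (frac_error n) => ? ? ?.
move: (ln n.+1%:R) (ln alpha) (ln pi) (ln 2) (ln 3) (ln l) (euler_gamma R) => *.
by field; rewrite gt_eqF.
Qed.

End Asymptotics.

Theorem theorem1p1 (R : realType) (alpha : R)
    (alpha_gt1 : 1 < alpha) (alpha_irr : irrational alpha) :
  [/\ (fun n : nat => (q_beatty alpha n)%:R)
        ~_\oo
      (fun n : nat =>
         expR (pi * Num.sqrt (n%:R / (3 * alpha)))
         / (2 `^ (2 - 1 / (2 * alpha)) * (3 * alpha) `^ (1 / 4)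
            * n%:R `^ (3 / 4))),
      exists2 e : nat -> R, e @ \oo --> (0 : R) &
        \forall n \near \oo,
          (p_beatty alpha n)%:R =
          expR (2 * pi * Num.sqrt (n%:R / (6 * alpha)))
          / n%:R `^ (1 - 1 / (4 * alpha) + e n)
    & cvgn (J1_partial alpha) ->
      cvgn (Lambda_prod_partial alpha) /\
      (fun n : nat => (p_beatty alpha n)%:R)
        ~_\oo
      (fun n : nat =>
         expR (2 * pi * Num.sqrt (n%:R / (6 * alpha)))
         / (Lambda alpha * n%:R `^ (1 - 1 / (4 * alpha))))].
Proof.
split.
- exact: q_beatty_equiv.
- exact: p_beatty_exponent.
- exact: p_beatty_equiv.
Qed.
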